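(* Let $U\subset\mathbb{R}$ be an open subset, let $\mu$ be the Lebesgue measure on $U$, and let $\Pi(x,y)$ be a kernel yielding a locally trace-class operator of orthogonal projection acting in $L_2(\mathbb{R},\mu)$ (that is, in $L_2(U)$). Assume that there exist $\alpha\in(0,1/2)$, $\varepsilon>0$, and, for any $R>0$, a constant $C(R)>0$ such that the following holds: (1) for all $x,y\in U$ with $x\ne y$ and $|x|,|y|\ge R$, $$|\Pi(x,y)|\le C(R)\cdot\frac{|x/y|^{\alpha}+|y/x|^{\alpha}}{|x-y|};$$ (2) for all $y\in U$, $$\int_{\{x\in U:\,|x|\le R\}}|\Pi(x,y)|^2\,d\mu(x)\le\frac{C(R)}{1+|y|^{1+\varepsilon}}.$$ Then the determinantal point process $\mathbb{P}_{\Pi}$ on $\mathbb{R}$ is rigid.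
   Context: Let $M$ be a complete separable metric space. A configuration on $M$ is a collection of particles in $M$, considered without regard to order and without accumulation points (a purely atomic Radon measure); $\mathrm{Conf}(M)$ is the space of configurations with the vague topology, and a point process on $M$ is a Borel probability measure on $\mathrm{Conf}(M)$. For a bounded Borel set $B\subset M$ and $X\in\mathrm{Conf}(M)$, $\#_B(X)$ is the number of particles of $X$ in $B$. For Borel $C\subset M$, $\mathcal{F}_C$ is the $\sigma$-algebra generated by all $\#_B$ with $B\subset C$ bounded Borel, and $\mathcal{F}_C^{\mathbb{P}}$ is its $\mathbb{P}$-completion. A point process $\mathbb{P}$ on $M$ is called rigid if for every bounded Borel $B\subset M$ the random variable $\#_B$ is $\mathcal{F}^{\mathbb{P}}_{M\setminus B}$-measurable. An operator $\Pi$ is locally trace-class if $\chi_B\Pi\chi_B$ is trace class for each bounded Borel set $B\subset\mathbb{R}$, where $\chi_B$ is the indicator of $B$. For the kernel $\Pi(x,y)$ of a locally trace-class orthogonal projection in $L_2(\mathbb{R},\mu)$, the determinantal point process $\mathbb{P}_\Pi$ is the unique Borel probability measure on $\mathrm{Conf}(\mathbb{R})$ such that for any bounded measurable $g$ with $g-1$ supported in a bounded set $B$, $$\mathbb{E}_{\mathbb{P}_\Pi}\Psi_g=\det\bigl(1+(g-1)\Pi\chi_B\bigr),\qquad \Psi_g(X)=\prod_{x\in X}g(x).$$ *)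

(* Defs.v *)
From HB Require Import structures.
From mathcomp Require Import all_boot all_order all_algebra.
From mathcomp Require Import all_classical all_reals all_analysis.
From mathcomp Require Import complex.

Set Implicit Arguments.
Unset Strict Implicit.
Unset Printing Implicit Defensive.

Import Order.TTheory GRing.Theory Num.Theory.
Import numFieldTopology.Exports numFieldNormedType.Exports.

Local Open Scope classical_set_scope.
Local Open Scope ring_scope.
Local Open Scope complex_scope.

(** * Complex-valued integration *)

Section complex_integration.
Context {d : measure_display} {T : measurableType d} {R : realType}.
Variables (mu : {measure set T -> \bar R}) (D : set T).
Implicit Types f : T -> R[i].

Definition cmeasurable f :=
  measurable_fun D (fun x => complex.Re (f x)) /\
  measurable_fun D (fun x => complex.Im (f x)).

Definition cintegrable f :=
  mu.-integrable D (EFin \o (fun x => complex.Re (f x))) /\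
  mu.-integrable D (EFin \o (fun x => complex.Im (f x))).

Definition cintegral f : R[i] :=
  (\int[mu]_(x in D) complex.Re (f x))%R +i*
  (\int[mu]_(x in D) complex.Im (f x))%R.

End complex_integration.

(** * Operators on the complex Hilbert space L^2(D, mu)

    Vectors are represented by functions, equality of vectors being equality
    almost everywhere on [D]; operators act on representatives. *)

Section L2_operators.
Context {d : measure_display} {T : measurableType d} {R : realType}.
Variables (mu : {measure set T -> \bar R}) (D : set T).
Implicit Types (f h : T -> R[i]) (A S : (T -> R[i]) -> (T -> R[i])).
Implicit Types e : nat -> T -> R[i].

Definition ae_on_eq f h := {ae mu, forall x, D x -> f x = h x}.

Definition square_integrable f :=
  cmeasurable D f /\
  (\int[mu]_(x in D) ((ComplexField.Normc.normc (f x)) ^+ 2)%:E < +oo)%E.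

Definition inner f h : R[i] := cintegral mu D (fun x => f x * (h x)^*).

Definition L2norm f : R := Num.sqrt (complex.Re (inner f f)).

Definition bounded_operator A :=
  [/\ forall f, square_integrable f -> square_integrable (A f),
      forall (a : R[i]) f h, square_integrable f -> square_integrable h ->
        ae_on_eq (A (fun x => a * f x + h x)) (fun x => a * A f x + A h x)
    & exists M : R, forall f, square_integrable f ->
        L2norm (A f) <= M * L2norm f].

Definition positive_operator A :=
  forall f, square_integrable f -> 0 <= inner (A f) f.

Definition orthogonal_projection A :=
  [/\ bounded_operator A,
      forall f, square_integrable f -> ae_on_eq (A (A f)) (A f)
    & forall f h, square_integrable f -> square_integrable h ->
        inner (A f) h = inner f (A h)].

(** A countable orthonormal basis, padded with null vectors: this covers
    finite-dimensional spaces (e.g. [D] empty) with the index set [nat]. *)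
Definition orthonormal_basis e :=
  [/\ forall n, square_integrable (e n),
      forall n, inner (e n) (e n) = 1 \/ inner (e n) (e n) = 0,
      forall m n, m <> n -> inner (e m) (e n) = 0
    & forall f, square_integrable f -> (forall n, inner f (e n) = 0) ->
        ae_on_eq f (fun=> 0)].

(** [S] is the positive square root |A| of A^* A. *)
Definition is_absolute_value A S :=
  [/\ bounded_operator S, positive_operator S
    & forall f h, square_integrable f -> square_integrable h ->
        inner (S (S f)) h = inner (A f) (A h)].

(** tr |A| < oo *)
Definition trace_class A :=
  bounded_operator A /\
  exists S e, [/\ is_absolute_value A S, orthonormal_basis e
    & (\sum_(0 <= n <oo) (complex.Re (inner (S (e n)) (e n)))%:E < +oo)%E].

(** For an orthonormal basis [e], the vectors e_{i_1} /\ ... /\ e_{i_n} with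
    i_1 < ... < i_n form an orthonormal basis of the n-th exterior power;
    [ext_trace e A n N] is the part of tr (Lambda^n A) with indices < N. *)
Definition ext_trace e A (n N : nat) : R[i] :=
  \sum_(s : {ffun 'I_n -> 'I_N} | [forall i : 'I_n, forall j : 'I_n, (i < j)%N ==> (s i < s j)%N])
    \det (\matrix_(i < n, j < n) inner (A (e (s j))) (e (s i))).

(** det(1 + A) = \sum_n tr (Lambda^n A), the traces being computed in the
    orthonormal basis [e]; for A of trace class the result does not depend
    on [e]. *)
Definition is_fredholm_det e A (z : R[i]) :=
  exists c : nat -> R[i],
    (forall n, ext_trace e A n N @[N --> \oo] --> (c n : R[i]^o)) /\
    (\sum_(0 <= k < n) c k @[n --> \oo] --> (z : R[i]^o)).

Definition mul_operator (h f : T -> R[i]) : T -> R[i] := fun x => h x * f x.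

Definition kernel_operator (K : T -> T -> R[i]) (f : T -> R[i]) : T -> R[i] :=
  fun x => cintegral mu D (fun y => K x y * f y).

Definition cindic (B : set T) : T -> R[i] := fun x => (\1_B x)%:C.

(** [K] is the kernel of an orthogonal projection: the integrals defining the
    operator converge absolutely for almost every x. *)
Definition projection_kernel (K : T -> T -> R[i]) :=
  [/\ cmeasurable (D `*` D) (fun p : T * T => K p.1 p.2),
      forall f, square_integrable f ->
        {ae mu, forall x, D x -> cintegrable mu D (fun y => K x y * f y)}
    & orthogonal_projection (kernel_operator K)].

End L2_operators.

Definition locally_trace_class {R : realType} (U : set R)
    (A : (R -> R[i]) -> (R -> R[i])) :=
  forall B : set R, measurable B -> bounded_set B ->
    trace_class lebesgue_measure U
      (mul_operator (cindic B) \o A \o mul_operator (cindic B)).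

(** * Configurations and point processes on the line *)

(** A configuration is given by the multiplicities of its particles. *)
Record conf (R : realType) := Conf {
  mult :> R -> nat ;
  mult_locally_finite : forall B : set R, bounded_set B ->
    finite_set (B `&` [set x | mult x != 0%N]) }.

Lemma conf0_subproof (R : realType) (B : set R) : bounded_set B ->
  finite_set (B `&` [set x | (fun=> 0%N : nat) x != 0%N]).
Proof.
move=> _; apply: (@sub_finite_set _ _ set0); last exact: finite_set0.
by move=> x [].
Qed.

HB.instance Definition _ (R : realType) := gen_eqMixin (conf R).
HB.instance Definition _ (R : realType) := gen_choiceMixin (conf R).
HB.instance Definition _ (R : realType) :=
  isPointed.Build (conf R) (Conf (@conf0_subproof R)).

Definition test_fun (R : realType) :=
  {f : R -> R | continuous f /\ compact (closure [set x | f x != 0])}.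

(** X |-> (\int f dX)_f, the integral against X being a finite sum. *)
Definition conf_pairing {R : realType} (X : conf R) :
    prod_topology (fun _ : test_fun R => R) :=
  fun f => \sum_(x \in [set: R]) (sval f x *+ X x).

Definition vague (R : realType) := initial_topology (@conf_pairing R).

(** The space of configurations with the Borel sigma-algebra of the vague
    topology. *)
Definition confB (R : realType) := g_sigma_algebraType (@open (vague R)).

Definition num_particles {R : realType} (B : set R) (X : conf R) : nat :=
  \big[addn/0%N]_(x \in B) X x.

Definition sigma_count {R : realType} (C : set R) : set_system (conf R) :=
  <<s [set E | exists (B : set R) (S : set nat),
        [/\ measurable B, bounded_set B, B `<=` C & E = num_particles B @^-1` S]] >>.

(** The completion adjoins all the [P]-null sets of the space of
    configurations, not only the subsets of null sets belonging to
    [sigma_count C]. *)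
Definition sigma_count_completed {R : realType} (P : probability (confB R) R)
    (C : set R) : set_system (conf R) :=
  <<s sigma_count C `|` P.-negligible >>.

Definition rigid {R : realType} (P : probability (confB R) R) :=
  forall B : set R, measurable B -> bounded_set B ->
  forall S : set nat, sigma_count_completed P (~` B) (num_particles B @^-1` S).

Definition mult_functional {R : realType} (g : R -> R[i]) (X : conf R) : R[i] :=
  \big[*%R/1]_(x \in [set: R]) (g x ^+ X x).

(** [P] is the determinantal point process with kernel [K] on [U]. All the
    Fredholm determinants are computed in one orthonormal basis [e]; as
    (g - 1) K \chi_B is of trace class, its choice is irrelevant. *)
Definition is_determinantal {R : realType} (U : set R) (K : R -> R -> R[i])
    (P : probability (confB R) R) :=
  exists e, orthonormal_basis lebesgue_measure U e /\
  forall (g : R -> R[i]) (B : set R),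
    cmeasurable setT g ->
    (exists M : R, forall x, ComplexField.Normc.normc (g x) <= M) ->
    measurable B -> bounded_set B -> (forall x, ~ B x -> g x = 1) ->
    cintegrable P setT (mult_functional g) /\
    is_fredholm_det lebesgue_measure U e
      (mul_operator (fun x => g x - 1) \o kernel_operator lebesgue_measure U K
         \o mul_operator (cindic B))
      (cintegral P setT (mult_functional g)).

(* Main.v *)
From HB Require Import structures.
From mathcomp Require Import all_boot all_order all_algebra.
From mathcomp Require Import all_classical all_reals all_analysis.
From mathcomp Require Import measurable_realfun.
From mathcomp Require Import complex ring lra zify.
Require Import Defs.

Set Implicit Arguments.
Unset Strict Implicit.
Unset Printing Implicit Defensive.

Import Order.TTheory GRing.Theory Num.Theory.
Import numFieldTopology.Exports numFieldNormedType.Exports.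

Local Open Scope classical_set_scope.
Local Open Scope ring_scope.
Local Open Scope complex_scope.

Local Notation Re := complex.Re.
Local Notation Im := complex.Im.
Local Notation normc := ComplexField.Normc.normc.

(** The particles in [B] are counted by linear statistics of the particles
    outside [B], up to deterministic constants and an error that vanishes
    almost surely.

    Suppose that functions f_n equal 1 on [B], have bounded support, and that
    the linear statistics S_n(X) = \sum_(x in X) f_n(x) satisfy
    \sum_n Var S_n < oo. Then S_n - E S_n tends to 0 almost surely. Since S_n
    is the sum of #_B and of the statistic of f_n restricted to the complement
    of [B], the number #_B is almost surely the limit of
    E S_n - \sum_(x in X \ B) f_n(x), and every term of this sequence is
    measurable with respect to the configuration outside [B]. This is
    [rigid_of_cutoffs].

    The f_n are logarithmic cutoffs [logcut r L]: equal to 1 for |x| <= r,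
    equal to 1 - ln(|x|/r)/L up to |x| = r e^L, and 0 beyond. Their variance is
    O(1/L), hence L = 2^n is a suitable choice. Two facts give this bound.

    The first one is the variance inequality for determinantal processes with
    a projection kernel ([linstat_variance]):
    Var S_f <= 1/2 \iint (f(x) - f(y))^2 |Pi(x,y)|^2 dx dy.
    The generating function z |-> E \prod_(x in X) (1 + z f(x)) is a Fredholm
    determinant det(1 + z f Pi chi), a power series in z whose coefficients are
    the traces of the exterior powers of f Pi chi. On the other hand, for f of
    bounded support the product is squeezed between polynomials of degree at
    most 3 in z with coefficients that are integrable in X ([psi_taylor]), so
    E S_f and E \sum_(pairs) f(x) f(y) are the first two coefficients
    ([linstat_moments]). It remains to express tr(f Pi chi) and
    tr((f Pi chi)^2), computed as limits of partial sums in the given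
    orthonormal basis, as double integrals of |Pi|^2. Both traces are obtained
    by polarization from sums of squares, to which the identity between the
    Hilbert-Schmidt norm in a basis and the L^2 norm of the kernel
    applies ([hs_cvg], [hs_cvg2], [amat_trace_cvg], [amat_trace2_cvg]). That
    identity is Parseval applied to every section of the kernel, and
    Parseval for a maximal orthonormal family needs the completeness of L^2
    ([riesz_fischer], [parseval]).

    The second one is an estimate of the double integral ([wint_logcut]). If
    |x| <= r < |y| or the other way round, the decay of the integral of
    |Pi(x,y)|^2 over |x| <= r beats the growth of ln(|y|/r)^2 and leaves
    O(1/L^2). If both points are far, say r < |x| <= |y|, the cutoff varies by
    at most ln(|y|/|x|)/L, and this logarithm compensates the singularity of the
    kernel bound on the diagonal; with delta = 1/2 - alpha, the integrand is at
    most a constant times L^-2 |x|^(delta-1) |y|^(-1-delta)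
    ([kernel_log_bound]). The integral in y gives |x|^-1, and the integral of
    |x|^-1 over r <= |x| <= r e^L is of order L, whence O(1/L) in total. *)

(** * Complex numbers by real and imaginary parts *)

Section complex_prelim.
Context {R : realType}.
Implicit Types x y z : R[i].

Lemma ReM x y : Re (x * y) = Re x * Re y - Im x * Im y.
Proof. by case: x y => [a b] [c d]. Qed.

Lemma ImM x y : Im (x * y) = Re x * Im y + Im x * Re y.
Proof. by case: x y => [a b] [c d]; rewrite /= addrC. Qed.

Lemma ReD x y : Re (x + y) = Re x + Re y.
Proof. by case: x y => [a b] [c d]. Qed.

Lemma ImD x y : Im (x + y) = Im x + Im y.
Proof. by case: x y => [a b] [c d]. Qed.

Lemma ReN x : Re (- x) = - Re x.
Proof. by case: x => [a b]. Qed.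

Lemma ImN x : Im (- x) = - Im x.
Proof. by case: x => [a b]. Qed.

Lemma ReJ x : Re x^* = Re x.
Proof. by case: x => [a b]. Qed.

Lemma ImJ x : Im x^* = - Im x.
Proof. by case: x => [a b]. Qed.

(** Inside ring expressions [^*] is read as [Num.conj] rather than [conjc]; with
    these forms [reimE] handles both. *)
Lemma ReJ' x : Re (Num.conj x) = Re x. Proof. exact: ReJ. Qed.

Lemma ImJ' x : Im (Num.conj x) = - Im x. Proof. exact: ImJ. Qed.

Lemma complex_ext x y : Re x = Re y -> Im x = Im y -> x = y.
Proof. by case: x y => [a b] [c d] /= -> ->. Qed.

Lemma sqr_normcE x : normc x ^+ 2 = Re x ^+ 2 + Im x ^+ 2.
Proof. by case: x => a b /=; rewrite sqr_sqrtr// addr_ge0// sqr_ge0. Qed.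

Definition reimE := (ReM, ImM, ReD, ImD, ReN, ImN, ReJ, ImJ, ReJ', ImJ').

Lemma Re_sum (I : Type) (r : seq I) (P : pred I) (F : I -> R[i]) :
  Re (\sum_(i <- r | P i) F i) = \sum_(i <- r | P i) Re (F i).
Proof. exact: (big_morph (@Re R) ReD (erefl _)). Qed.

Lemma normc_ge0 x : 0 <= normc x.
Proof. by case: x => a b /=; exact: sqrtr_ge0. Qed.

Lemma Re_le_normc x : `|Re x| <= normc x.
Proof.
rewrite -(@ler_pXn2r _ 2)// ?nnegrE ?normc_ge0// sqr_normcE real_normK ?num_real//.
by rewrite lerDl sqr_ge0.
Qed.

Lemma mulcJ x : x * x^* = (normc x ^+ 2)%:C.
Proof.
by apply: complex_ext; rewrite !reimE ?sqr_normcE /=; ring.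
Qed.

Lemma conjcD x y : (x + y)^* = x^* + y^*.
Proof. by apply: complex_ext; rewrite !reimE// opprD. Qed.

Lemma conjc_sum (I : Type) (r : seq I) (P : pred I) (F : I -> R[i]) :
  (\sum_(i <- r | P i) F i)^* = \sum_(i <- r | P i) conjc (F i).
Proof. apply: (big_morph (@conjc R) conjcD); exact: conjc0. Qed.

Lemma sumrC (I : Type) (r : seq I) (P : pred I) (F : I -> R) :
  (\sum_(i <- r | P i) F i)%:C = \sum_(i <- r | P i) (F i)%:C%C.
Proof. by apply: (big_morph (fun a : R => a%:C) (id1 := 0) (op1 := +%R)) => // a b; apply: complex_ext; rewrite /= ?addr0. Qed.

Lemma sqr_normcM x y : normc (x * y) ^+ 2 = normc x ^+ 2 * normc y ^+ 2.
Proof. by rewrite !sqr_normcE !reimE; ring. Qed.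

Lemma sqr_normcJ x : normc (x^*) ^+ 2 = normc x ^+ 2.
Proof. by rewrite !sqr_normcE !reimE; ring. Qed.

Lemma sqr_normcR (a : R) : normc (a%:C) ^+ 2 = a ^+ 2.
Proof. by rewrite sqr_normcE /= expr0n addr0. Qed.

Lemma sqr_normc_eq0 x : normc x ^+ 2 = 0 -> x = 0.
Proof. by move/eqP; rewrite sqrf_eq0 => /eqP; exact: ComplexField.Normc.eq0_normc. Qed.

End complex_prelim.

(** * Square-integrable functions *)

Section L2_basics.
Context {d : measure_display} {T : measurableType d} {R : realType}.
Variables (mu : {measure set T -> \bar R}) (D : set T).
Hypothesis mD : measurable D.
Implicit Types f g h : T -> R[i].
Implicit Types r s : T -> R.

Local Notation rint r := (mu.-integrable D (EFin \o r)).
Local Notation L2 := (square_integrable mu D).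
Local Notation inner := (inner mu D).

Lemma rint_lin (a b : R) r s : rint r -> rint s -> rint (fun x => a * r x + b * s x).
Proof.
move=> ir is_.
have := integrableD mD (integrableZl mD a ir) (integrableZl mD b is_).
by apply: eq_integrable => // x _ /=; rewrite -!EFinM -EFinD.
Qed.

Lemma Rintegral_lin (a b : R) r s : rint r -> rint s ->
  (\int[mu]_(x in D) (a * r x + b * s x) =
   a * \int[mu]_(x in D) r x + b * \int[mu]_(x in D) s x)%R.
Proof.
move=> ir is_.
rewrite RintegralD//; last 2 first.
- by have := integrableZl mD a ir; apply: eq_integrable.
- by have := integrableZl mD b is_; apply: eq_integrable.
by rewrite !RintegralZl.
Qed.

Lemma rint_eq r s : (forall x, D x -> r x = s x) -> rint r -> rint s.
Proof.
by move=> rs; apply: eq_integrable => // x; rewrite inE => Dx /=; rewrite rs.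
Qed.

Lemma cintegrable_eq f g : (forall x, D x -> f x = g x) ->
  cintegrable mu D f -> cintegrable mu D g.
Proof.
by move=> fg [h1 h2]; split; [move: h1|move: h2]; apply: rint_eq => x Dx; rewrite fg.
Qed.

Lemma cintegral_eq f g : (forall x, D x -> f x = g x) ->
  cintegral mu D f = cintegral mu D g.
Proof.
by move=> fg; congr (_ +i* _); apply: eq_Rintegral => x; rewrite inE => Dx; rewrite fg.
Qed.

Lemma cintegrable_lin (a : R[i]) f g : cintegrable mu D f -> cintegrable mu D g ->
  cintegrable mu D (fun x => a * f x + g x).
Proof.
move=> [rf If] [rg Ig]; split.
- have := rint_lin 1 1 (rint_lin (Re a) (- Im a) rf If) rg.
  by apply: rint_eq => x _; rewrite !reimE; ring.
- have := rint_lin 1 1 (rint_lin (Im a) (Re a) rf If) Ig.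
  by apply: rint_eq => x _; rewrite !reimE; ring.
Qed.

Lemma cintegral_lin (a : R[i]) f g : cintegrable mu D f -> cintegrable mu D g ->
  cintegral mu D (fun x => a * f x + g x) =
  a * cintegral mu D f + cintegral mu D g.
Proof.
move=> [rf If] [rg Ig]; apply: complex_ext; rewrite !reimE /cintegral /=.
- rewrite -mulNr -[X in X + _]Rintegral_lin// -[X in _ + X]mul1r -[X in X + _]mul1r.
  rewrite -Rintegral_lin//; last exact: rint_lin.
  by apply: eq_Rintegral => x _; rewrite !reimE; ring.
- rewrite -[X in X + _]Rintegral_lin// -[X in _ + X]mul1r -[X in X + _]mul1r.
  rewrite -Rintegral_lin//; last exact: rint_lin.
  by apply: eq_Rintegral => x _; rewrite !reimE; ring.
Qed.

Lemma cintegralJ f : cintegrable mu D f ->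
  cintegral mu D (fun x => (f x)^*) = (cintegral mu D f)^*.
Proof.
move=> [rf If]; apply: complex_ext; rewrite !reimE /cintegral /=.
  by apply: eq_Rintegral => x _; rewrite !reimE.
rewrite -mulN1r -RintegralZl//; apply: eq_Rintegral => x _; rewrite !reimE; ring.
Qed.

Lemma cmeas_eq f g : (forall x, D x -> f x = g x) ->
  cmeasurable D f -> cmeasurable D g.
Proof.
move=> fg [h1 h2]; split; [move: h1|move: h2]; apply: eq_measurable_fun => x;
by rewrite inE => Dx; rewrite fg.
Qed.

Lemma cmeasD f g : cmeasurable D f -> cmeasurable D g -> cmeasurable D (fun x => f x + g x).
Proof.
move=> [f1 f2] [g1 g2]; split.
- apply: (eq_measurable_fun (fun x => Re (f x) + Re (g x))); last exact: measurable_funD.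
  by move=> x _; rewrite !reimE.
- apply: (eq_measurable_fun (fun x => Im (f x) + Im (g x))); last exact: measurable_funD.
  by move=> x _; rewrite !reimE.
Qed.

Lemma cmeasM f g : cmeasurable D f -> cmeasurable D g -> cmeasurable D (fun x => f x * g x).
Proof.
move=> [f1 f2] [g1 g2]; split.
- apply: (eq_measurable_fun (fun x => Re (f x) * Re (g x) - Im (f x) * Im (g x))).
    by move=> x _; rewrite !reimE.
  by apply: measurable_funB; exact: measurable_funM.
- apply: (eq_measurable_fun (fun x => Re (f x) * Im (g x) + Im (f x) * Re (g x))).
    by move=> x _; rewrite !reimE.
  by apply: measurable_funD; exact: measurable_funM.
Qed.

Lemma cmeasJ f : cmeasurable D f -> cmeasurable D (fun x => (f x)^*).
Proof.
move=> [f1 f2]; split.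
- by move: f1; apply: eq_measurable_fun => x _; rewrite reimE.
- have := measurableT_comp (@oppr_measurable R setT) f2.
  by apply: eq_measurable_fun => x _; rewrite /= reimE.
Qed.

Lemma cmeas_cst (a : R[i]) : cmeasurable D (fun=> a).
Proof. by split; exact: measurable_cst. Qed.

Lemma cmeasR r : measurable_fun D r -> cmeasurable D (fun x => (r x)%:C).
Proof. by move=> mr; split => //=; exact: measurable_cst. Qed.

Lemma meas_sqr_normc f : cmeasurable D f -> measurable_fun D (fun x => normc (f x) ^+ 2).
Proof.
move=> [f1 f2]; apply: (eq_measurable_fun (fun x => Re (f x) ^+ 2 + Im (f x) ^+ 2)).
  by move=> x _; rewrite sqr_normcE.
by apply: measurable_funD; exact: measurable_funX.
Qed.

Lemma L2_meas f : L2 f -> cmeasurable D f.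
Proof. by case. Qed.

Lemma L2_rint f : L2 f -> rint (fun x => normc (f x) ^+ 2).
Proof.
move=> [mf fi]; apply/integrableP; split.
  by apply/measurable_EFinP; exact: meas_sqr_normc.
rewrite (le_lt_trans _ fi)// le_eqVlt; apply/orP; left; apply/eqP.
by apply: eq_integral => x _ /=; rewrite ger0_norm// sqr_ge0.
Qed.

Lemma rint_dom r s : measurable_fun D r -> (forall x, D x -> `|r x| <= s x) ->
  rint s -> rint r.
Proof.
move=> mr rs; apply: le_integrable => //; first exact/measurable_EFinP.
move=> x Dx /=; rewrite lee_fin (le_trans (rs _ Dx))//; exact: ler_norm.
Qed.

Lemma L2_eq f g : (forall x, D x -> f x = g x) -> L2 f -> L2 g.
Proof.
move=> fg [mf fi]; split; first exact: cmeas_eq mf.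
rewrite (le_lt_trans _ fi)// le_eqVlt; apply/orP; left; apply/eqP.
by apply: eq_integral => x; rewrite inE => Dx; rewrite fg.
Qed.

Lemma L2_dom f r : cmeasurable D f -> (forall x, D x -> normc (f x) ^+ 2 <= r x) ->
  rint r -> L2 f.
Proof.
move=> mf fr ir; split => //.
have : rint (fun x => normc (f x) ^+ 2).
  apply: rint_dom ir; first exact: meas_sqr_normc.
  by move=> x Dx; rewrite ger0_norm ?sqr_ge0// fr.
by move=> /(integrable_lty mD).
Qed.

Lemma L2_lin (a : R[i]) f g : L2 f -> L2 g -> L2 (fun x => a * f x + g x).
Proof.
move=> Lf Lg; apply: (L2_dom (r := fun x => 2 * normc a ^+ 2 * normc (f x) ^+ 2 + 2 * normc (g x) ^+ 2)).
- apply: cmeasD; last exact: L2_meas.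
  by apply: cmeasM; [exact: cmeas_cst|exact: L2_meas].
- move=> x Dx; rewrite -[2 * _ * _]mulrA -sqr_normcM !sqr_normcE !reimE.
  move: (Re a * Re (f x) - Im a * Im (f x)) (Re a * Im (f x) + Im a * Re (f x)) => u v.
  move: (Re (g x)) (Im (g x)) => w z.
  have := sqr_ge0 (u - w); have := sqr_ge0 (v - z); nra.
- by apply: rint_lin; exact: L2_rint.
Qed.

Lemma L2Z (a : R[i]) f : L2 f -> L2 (fun x => a * f x).
Proof.
move=> Lf; have := L2_lin (a - 1) Lf Lf; apply: L2_eq => x _; ring.
Qed.

Lemma L2D f g : L2 f -> L2 g -> L2 (fun x => f x + g x).
Proof. by move=> Lf Lg; have := L2_lin 1 Lf Lg; apply: L2_eq => x _; ring. Qed.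

Lemma L2B f g : L2 f -> L2 g -> L2 (fun x => f x - g x).
Proof. by move=> Lf Lg; have := L2_lin (-1) Lg Lf; apply: L2_eq => x _; ring. Qed.

Lemma L20 : L2 (fun=> 0).
Proof.
split; first exact: cmeas_cst.
rewrite integral0_eq ?ltry// => x _.
by rewrite sqr_normcE /= expr0n addr0.
Qed.

Lemma L2_sum (I : Type) (s : seq I) (F : I -> T -> R[i]) : (forall i, L2 (F i)) ->
  L2 (fun x => \sum_(i <- s) F i x).
Proof.
move=> LF; elim: s => [|a s ih].
  by have := L20; apply: L2_eq => x _; rewrite big_nil.
by have := L2D (LF a) ih; apply: L2_eq => x _; rewrite big_cons.
Qed.

Lemma L2J f : L2 f -> L2 (fun x => (f x)^*).
Proof.
move=> Lf; apply: L2_dom (L2_rint Lf); first exact/cmeasJ/L2_meas.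
by move=> x _; rewrite sqr_normcJ.
Qed.

Lemma L2_bdd f g (M : R) : cmeasurable D g -> (forall x, D x -> normc (g x) ^+ 2 <= M) ->
  L2 f -> L2 (fun x => g x * f x).
Proof.
move=> mg gM Lf.
apply: (L2_dom (r := fun x => M * normc (f x) ^+ 2 + 0 * normc (f x) ^+ 2)).
- by apply: cmeasM => //; exact: L2_meas.
- by move=> x Dx; rewrite sqr_normcM mul0r addr0 ler_wpM2r ?sqr_ge0 ?gM.
- by apply: rint_lin; exact: L2_rint.
Qed.

(** Both parts of the product are dominated by |f|^2 + |g|^2. *)
Lemma L2_cintegrable f g : L2 f -> L2 g -> cintegrable mu D (fun x => f x * g x).
Proof.
move=> Lf Lg; have mfg := cmeasM (L2_meas Lf) (L2_meas Lg).
have H (r : T -> R) : measurable_fun D r ->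
    (forall x, D x -> `|r x| <= normc (f x) ^+ 2 + normc (g x) ^+ 2) -> rint r.
  move=> mr rb; apply: rint_dom mr _ (rint_lin 1 1 (L2_rint Lf) (L2_rint Lg)).
  by move=> x Dx; rewrite !mul1r rb.
split; apply: H; [exact: mfg.1| |exact: mfg.2|] => x _.
- rewrite reimE !sqr_normcE ler_norml; move: (Re (f x)) (Im (f x)) (Re (g x)) (Im (g x)) => a b c e.
  have := sqr_ge0 (a - c); have := sqr_ge0 (a + c); have := sqr_ge0 (b - e); have := sqr_ge0 (b + e).
  by move=> *; apply/andP; split; nra.
- rewrite reimE !sqr_normcE ler_norml; move: (Re (f x)) (Im (f x)) (Re (g x)) (Im (g x)) => a b c e.
  have := sqr_ge0 (a - e); have := sqr_ge0 (a + e); have := sqr_ge0 (b - c); have := sqr_ge0 (b + c).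
  by move=> *; apply/andP; split; nra.
Qed.

Lemma inner_cintegrable f g : L2 f -> L2 g -> cintegrable mu D (fun x => f x * (g x)^*).
Proof. by move=> Lf Lg; apply: L2_cintegrable => //; exact: L2J. Qed.

Lemma inner_lin (a : R[i]) f g h : L2 f -> L2 g -> L2 h ->
  inner (fun x => a * f x + g x) h = a * inner f h + inner g h.
Proof.
move=> Lf Lg Lh; rewrite /Defs.inner -cintegral_lin//; try exact: inner_cintegrable.
by apply: cintegral_eq => x _; rewrite mulrDl mulrA.
Qed.

Lemma innerC f g : L2 f -> L2 g -> inner g f = (inner f g)^*.
Proof.
move=> Lf Lg; rewrite /Defs.inner -cintegralJ; last exact: inner_cintegrable.
by apply: cintegral_eq => x _; apply: complex_ext; rewrite !reimE; ring.
Qed.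

Lemma inner_eq f f' g g' : (forall x, D x -> f x = f' x) -> (forall x, D x -> g x = g' x) ->
  inner f g = inner f' g'.
Proof. by move=> ff gg; apply: cintegral_eq => x Dx; rewrite ff// gg. Qed.

Lemma innerD f g h : L2 f -> L2 g -> L2 h ->
  inner (fun x => f x + g x) h = inner f h + inner g h.
Proof.
move=> Lf Lg Lh; rewrite -[inner f h]mul1r -inner_lin//.
by apply: inner_eq => // x _; rewrite mul1r.
Qed.

Lemma inner0l h : inner (fun=> 0) h = 0.
Proof.
apply: complex_ext; rewrite /= /Rintegral; under eq_integral do rewrite mul0r /=;
by rewrite integral0.
Qed.

Lemma innerZ (a : R[i]) f h : L2 f -> L2 h ->
  inner (fun x => a * f x) h = a * inner f h.
Proof.
move=> Lf Lh; rewrite -[RHS]addr0 -(inner0l h) -inner_lin//; last exact: L20.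
by apply: inner_eq => // x _; rewrite addr0.
Qed.

Lemma innerB f g h : L2 f -> L2 g -> L2 h ->
  inner (fun x => f x - g x) h = inner f h - inner g h.
Proof.
move=> Lf Lg Lh; rewrite addrC -mulN1r -inner_lin//.
by apply: inner_eq => // x _; rewrite addrC mulN1r.
Qed.

Lemma innerBr f g h : L2 f -> L2 g -> L2 h ->
  inner h (fun x => f x - g x) = inner h f - inner h g.
Proof.
move=> Lf Lg Lh; rewrite innerC//; last exact: L2B.
rewrite innerB// (innerC Lf Lh) (innerC Lg Lh); apply: complex_ext; rewrite !reimE//; ring.
Qed.

Lemma inner_sum (I : Type) (s : seq I) (F : I -> T -> R[i]) h : (forall i, L2 (F i)) -> L2 h ->
  inner (fun x => \sum_(i <- s) F i x) h = \sum_(i <- s) inner (F i) h.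
Proof.
move=> LF Lh; elim: s => [|a s ih].
  by rewrite big_nil -[RHS](inner0l h); apply: inner_eq => // x _; rewrite big_nil.
rewrite big_cons -ih -innerD//; last exact: L2_sum.
by apply: inner_eq => // x _; rewrite big_cons.
Qed.

Definition sqnorm f : R := Re (inner f f).

Lemma sqnorm_Re f : sqnorm f = Re (inner f f). Proof. by []. Qed.

Lemma Re_inner f : Re (inner f f) = (\int[mu]_(x in D) (normc (f x) ^+ 2))%R.
Proof. by apply: eq_Rintegral => x _; rewrite mulcJ. Qed.

Lemma Im_inner f : Im (inner f f) = 0.
Proof.
rewrite /= /Rintegral; under eq_integral do rewrite mulcJ /=.
by rewrite integral0.
Qed.

Lemma sqnormE f : L2 f -> (\int[mu]_(x in D) (normc (f x) ^+ 2)%:E)%E = (sqnorm f)%:E.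
Proof.
move=> Lf; rewrite /sqnorm Re_inner /Rintegral fineK//.
exact: (integrable_fin_num mD (L2_rint Lf)).
Qed.

Lemma sqnorm_ge0 f : 0 <= sqnorm f.
Proof. by rewrite /sqnorm Re_inner; apply: Rintegral_ge0 => x _; exact: sqr_ge0. Qed.

Lemma innerE_sqnorm f : inner f f = (sqnorm f)%:C.
Proof. by apply: complex_ext => //; rewrite Im_inner. Qed.

Lemma sqnormB f g : L2 f -> L2 g ->
  sqnorm (fun x => f x - g x) = sqnorm f + sqnorm g - 2 * Re (inner f g).
Proof.
move=> Lf Lg; rewrite /sqnorm innerB ?innerBr//; try exact: L2B.
rewrite (innerC Lf Lg) !reimE; ring.
Qed.

(** Operators act on representatives, so identities between images hold only
    almost everywhere; the inner product does not see the difference. *)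
Lemma ae_eq_inner f f' g g' : L2 f -> L2 f' -> L2 g -> L2 g' ->
  ae_on_eq mu D f f' -> ae_on_eq mu D g g' -> inner f g = inner f' g'.
Proof.
move=> Lf Lf' Lg Lg' ff gg.
have I := inner_cintegrable Lf Lg; have I' := inner_cintegrable Lf' Lg'.
apply: complex_ext; rewrite /= /Rintegral; congr fine; apply: ae_eq_integral => //.
- exact: (measurable_int mu I.1).
- exact: (measurable_int mu I'.1).
- by apply: filterS2 ff gg => x ff gg Dx; rewrite ff ?gg.
- exact: (measurable_int mu I.2).
- exact: (measurable_int mu I'.2).
- by apply: filterS2 ff gg => x ff gg Dx; rewrite ff ?gg.
Qed.

End L2_basics.

(** * Completeness of L^2 and the Parseval identity *)

Section limits.
Context {d : measure_display} {T : measurableType d} {R : realType}.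
Variables (mu : {measure set T -> \bar R}) (D : set T).
Hypothesis mD : measurable D.

(** Fatou with a uniform bound, in the form used to pass a norm bound to a
    pointwise limit. *)
Lemma fatou_le (f_ : nat -> T -> \bar R) (f : T -> \bar R) (c : \bar R) :
  (forall n, measurable_fun D (f_ n)) -> (forall n x, D x -> (0 <= f_ n x)%E) ->
  (forall x, D x -> f_ n x @[n --> \oo] --> f x) ->
  (forall n, \int[mu]_(x in D) f_ n x <= c)%E -> (\int[mu]_(x in D) f x <= c)%E.
Proof.
move=> mf f0 fcv fc.
rewrite (eq_integral (fun x => limn_einf (f_ ^~ x))); last first.
  move=> x; rewrite inE => Dx; have H := fcv x Dx.
  rewrite is_cvg_limn_einfE; last by apply/cvg_ex; exists (f x).
  by apply/esym/cvg_lim.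
apply: (le_trans (@fatou _ _ _ mu _ mD _ mf f0)).
rewrite limn_einf_lim; apply: lime_le; first exact: is_cvg_einfs.
apply: nearW => n; apply: le_trans (fc n).
by apply: ereal_inf_lbound; exists n => //=.
Qed.

End limits.

Section series_prelim.
Context {R : realType}.

Lemma geom_half_le n : \sum_(k < n) ((2^-1 : R) ^+ k) <= 2.
Proof.
have -> : \sum_(k < n) ((2^-1 : R) ^+ k) = 2 - 2 * 2^-1 ^+ n.
  elim: n => [|n ih]; first by rewrite big_ord0 expr0; ring.
  by rewrite big_ord_recr /= ih exprS; field.
by rewrite gerBl mulr_ge0// exprn_ge0// invr_ge0.
Qed.

Lemma geom_quarter_le n : \sum_(k < n) ((2 : R) ^+ k * (8^-1) ^+ k) <= 2.
Proof.
apply: le_trans (geom_half_le n); apply: ler_sum => k _.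
rewrite -exprMn lerXn2r// ?nnegrE; lra.
Qed.

(** With weights 2^k, square summability of the increments controls their
    absolute sum: |a| <= (2^k a^2 + 2^-k) / 2. *)
Lemma cvg_weighted_sqr (u : nat -> R) (C : R) :
  (forall n, \sum_(k < n) (2 ^+ k * (u k.+1 - u k) ^+ 2) <= C) -> cvgn u.
Proof.
move=> uC.
have H : cvgn (series (telescope u)).
  apply: normed_cvg; apply: nondecreasing_is_cvgn.
    apply/nondecreasing_seqP => n; rewrite /normed_series_of /series /= !big_mkord.
    by rewrite [X in _ <= X]big_ord_recr /= lerDl.
  exists ((C + 2) / 2) => _ [n _ <-]; rewrite /normed_series_of /series /= big_mkord.
  have := lerD (uC n) (geom_half_le n); rewrite -big_split /= => le1.
  rewrite ler_pdivlMr// mulr_suml; apply: le_trans le1.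
  apply: ler_sum => k _; rewrite /telescope /=; set r := u k.+1 - u k.
  have p0 : 0 < (2 : R) ^+ k by exact: exprn_gt0.
  rewrite exprVn; have := sqr_ge0 (2 ^+ k * `|r| - 1).
  rewrite -(real_normK (num_real r)); set a := `|r|; set p := 2 ^+ k in p0 *.
  move=> h; rewrite -(ler_pM2r p0) mulrDl mulVf ?gt_eqF//; nra.
have -> : u = (fun n => u 0%N + series (telescope u) n).
  by apply/funext => n; exact: eq_sum_telescope.
by apply: is_cvgD => //; exact: is_cvg_cst.
Qed.

End series_prelim.

Section hilbert.
Context {d : measure_display} {T : measurableType d} {R : realType}.
Variables (mu : {measure set T -> \bar R}) (D : set T).
Hypothesis mD : measurable D.
Implicit Types f g h : T -> R[i].
Local Notation L2 := (square_integrable mu D).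
Local Notation inner := (inner mu D).
Local Notation sqnorm := (sqnorm mu D).

(** The squared norm of h - t <h,g> g is a quadratic polynomial in t that is
    nowhere negative; t = 1/|g|^2 gives the inequality, and when |g| = 0 a large
    t forces <h,g> = 0. *)
Lemma cauchy_schwarz h g : L2 h -> L2 g ->
  normc (inner h g) ^+ 2 <= sqnorm h * sqnorm g.
Proof.
move=> Lh Lg; have [c cE] : exists c, inner h g = c by eexists.
rewrite cE; set q := normc c ^+ 2.
have key (t : R) : 0 <= sqnorm h + t ^+ 2 * q * sqnorm g - 2 * t * q.
  have := sqnorm_ge0 mu D (fun x => h x - t%:C * c * g x).
  rewrite sqnormB//; last exact: L2Z.
  have -> : sqnorm (fun x => t%:C * c * g x) = t ^+ 2 * q * sqnorm g.
    rewrite [LHS]sqnorm_Re innerZ//; last exact: L2Z.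
    rewrite innerC//; last exact: L2Z.
    rewrite innerZ// innerE_sqnorm !reimE /q sqr_normcE /=; ring.
  rewrite innerC//; last exact: L2Z.
  by rewrite innerZ// [inner g h]innerC// cE !reimE /q sqr_normcE /=; congr (0 <= _); ring.
have q0 : 0 <= q by exact: sqr_ge0.
have g0 := sqnorm_ge0 mu D g; have h0 := sqnorm_ge0 mu D h.
have [gg|gn] := eqVneq (sqnorm g) 0.
  rewrite gg mulr0; have [->//|qn] := eqVneq q 0.
  have qp : 0 < q by rewrite lt_neqAle eq_sym qn.
  (* At this value of t the polynomial is -|h|^2 - 2, so q > 0 is impossible. *)
  have := key ((sqnorm h + 1) / q).
  have -> : sqnorm h + ((sqnorm h + 1) / q) ^+ 2 * q * sqnorm g - 2 * ((sqnorm h + 1) / q) * q =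
    - sqnorm h - 2 by rewrite gg; field.
  lra.
have gp : 0 < sqnorm g by rewrite lt_neqAle eq_sym gn.
have := key (sqnorm g)^-1.
have -> : sqnorm h + (sqnorm g)^-1 ^+ 2 * q * sqnorm g - 2 * (sqnorm g)^-1 * q = sqnorm h - q / sqnorm g by field.
by rewrite subr_ge0 ler_pdivrMr.
Qed.

Lemma inner_sqnorm0 h g : L2 h -> L2 g -> sqnorm g = 0 -> inner h g = 0.
Proof.
move=> Lh Lg g0; have := cauchy_schwarz Lh Lg; rewrite g0 mulr0 => le0.
by apply: sqr_normc_eq0; apply/eqP; rewrite eq_le le0 sqr_ge0.
Qed.

(** The weighted sum G of the squared increments has finite integral, hence is
    finite almost everywhere; where it is finite, u_k converges pointwise by
    [cvg_weighted_sqr], and Fatou transfers the norm bounds to the limit. The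
    ratio 1/8 leaves room for the weights 2^k. *)
Lemma riesz_fischer (u : nat -> T -> R[i]) : (forall n, L2 (u n)) ->
  (forall k j, (k <= j)%N -> sqnorm (fun x => u j x - u k x) <= 8^-1 ^+ k) ->
  exists s, L2 s /\ forall k, sqnorm (fun x => s x - u k x) <= 8^-1 ^+ k.
Proof.
move=> Lu cu.
pose t k x := 2 ^+ k * normc (u k.+1 x - u k x) ^+ 2.
have mt k : measurable_fun D (EFin \o t k).
  apply/measurable_EFinP; apply: measurable_funM => //.
  by apply: meas_sqr_normc; apply: L2_meas; exact: L2B.
have t0 k x : (0 <= (t k x)%:E)%E.
  by rewrite lee_fin; apply: mulr_ge0; [exact: exprn_ge0|exact: sqr_ge0].
pose G x := (\sum_(0 <= k <oo) (t k x)%:E)%E.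
have mG : measurable_fun D G.
  have -> : G = (fun x => (\sum_(0 <= k <oo | k \in xpredT) (t k x)%:E)%E) by [].
  apply: (@ge0_emeasurable_sum _ _ _ D (fun k x => (t k x)%:E) xpredT) => [k x _ _|k _].
    exact: t0.
  exact: mt.
have G0 x : (0 <= G x)%E by exact: nneseries_ge0.
have iG : (\int[mu]_(x in D) G x <= 2%:E)%E.
  rewrite integral_nneseries//.
  apply: lime_le; first by apply: is_cvg_nneseries => n _ _; exact: integral_ge0.
  apply: nearW => n; rewrite big_mkord.
  apply: (@le_trans _ _ (\sum_(k < n) (2 ^+ k * 8^-1 ^+ k)%:E)%E).
    apply: lee_sum => k _.
    rewrite (eq_integral (fun x => (2 ^+ k)%:E * (normc (u k.+1 x - u k x) ^+ 2)%:E)%E)//.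
    rewrite ge0_integralZl//; last 2 first.
    - by apply/measurable_EFinP; apply: meas_sqr_normc; apply: L2_meas; exact: L2B.
    - by move=> x _; rewrite lee_fin sqr_ge0.
    by rewrite sqnormE//; [rewrite -EFinM lee_fin ler_wpM2l ?exprn_ge0 ?cu|exact: L2B].
  by rewrite sumEFin lee_fin geom_quarter_le.
have intG : mu.-integrable D G.
  apply/integrableP; split => //.
  rewrite (eq_integral G); last by move=> x _; rewrite gee0_abs.
  exact: le_lt_trans iG (ltry _).
pose b x := (G x < +oo)%E.
have mb : measurable_fun D b.
  by apply: measurable_fun_lte => //; exact: measurable_cst.
have aeb : {ae mu, forall x, D x -> b x}.
  apply: filterS (integrable_ae mD intG) => x H Dx; rewrite /b.
  by have := H Dx; rewrite fin_numElt => /andP[].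
(* Discard the null set where G is infinite, so that the limit exists
   everywhere and is measurable. *)
pose v k x := if b x then u k x else 0.
have mv k : cmeasurable D (v k).
  have [m1 m2] := L2_meas (Lu k).
  split.
  - apply: (eq_measurable_fun (fun x => if b x then Re (u k x) else 0)).
      by move=> x _; rewrite /v; case: (b x).
    by apply: measurable_fun_if => //; apply: (measurable_funS mD (@subIsetl _ _ _)).
  - apply: (eq_measurable_fun (fun x => if b x then Im (u k x) else 0)).
      by move=> x _; rewrite /v; case: (b x).
    by apply: measurable_fun_if => //; apply: (measurable_funS mD (@subIsetl _ _ _)).
have cv (p : R[i] -> R) (pB : forall x y, p (x - y) = p x - p y)
    (ple : forall x, p x ^+ 2 <= normc x ^+ 2) x : cvgn (fun k => p (v k x)).
  rewrite /v; case: (boolP (b x)) => bx; last by exact: is_cvg_cst.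
  apply: (cvg_weighted_sqr (C := fine (G x))) => n.
  rewrite -lee_fin fineK; last by rewrite ge0_fin_numE.
  rewrite -sumEFin; have := @nneseries_lim_ge R (fun k => (t k x)%:E) xpredT 0 n (fun k _ _ => t0 k x).
  apply: le_trans; rewrite big_mkord; apply: lee_sum => k _.
  by rewrite lee_fin ler_wpM2l ?exprn_ge0// -pB ple.
have cvRe x : cvgn (fun k => Re (v k x)).
  apply: cv => [y z|y]; first by rewrite !reimE.
  by rewrite sqr_normcE lerDl sqr_ge0.
have cvIm x : cvgn (fun k => Im (v k x)).
  apply: cv => [y z|y]; first by rewrite !reimE.
  by rewrite sqr_normcE lerDr sqr_ge0.
pose s x := limn (fun k => Re (v k x)) +i* limn (fun k => Im (v k x)).
have ms : cmeasurable D s.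
  split; [apply: (measurable_fun_cvg (fun k => (mv k).1))|apply: (measurable_fun_cvg (fun k => (mv k).2))].
  - by move=> x _; exact: cvRe.
  - by move=> x _; exact: cvIm.
have key k : (\int[mu]_(x in D) (normc (s x - u k x) ^+ 2)%:E <= (8^-1 ^+ k)%:E)%E.
  apply: (fatou_le mD (f_ := fun j x => (normc (v (j + k)%N x - u k x) ^+ 2)%:E)).
  - move=> j; apply/measurable_EFinP; apply: meas_sqr_normc.
    have : cmeasurable D (fun x => v (j + k)%N x + (-1) * u k x).
      apply: cmeasD => //; apply: cmeasM; first exact: cmeas_cst.
      exact: L2_meas.
    by apply: cmeas_eq => x _; rewrite mulN1r.
  - by move=> j x _; rewrite lee_fin sqr_ge0.
  - move=> x Dx; apply: cvg_EFin; first exact: nearW.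
    rewrite (_ : _ \o _ = (fun j => (Re (v (j + k)%N x) - Re (u k x)) ^+ 2 +
       (Im (v (j + k)%N x) - Im (u k x)) ^+ 2)); last first.
      by apply/funext => j /=; rewrite sqr_normcE !reimE.
    rewrite /= sqr_normcE !reimE /=; apply: cvgD; rewrite expr2; under eq_fun do rewrite expr2;
      (apply: cvgM; (apply: cvgB; last exact: cvg_cst)).
    - by rewrite (cvg_shiftn k (fun j => Re (v j x))); exact: cvRe.
    - by rewrite (cvg_shiftn k (fun j => Re (v j x))); exact: cvRe.
    - by rewrite (cvg_shiftn k (fun j => Im (v j x))); exact: cvIm.
    - by rewrite (cvg_shiftn k (fun j => Im (v j x))); exact: cvIm.
  - move=> j; have := cu k (j + k)%N (leq_addl _ _).
    rewrite -lee_fin -sqnormE//; last exact: L2B.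
    apply: le_trans; rewrite le_eqVlt; apply/orP; left; apply/eqP.
    apply: ge0_ae_eq_integral => //.
    + apply/measurable_EFinP; apply: meas_sqr_normc.
      have : cmeasurable D (fun x => v (j + k)%N x + (-1) * u k x).
        apply: cmeasD => //; apply: cmeasM; first exact: cmeas_cst.
        exact: L2_meas.
      by apply: cmeas_eq => x _; rewrite mulN1r.
    + by apply/measurable_EFinP; apply: meas_sqr_normc; apply: L2_meas; exact: L2B.
    + by move=> x _; rewrite lee_fin sqr_ge0.
    + by move=> x _; rewrite lee_fin sqr_ge0.
    + by apply: filterS aeb => x H Dx; rewrite /v H.
have Lsu : L2 (fun x => s x - u 0%N x).
  split; last exact: le_lt_trans (key 0%N) (ltry _).
  have : cmeasurable D (fun x => s x + (-1) * u 0%N x).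
    by apply: cmeasD => //; apply: cmeasM; [exact: cmeas_cst|exact: L2_meas].
  by apply: cmeas_eq => x _; rewrite mulN1r.
have Ls : L2 s.
  by have := L2D mD Lsu (Lu 0%N); apply: L2_eq => x _; rewrite subrK.
by exists s; split => // k; rewrite -lee_fin -sqnormE//; exact: L2B.
Qed.

Section parseval.
Variable e : nat -> T -> R[i].
Hypothesis he : orthonormal_basis mu D e.

Lemma onb_L2 n : L2 (e n). Proof. by case: he. Qed.

(** Padding vectors have norm 0, so their coefficients vanish and the two cases
    of the normalization agree here. *)
Lemma onb_coef h n : L2 h -> inner h (e n) * inner (e n) (e n) = inner h (e n).
Proof.
move=> Lh; case: he => _ /(_ n) [] E _ _; first by rewrite E mulr1.
rewrite [in RHS]inner_sqnorm0 ?E ?mulr0//; first exact: onb_L2.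
by rewrite sqnorm_Re E.
Qed.

Definition partial_expansion h n x := \sum_(k < n) (inner h (e k) * e k x).

Lemma partial_expansion_L2 h n : L2 (partial_expansion h n).
Proof. by apply: L2_sum => // i; apply: L2Z => //; exact: onb_L2. Qed.

Lemma inner_partial_expansion h n g : L2 g ->
  inner (partial_expansion h n) g = \sum_(k < n) inner h (e k) * inner (e k) g.
Proof.
move=> Lg; rewrite inner_sum//; last by move=> i; apply: L2Z => //; exact: onb_L2.
by apply: eq_bigr => i _; rewrite innerZ//; exact: onb_L2.
Qed.

Lemma coef_partial_expansion h n m : L2 h -> (m < n)%N ->
  inner (partial_expansion h n) (e m) = inner h (e m).
Proof.
move=> Lh mn; rewrite inner_partial_expansion; last exact: onb_L2.
rewrite (bigD1 (Ordinal mn))//= onb_coef// big1 ?addr0// => i im.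
case: he => _ _ eo _; rewrite eo ?mulr0// => iE; move/eqP: im; apply.
exact: val_inj.
Qed.

Definition bessel_sum h n : R := \sum_(k < n) normc (inner h (e k)) ^+ 2.

Lemma inner_partial_expansion2 h n m : L2 h -> (n <= m)%N ->
  inner (partial_expansion h n) (partial_expansion h m) = (bessel_sum h n)%:C.
Proof.
move=> Lh nm; rewrite inner_partial_expansion; last exact: partial_expansion_L2.
rewrite sumrC; apply: eq_bigr => i _.
rewrite (innerC mD (partial_expansion_L2 h m) (onb_L2 i)).
by rewrite coef_partial_expansion ?mulcJ//; exact: leq_trans nm.
Qed.

Lemma inner_partial_expansionr h n : L2 h ->
  inner h (partial_expansion h n) = (bessel_sum h n)%:C.
Proof.
move=> Lh; rewrite innerC//; last exact: partial_expansion_L2.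
rewrite inner_partial_expansion// conjc_sum sumrC; apply: eq_bigr => i _.
rewrite (innerC mD Lh (onb_L2 i)) -[RHS]mulcJ.
by apply: complex_ext; rewrite !reimE; ring.
Qed.

Lemma sqnorm_partial_expansion h n : L2 h -> sqnorm (partial_expansion h n) = bessel_sum h n.
Proof. by move=> Lh; rewrite /sqnorm inner_partial_expansion2. Qed.

Lemma sqnorm_residual h n : L2 h ->
  sqnorm (fun x => h x - partial_expansion h n x) = sqnorm h - bessel_sum h n.
Proof.
move=> Lh; rewrite sqnormB//; last exact: partial_expansion_L2.
rewrite sqnorm_partial_expansion// inner_partial_expansionr//=; ring.
Qed.

Lemma sqnorm_partial_expansionB h n m : L2 h -> (n <= m)%N ->
  sqnorm (fun x => partial_expansion h m x - partial_expansion h n x) =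
  bessel_sum h m - bessel_sum h n.
Proof.
move=> Lh nm; have Ln := partial_expansion_L2 h n; have Lm := partial_expansion_L2 h m.
rewrite sqnormB// !sqnorm_partial_expansion// innerC// inner_partial_expansion2// !reimE /=; ring.
Qed.

Lemma bessel_sum_nd h : {homo bessel_sum h : n m / (n <= m)%N >-> n <= m}.
Proof.
apply/nondecreasing_seqP => n; rewrite /bessel_sum big_ord_recr /= lerDl; exact: sqr_ge0.
Qed.

Lemma bessel h n : L2 h -> bessel_sum h n <= sqnorm h.
Proof. by move=> Lh; rewrite -subr_ge0 -sqnorm_residual// sqnorm_ge0. Qed.

(** Bessel makes the partial expansions Cauchy; a fast subsequence converges to
    some s by completeness. All the coefficients of h - s vanish, hence h = s
    almost everywhere by maximality of the family, and the residual norms tend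
    to 0. *)
Lemma parseval_cvg h : L2 h -> bessel_sum h n @[n --> \oo] --> sqnorm h.
Proof.
move=> Lh.
have cB : cvgn (bessel_sum h).
  apply: nondecreasing_is_cvgn; first exact: bessel_sum_nd.
  by exists (sqnorm h) => _ [n _ <-]; exact: bessel.
set l := limn (bessel_sum h) in cB *.
have leB n : bessel_sum h n <= l by apply: nondecreasing_cvgn_le => //; exact: bessel_sum_nd.
have /choice [N NP] : forall k, exists n, forall m, (n <= m)%N -> l - bessel_sum h m <= 8^-1 ^+ k.
  move=> k; have p : 0 < (8^-1 : R) ^+ k by rewrite exprn_gt0.
  have [n _ H] := (cvgrPdist_le _ _).1 cB _ p; exists n => m nm.
  by apply: le_trans (H m nm); exact: ler_norm.
(* A nondecreasing majorant of N, also larger than k. *)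
pose M k := \sum_(j < k.+1) (N j).+1.
have NM k : (N k <= M k)%N by rewrite /M big_ord_recr /= (leq_trans (leqnSn _))// leq_addl.
have Mnd : {homo M : n m / (n <= m)%N >-> (n <= m)%N}.
  apply: homo_leq => // [a b c|k]; first exact: leq_trans.
  by rewrite /M [X in (_ <= X)%N]big_ord_recr /= leq_addr.
pose u k := partial_expansion h (M k).
have [s [Ls sP]] : exists s, L2 s /\ forall k, sqnorm (fun x => s x - u k x) <= 8^-1 ^+ k.
  apply: riesz_fischer => [n|k j kj]; first exact: partial_expansion_L2.
  rewrite sqnorm_partial_expansionB//; last exact: Mnd.
  by apply: le_trans (NP k (M k) (NM k)); rewrite lerB.
have Lhs := L2B mD Lh Ls.
(* Once n < M k, the expansion u_k has the same n-th coefficient as h. *)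
have cs n : inner s (e n) = inner h (e n).
  have en1 : sqnorm (e n) <= 1.
    by case: he => _ /(_ n) [] E _ _; rewrite /sqnorm E.
  apply/eqP; rewrite -subr_eq0; apply/eqP; apply: sqr_normc_eq0; apply/eqP; rewrite eq_le sqr_ge0 andbT.
  have H k : (n < M k)%N -> normc (inner s (e n) - inner h (e n)) ^+ 2 <= 8^-1 ^+ k.
    move=> nMk; rewrite -(coef_partial_expansion Lh nMk) -innerB//; [|exact: partial_expansion_L2|exact: onb_L2].
    apply: le_trans (cauchy_schwarz _ (onb_L2 n)) _; first by apply: L2B => //; exact: partial_expansion_L2.
    apply: le_trans (sP k); rewrite -[X in _ <= X]mulr1.
    by apply: ler_wpM2l => //; exact: sqnorm_ge0.
  have : (8^-1 : R) ^+ k @[k --> \oo] --> 0.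
    by apply: cvg_expr; rewrite ger0_norm; lra.
  move=> p0.
  have kM k : (k < M k)%N.
    elim: k => [|k ih]; first by rewrite /M big_ord_recr /=; lia.
    have -> : M k.+1 = (M k + (N k.+1).+1)%N by rewrite /M [in LHS]big_ord_recr.
    by lia.
  apply: (cvgr_to_ge p0); exists n => // k /= nk; apply: H; exact: leq_ltn_trans (kM k).
have hs : ae_on_eq mu D (fun x => h x - s x) (fun=> 0).
  case: he => _ _ _ H; apply: H => // n.
  by rewrite innerB//; [rewrite cs subrr|exact: onb_L2].
have res k : sqnorm h - bessel_sum h (M k) <= 8^-1 ^+ k.
  rewrite -sqnorm_residual//; apply: le_trans (sP k).
  rewrite /sqnorm (@ae_eq_inner _ _ _ _ _ mD _ (fun x => s x - u k x) _ (fun x => s x - u k x))//; try (apply: L2B => //; exact: partial_expansion_L2).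
    by apply: filterS hs => x H Dx; rewrite -/(u k) -[h x](subrK (s x)) H// add0r.
  by apply: filterS hs => x H Dx; rewrite -/(u k) -[h x](subrK (s x)) H// add0r.
suff -> : sqnorm h = l by [].
apply/eqP; rewrite eq_le; apply/andP; split; last first.
  by apply: limr_le => //; apply: nearW => n; exact: bessel.
apply/ler_addgt0Pr => z z0.
have : (8^-1 : R) ^+ k @[k --> \oo] --> 0.
  by apply: cvg_expr; rewrite ger0_norm; lra.
move=> /(cvgrPdist_le _ _).1 /(_ _ z0) [k _ /(_ k (leqnn k))].
rewrite sub0r normrN ger0_norm ?exprn_ge0// => kz.
have := res k; have := leB (M k); move: kz; rewrite /=; lra.
Qed.

Lemma parseval h : L2 h ->
  (\sum_(0 <= k <oo) (normc (inner h (e k)) ^+ 2)%:E)%E = (sqnorm h)%:E.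
Proof.
move=> Lh; apply/cvg_lim => //.
rewrite (_ : (fun _ => _) = EFin \o bessel_sum h).
  by apply: cvg_EFin; [exact: nearW|exact: parseval_cvg].
by apply/funext => n; rewrite /= sumEFin big_mkord.
Qed.

End parseval.
End hilbert.

(** * Double sums and double integrals *)

Section array.
Context {R : realType}.

Lemma cvg_sum_ord (J : nat) (f : nat -> nat -> R) (l : nat -> R) :
  (forall j, f j n @[n --> \oo] --> l j) ->
  \sum_(j < J) f j n @[n --> \oo] --> \sum_(j < J) l j.
Proof.
move=> fl; elim: J => [|J ih].
  rewrite big_ord0 (_ : (fun _ => _) = fun=> 0); first exact: cvg_cst.
  by apply/funext => n; rewrite big_ord0.
rewrite big_ord_recr (_ : (fun _ => _) = fun n => \sum_(j < J) f j n + f J n).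
  by apply: cvgD => //; exact: fl.
by apply/funext => n; rewrite big_ord_recr.
Qed.

(** For nonnegative entries, sums over the growing squares have the same limit
    as sums of complete rows: a finite number of rows carries almost all of the
    total. *)
Lemma cvg_square_sum (a : nat -> nat -> R) (s : nat -> R) (S : R) :
  (forall j i, 0 <= a j i) ->
  (forall j, \sum_(i < n) a j i @[n --> \oo] --> s j) ->
  \sum_(j < n) s j @[n --> \oo] --> S ->
  \sum_(j < n) \sum_(i < n) a j i @[n --> \oo] --> S.
Proof.
move=> a0 as_ sS.
have ndr j : {homo (fun n => \sum_(i < n) a j i) : n m / (n <= m)%N >-> n <= m}.
  by apply/nondecreasing_seqP => n; rewrite big_ord_recr /= lerDl.
have ale j n : \sum_(i < n) a j i <= s j.
  have <- : limn (fun n => \sum_(i < n) a j i) = s j by apply/cvg_lim => //; exact: as_.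
  by apply: nondecreasing_cvgn_le; [exact: ndr|apply/cvg_ex; exists (s j); exact: as_].
have s0 j : 0 <= s j by have := ale j 0%N; rewrite big_ord0.
have nds : {homo (fun n => \sum_(j < n) s j) : n m / (n <= m)%N >-> n <= m}.
  by apply/nondecreasing_seqP => n; rewrite big_ord_recr /= lerDl.
have sle n : \sum_(j < n) s j <= S.
  have <- : limn (fun n => \sum_(j < n) s j) = S by apply/cvg_lim => //; exact: sS.
  by apply: nondecreasing_cvgn_le => //; apply/cvg_ex; exists S.
apply/cvgrPdist_le => eps eps0.
have e2 : 0 < eps / 2 by rewrite divr_gt0.
have [J _ /(_ J (leqnn J)) HJ] := (cvgrPdist_le _ _).1 sS _ e2.
have cJ : \sum_(j < J) \sum_(i < n) a j i @[n --> \oo] --> \sum_(j < J) s j.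
  by have := @cvg_sum_ord J (fun j n => \sum_(i < n) a j i) s as_; apply.
have [K _ HK] := (cvgrPdist_le _ _).1 cJ _ e2.
exists (maxn J K) => // n /=; rewrite geq_max => /andP[Jn Kn].
have := HK n Kn; rewrite /= in HJ *.
(* The square of size n lies between its first J rows and the complete rows. *)
have le1 : \sum_(j < J) \sum_(i < n) a j i <= \sum_(j < n) \sum_(i < n) a j i.
  have nd : {homo (fun m => \sum_(j < m) \sum_(i < n) a j i) : p q / (p <= q)%N >-> p <= q}.
    by apply/nondecreasing_seqP => m; rewrite big_ord_recr /= lerDl sumr_ge0.
  exact: nd.
have le2 : \sum_(j < n) \sum_(i < n) a j i <= S.
  apply: le_trans (sle n); exact: ler_sum.
move=> h1; rewrite ger0_norm ?subr_ge0//.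
move: HJ h1 => /ler_normlP[_ h2] /ler_normlP[_ h3]; lra.
Qed.

End array.

Section double_integral.
Context {d : measure_display} {T : measurableType d} {R : realType}.
Variables (mu : {sigma_finite_measure set T -> \bar R}) (D : set T).
Hypothesis mD : measurable D.
Implicit Types w : T -> T -> R.

Definition meas2 w := measurable_fun (D `*` D) (fun p => w p.1 p.2).

Definition iint w : \bar R := (\int[mu]_(x in D) \int[mu]_(y in D) (w x y)%:E)%E.

Let mDD : measurable (D `*` D). Proof. exact: measurableX. Qed.

Lemma meas2_sec w x : meas2 w -> D x -> measurable_fun D (w x).
Proof.
move=> mw Dx; rewrite (_ : w x = (fun p => w p.1 p.2) \o pair x)//.
apply: (measurable_comp mDD _ mw); first by move=> _ [y Dy <-].
by apply: measurable_funS (@pair1_measurable _ _ T T x).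
Qed.

(** Extension by zero to the whole plane, on which the Tonelli theorem is
    available. *)
Definition ext w (p : T * T) : \bar R := (fun p => (w p.1 p.2)%:E) \_ (D `*` D) p.

Lemma meas_ext w : meas2 w -> measurable_fun setT (ext w).
Proof.
move=> mw; apply/(measurable_restrictT _ mDD).
by apply/measurable_EFinP.
Qed.

Lemma extE w x y : ext w (x, y) = (if (x \in D) && (y \in D) then (w x y)%:E else 0%E).
Proof. by rewrite /ext patchE in_setX. Qed.

Lemma integral_ext w x : D x -> (\int[mu]_(y in D) (w x y)%:E = \int[mu]_y ext w (x, y))%E.
Proof.
move=> Dx; rewrite integral_mkcond; apply: eq_integral => y _.
by rewrite extE patchE (mem_set Dx).
Qed.

Lemma iint_ext w : iint w = (\int[mu]_x \int[mu]_y ext w (x, y))%E.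
Proof.
rewrite /iint integral_mkcond; apply: eq_integral => x _; rewrite patchE.
case: ifPn => [|nx]; first by rewrite inE => /integral_ext.
by rewrite integral0_eq// => y _; rewrite extE (negbTE nx).
Qed.

Lemma ext_ge0 w : (forall x y, D x -> D y -> 0 <= w x y) -> forall p, (0 <= ext w p)%E.
Proof.
move=> w0 [x y]; rewrite extE; case: ifPn => // /andP[]; rewrite !inE => Dx Dy.
by rewrite lee_fin w0.
Qed.

Lemma meas_inner_integral w : meas2 w -> (forall x y, D x -> D y -> 0 <= w x y) ->
  measurable_fun D (fun x => \int[mu]_(y in D) (w x y)%:E)%E.
Proof.
move=> mw w0.
apply: (eq_measurable_fun (fun x => \int[mu]_y ext w (x, y))%E).
  by move=> x; rewrite inE => Dx; rewrite integral_ext.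
apply: (measurable_funS measurableT) => //.
exact: (@measurable_fun_fubini_tonelli_F _ _ _ _ _ mu _ (meas_ext mw) (ext_ge0 w0)).
Qed.

Lemma meas_inner_Rintegral w : meas2 w ->
  measurable_fun D (fun x => \int[mu]_(y in D) w x y)%R.
Proof.
move=> mw; have mW := meas_ext mw.
apply: (eq_measurable_fun (fun x => fine (\int[mu]_y (ext w)^\+ (x, y) - \int[mu]_y (ext w)^\- (x, y))%E)).
  move=> x; rewrite inE => Dx; rewrite /Rintegral integral_ext// [in RHS]integralE.
  by congr (fine (_ - _)%E); apply: eq_integral => y _; rewrite ?funeposE ?funenegE.
apply: (measurable_funS measurableT) => //.
apply: (measurableT_comp (@fine_measurable R setT measurableT)).
apply: emeasurable_funB.
- apply: (measurable_fun_fubini_tonelli_F (m2 := mu)) => //; exact: measurable_funepos.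
- apply: (measurable_fun_fubini_tonelli_F (m2 := mu)) => //; exact: measurable_funeneg.
Qed.

Lemma iint_swap w : meas2 w -> (forall x y, D x -> D y -> 0 <= w x y) ->
  iint w = iint (fun x y => w y x).
Proof.
move=> mw w0; rewrite !iint_ext.
rewrite (@fubini_tonelli _ _ _ _ _ mu mu _ (meas_ext mw) (ext_ge0 w0)).
by apply: eq_integral => x _; apply: eq_integral => y _; rewrite !extE andbC.
Qed.

Lemma iint_ge0 w : (forall x y, D x -> D y -> 0 <= w x y) -> (0 <= iint w)%E.
Proof.
by move=> w0; apply: integral_ge0 => x Dx; apply: integral_ge0 => y Dy; rewrite lee_fin w0.
Qed.

(** A domination that may fail on the diagonal, a null set for the product
    measure; this is where the kernel bound is not available. *)
Lemma iint_le w1 w2 : meas2 w1 -> meas2 w2 ->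
  (forall x y, D x -> D y -> 0 <= w1 x y) ->
  (forall x y, D x -> D y -> x <> y -> w1 x y <= w2 x y) ->
  (forall x y, D x -> D y -> 0 <= w2 x y) ->
  (forall x, mu [set x] = 0%E) -> (forall x : T, measurable ([set x] : set T)) ->
  (iint w1 <= iint w2)%E.
Proof.
move=> m1 m2 w10 w12 w20 mu0 ms; apply: ge0_le_integral => //.
- by move=> x Dx; apply: integral_ge0 => y Dy; rewrite lee_fin w10.
- exact: meas_inner_integral.
- exact: meas_inner_integral.
move=> x Dx; apply: ae_ge0_le_integral => //.
- by move=> y Dy; rewrite lee_fin w10.
- by apply/measurable_EFinP; exact: meas2_sec.
- by move=> y Dy; rewrite lee_fin w20.
- by apply/measurable_EFinP; exact: meas2_sec.
exists [set x]; split; [exact: ms|exact: mu0|] => y /=; apply: contra_notP => yx Dy.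
by rewrite lee_fin w12// => xy; apply: yx; rewrite xy.
Qed.

Lemma iintD w1 w2 : meas2 w1 -> meas2 w2 ->
  (forall x y, D x -> D y -> 0 <= w1 x y) ->
  (forall x y, D x -> D y -> 0 <= w2 x y) ->
  iint (fun x y => w1 x y + w2 x y) = (iint w1 + iint w2)%E.
Proof.
move=> m1 m2 w10 w20; rewrite /iint -ge0_integralD//; try exact: meas_inner_integral.
- apply: eq_integral => x; rewrite inE => Dx; rewrite -ge0_integralD//.
  + by move=> y Dy; rewrite lee_fin w10.
  + by apply/measurable_EFinP; exact: meas2_sec.
  + by move=> y Dy; rewrite lee_fin w20.
  + by apply/measurable_EFinP; exact: meas2_sec.
- by move=> x Dx; apply: integral_ge0 => y Dy; rewrite lee_fin w10.
- by move=> x Dx; apply: integral_ge0 => y Dy; rewrite lee_fin w20.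
Qed.

Lemma iintZ (c : R) w : 0 <= c -> meas2 w -> (forall x y, D x -> D y -> 0 <= w x y) ->
  iint (fun x y => c * w x y) = (c%:E * iint w)%E.
Proof.
move=> c0 mw w0; rewrite /iint -ge0_integralZl//; last 2 first.
- exact: meas_inner_integral.
- by move=> x Dx; apply: integral_ge0 => y Dy; rewrite lee_fin w0.
apply: eq_integral => x; rewrite inE => Dx; rewrite -ge0_integralZl//.
- by apply/measurable_EFinP; exact: meas2_sec.
- by move=> y Dy; rewrite lee_fin w0.
Qed.

Lemma iint_eq w1 w2 : (forall x y, D x -> D y -> w1 x y = w2 x y) -> iint w1 = iint w2.
Proof.
move=> ww; apply: eq_integral => x; rewrite inE => Dx; apply: eq_integral => y; rewrite inE => Dy.
by rewrite ww.
Qed.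

(** Monotone convergence, applied to the inner and then to the outer integral. *)
Lemma iint_mct (w_ : nat -> T -> T -> R) w : (forall n, meas2 (w_ n)) ->
  (forall n x y, D x -> D y -> 0 <= w_ n x y) ->
  (forall x y, D x -> D y -> {homo (fun n => w_ n x y) : n m / (n <= m)%N >-> n <= m}) ->
  (forall x y, D x -> D y -> w_ n x y @[n --> \oo] --> w x y) ->
  iint (w_ n) @[n --> \oo] --> iint w.
Proof.
move=> mw w0 nd cw.
have H x : D x -> (\int[mu]_(y in D) (w_ n x y)%:E @[n --> \oo] --> \int[mu]_(y in D) (w x y)%:E)%E.
  move=> Dx; rewrite (eq_integral (fun y => limn (fun n => (w_ n x y)%:E))); last first.
    move=> y; rewrite inE => Dy; apply/esym/cvg_lim => //.
    by apply: cvg_EFin; [exact: nearW|exact: cw].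
  apply: cvg_monotone_convergence => //.
  - by move=> n; apply/measurable_EFinP; exact: meas2_sec.
  - by move=> n y Dy; rewrite lee_fin w0.
  - by move=> y Dy n m nm; rewrite lee_fin nd.
rewrite {2}/iint (eq_integral (fun x => limn (fun n => \int[mu]_(y in D) (w_ n x y)%:E)%E)); last first.
  by move=> x; rewrite inE => Dx; apply/esym/cvg_lim => //; exact: H.
apply: cvg_monotone_convergence => //.
- by move=> n; apply: meas_inner_integral => // x y; exact: w0.
- by move=> n x Dx; apply: integral_ge0 => y Dy; rewrite lee_fin w0.
- move=> x Dx n m nm; apply: ge0_le_integral => //.
  + by move=> y Dy; rewrite lee_fin w0.
  + by apply/measurable_EFinP; exact: meas2_sec.
  + by apply/measurable_EFinP; exact: meas2_sec.
  + by move=> y Dy; rewrite lee_fin nd.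
Qed.

End double_integral.

(** * Hilbert-Schmidt kernels *)

Section hilbert_schmidt.
Context {d : measure_display} {T : measurableType d} {R : realType}.
Variables (mu : {sigma_finite_measure set T -> \bar R}) (D : set T).
Hypothesis mD : measurable D.
Variable e : nat -> T -> R[i].
Hypothesis he : orthonormal_basis mu D e.
Local Notation L2 := (square_integrable mu D).
Local Notation inner := (inner mu D).
Local Notation sqnorm := (sqnorm mu D).
Local Notation iint := (iint mu D).
Implicit Types L : T -> T -> R[i].

Definition hs_kernel L := cmeasurable (D `*` D) (fun p => L p.1 p.2) /\
  (iint (fun x y => (normc (L x y) ^+ 2)%R) < +oo)%E.

Lemma hs_meas2 L : cmeasurable (D `*` D) (fun p => L p.1 p.2) ->
  meas2 D (fun x y => (normc (L x y) ^+ 2)%R).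
Proof. by move=> mL; exact: (meas_sqr_normc mL). Qed.

Lemma kernel_operator_meas L f : cmeasurable (D `*` D) (fun p => L p.1 p.2) ->
  cmeasurable D f -> cmeasurable D (kernel_operator mu D L f).
Proof.
move=> mL mf.
have mf2 : cmeasurable (D `*` D) (fun p : T * T => f p.2).
  have H (r : T -> R) : measurable_fun D r -> measurable_fun (D `*` D) (fun p : T * T => r p.2).
    move=> mr; apply: (measurable_comp mD _ mr); first by move=> _ [[x y] [/= _ Dy] <-].
    by apply: measurable_funS measurable_snd => //.
  by case: mf => m1 m2; split; [apply: H m1|apply: H m2].
have [m1 m2] := cmeasM mL mf2.
split.
- exact: (@meas_inner_Rintegral _ _ _ _ _ mD (fun x y => Re (L x y * f y)) m1).
- exact: (@meas_inner_Rintegral _ _ _ _ _ mD (fun x y => Im (L x y * f y)) m2).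
Qed.

Lemma cmeas_sec L x : cmeasurable (D `*` D) (fun p => L p.1 p.2) -> D x -> cmeasurable D (L x).
Proof.
move=> [m1 m2] Dx; split.
- exact: (@meas2_sec _ _ _ _ mD (fun x y => Re (L x y)) x m1 Dx).
- exact: (@meas2_sec _ _ _ _ mD (fun x y => Im (L x y)) x m2 Dx).
Qed.

(** Applied to e_n, the operator computes at x the conjugate coefficients of the
    section L(x, .); Parseval sums their squares. *)
Lemma sqr_normc_kernel_operator L x : D x -> L2 (L x) ->
  (\sum_(0 <= n <oo) (normc (kernel_operator mu D L (e n) x) ^+ 2)%:E =
   \int[mu]_(y in D) (normc (L x y) ^+ 2)%R%:E)%E.
Proof.
move=> Dx LLx; have LJ := L2J mD LLx.
transitivity (\int[mu]_(y in D) (normc (conjc (L x y)) ^+ 2)%:E)%E; last first.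
  by apply: eq_integral => y _; rewrite sqr_normcJ.
rewrite (sqnormE mD LJ) -(parseval mD he LJ); apply: eq_eseriesr => n _; congr (_%:E).
have I : cintegrable mu D (fun y => L x y * e n y) by apply: L2_cintegrable => //; exact: (onb_L2 he).
rewrite /kernel_operator -sqr_normcJ -(cintegralJ mD I).
congr (normc _ ^+ 2); apply: cintegral_eq => y _.
by apply: complex_ext; rewrite !reimE; ring.
Qed.

Lemma hs_kernel_sec L : hs_kernel L -> {ae mu, forall x, D x -> L2 (L x)}.
Proof.
move=> [mL iL].
have H : mu.-integrable D (fun x => \int[mu]_(y in D) (normc (L x y) ^+ 2)%R%:E)%E.
  apply/integrableP; split.
    have := @meas_inner_integral _ _ _ mu _ mD _ (hs_meas2 mL); apply => x y _ _; exact: sqr_ge0.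
  apply: le_lt_trans iL; rewrite le_eqVlt; apply/orP; left; apply/eqP.
  apply: eq_integral => x _; rewrite gee0_abs// integral_ge0// => y _; rewrite lee_fin; exact: sqr_ge0.
apply: filterS (integrable_ae mD H) => x Hx Dx; split; first exact: cmeas_sec.
by have := Hx Dx; rewrite fin_numElt => /andP[].
Qed.

(** Integration of [sqr_normc_kernel_operator] over x: the sum of |L e_n|^2 is
    the squared L^2 norm of the kernel. *)
Lemma hs_sum_int L : hs_kernel L ->
  (\sum_(0 <= n <oo) \int[mu]_(x in D) (normc (kernel_operator mu D L (e n) x) ^+ 2)%:E =
   iint (fun x y => (normc (L x y) ^+ 2)%R))%E.
Proof.
move=> hL; have [mL iL] := hL.
have mT n : measurable_fun D (fun x => (normc (kernel_operator mu D L (e n) x) ^+ 2)%:E).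
  apply/measurable_EFinP; apply: meas_sqr_normc; apply: kernel_operator_meas => //.
  by apply: L2_meas; exact: (onb_L2 he).
have T0 n x : (0 <= (normc (kernel_operator mu D L (e n) x) ^+ 2)%:E)%E by rewrite lee_fin sqr_ge0.
rewrite -integral_nneseries//; apply: ge0_ae_eq_integral => //.
- apply: (@ge0_emeasurable_sum _ _ _ D (fun n x => (normc (kernel_operator mu D L (e n) x) ^+ 2)%:E) xpredT) => [k x _ _|k _].
    exact: T0.
  exact: mT.
- have := @meas_inner_integral _ _ _ mu _ mD _ (hs_meas2 mL); apply => x y _ _; exact: sqr_ge0.
- by move=> x _; exact: nneseries_ge0.
- by move=> x _; apply: integral_ge0 => y _; rewrite lee_fin sqr_ge0.
by apply: filterS (hs_kernel_sec hL) => x Hx Dx; exact: sqr_normc_kernel_operator (Hx Dx).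
Qed.

Lemma kernel_operator_onb_L2 L n : hs_kernel L -> L2 (kernel_operator mu D L (e n)).
Proof.
move=> hL; have [mL iL] := hL; split.
  by apply: kernel_operator_meas => //; apply: L2_meas; exact: (onb_L2 he).
apply: le_lt_trans iL; rewrite -hs_sum_int//.
pose u k := (\int[mu]_(x in D) (normc (kernel_operator mu D L (e k) x) ^+ 2)%:E)%E.
have u0 k : (0 <= u k)%E by apply: integral_ge0 => x _; rewrite lee_fin sqr_ge0.
apply: (@le_trans _ _ (\sum_(0 <= k < n.+1) u k)%E); last exact: nneseries_lim_ge.
by rewrite big_nat_recr//= leeDr// sume_ge0.
Qed.

Lemma hs_cvg L : hs_kernel L ->
  \sum_(j < n) sqnorm (kernel_operator mu D L (e j)) @[n --> \oo] -->
  fine (iint (fun x y => (normc (L x y) ^+ 2)%R)).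
Proof.
move=> hL; apply: (@fine_cvg _ _ _ _ (fun n => (\sum_(j < n) sqnorm (kernel_operator mu D L (e j)))%:E)); rewrite fineK; last first.
  rewrite ge0_fin_numE; first exact: hL.2.
  by apply: iint_ge0 => x y _ _; exact: sqr_ge0.
rewrite -hs_sum_int//.
rewrite (_ : (fun _ => _) = fun n => (\sum_(0 <= j < n) \int[mu]_(x in D) (normc (kernel_operator mu D L (e j) x) ^+ 2)%:E)%E).
  by apply: is_cvg_nneseries => k _ _; apply: integral_ge0 => x _; rewrite lee_fin sqr_ge0.
apply/funext => n; rewrite big_mkord -sumEFin; apply: eq_bigr => j _.
by rewrite sqnormE//; exact: kernel_operator_onb_L2.
Qed.

(** Parseval once more, for the vectors L e_j, turns the Hilbert-Schmidt norm
    into the sum of the squared matrix entries. *)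
Lemma hs_cvg2 L : hs_kernel L ->
  \sum_(j < n) \sum_(i < n) normc (inner (kernel_operator mu D L (e j)) (e i)) ^+ 2
     @[n --> \oo] -->
  fine (iint (fun x y => (normc (L x y) ^+ 2)%R)).
Proof.
move=> hL; apply: (@cvg_square_sum _ (fun j i => normc (inner (kernel_operator mu D L (e j)) (e i)) ^+ 2) (fun j => sqnorm (kernel_operator mu D L (e j)))).
- by move=> j i; exact: sqr_ge0.
- by move=> j; apply: (parseval_cvg mD he); exact: kernel_operator_onb_L2.
- exact: hs_cvg.
Qed.

End hilbert_schmidt.

(** * Compressions of a projection kernel *)

Lemma eq_cvgn {R : realType} (u v : nat -> R) (l : R) : u =1 v ->
  u n @[n --> \oo] --> l -> v n @[n --> \oo] --> l.
Proof. by move=> /funext ->. Qed.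

Lemma eq_ecvgn {R : realType} (u v : nat -> \bar R) (l : \bar R) : u =1 v ->
  u n @[n --> \oo] --> l -> v n @[n --> \oo] --> l.
Proof. by move=> /funext ->. Qed.

(** Polarization for extended reals, where the subtraction only makes sense
    after taking finite values. *)
Lemma fine_polar {R : realType} (x y p : \bar R) : y \is a fin_num -> p \is a fin_num ->
  x = (y + 4%:E * p)%E -> fine p = 4^-1 * (fine x - fine y).
Proof. by case: y p => [y||] [p||]// _ _ ->; rewrite /=; field. Qed.

Lemma cvg_polar {R : realType} (u v : nat -> R) (l m : R) :
  u n @[n --> \oo] --> l -> v n @[n --> \oo] --> m ->
  4^-1 * (u n - v n) @[n --> \oo] --> 4^-1 * (l - m).
Proof. by move=> ul vm; apply: cvgM; [exact: cvg_cst|exact: cvgB]. Qed.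

Section meas2_closure.
Context {d : measure_display} {T : measurableType d} {R : realType} (D : set T).
Hypothesis mD : measurable D.
Implicit Types (w : T -> T -> R) (a : T -> R).

Lemma meas2M w1 w2 : meas2 D w1 -> meas2 D w2 -> meas2 D (fun x y => w1 x y * w2 x y).
Proof. by move=> m1 m2; exact: measurable_funM. Qed.

Lemma meas2D w1 w2 : meas2 D w1 -> meas2 D w2 -> meas2 D (fun x y => w1 x y + w2 x y).
Proof. by move=> m1 m2; exact: measurable_funD. Qed.

Lemma meas2B w1 w2 : meas2 D w1 -> meas2 D w2 -> meas2 D (fun x y => w1 x y - w2 x y).
Proof. by move=> m1 m2; exact: measurable_funB. Qed.

Lemma meas2X w n : meas2 D w -> meas2 D (fun x y => w x y ^+ n).
Proof. by move=> m1; exact: measurable_funX. Qed.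

Lemma meas2_cst c : meas2 D (fun _ _ : T => c : R).
Proof. exact: measurable_cst. Qed.

Lemma meas2_fst a : measurable_fun setT a -> meas2 D (fun x _ => a x).
Proof.
move=> ma; apply: (@measurable_funS _ _ _ _ setT) => //.
exact: (measurableT_comp ma measurable_fst).
Qed.

Lemma meas2_snd a : measurable_fun setT a -> meas2 D (fun _ y => a y).
Proof.
move=> ma; apply: (@measurable_funS _ _ _ _ setT) => //.
exact: (measurableT_comp ma measurable_snd).
Qed.

End meas2_closure.

Section sqnorm_extra.
Context {d : measure_display} {T : measurableType d} {R : realType}.
Variables (mu : {measure set T -> \bar R}) (D : set T).
Hypothesis mD : measurable D.
Implicit Types f g h : T -> R[i].
Local Notation L2 := (square_integrable mu D).

Lemma sqnormD f g : L2 f -> L2 g ->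
  sqnorm mu D (fun x => f x + g x) =
  sqnorm mu D f + sqnorm mu D g + 2 * Re (inner mu D f g).
Proof.
move=> Lf Lg; have Lfg := L2D mD Lf Lg.
rewrite /sqnorm innerD// (innerC mD Lfg Lf) (innerC mD Lfg Lg) !innerD//.
rewrite [inner mu D g f]innerC// !reimE; ring.
Qed.

Lemma polarization f g : L2 f -> L2 g ->
  Re (inner mu D f g) = 4^-1 * (sqnorm mu D (fun x => f x + g x) - sqnorm mu D (fun x => f x - g x)).
Proof. by move=> Lf Lg; rewrite sqnormD// sqnormB//; field. Qed.

Lemma ae_sqnorm f g : L2 f -> L2 g -> ae_on_eq mu D f g -> sqnorm mu D f = sqnorm mu D g.
Proof. by move=> Lf Lg fg; rewrite /sqnorm (ae_eq_inner mD Lf Lg Lf Lg fg fg). Qed.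

Lemma inner_mulR (a : T -> R) (M : R) f g : measurable_fun D a -> (forall x, `|a x| <= M) ->
  L2 f -> L2 g ->
  inner mu D (fun x => (a x)%:C * f x) g = inner mu D f (fun x => (a x)%:C * g x).
Proof.
move=> ma aM Lf Lg; apply: cintegral_eq => x _.
by apply: complex_ext; rewrite !reimE /=; ring.
Qed.

Lemma L2_mulR (a : T -> R) (M : R) f : measurable_fun D a -> (forall x, `|a x| <= M) ->
  L2 f -> L2 (fun x => (a x)%:C * f x).
Proof.
move=> ma aM Lf; have mac : cmeasurable D (fun x => (a x)%:C) by exact: cmeasR.
apply: (@L2_bdd _ _ _ mu D mD f (fun x => (a x)%:C) (M ^+ 2)) => //.
move=> x _; rewrite sqr_normcR -(real_normK (num_real (a x))).
by rewrite lerXn2r// ?nnegrE// (le_trans _ (aM x)).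
Qed.

End sqnorm_extra.

Section projection.
Context {R : realType}.
Local Notation T := (measurableTypeR R).
Variables (U : set T) (K : T -> T -> R[i]).
Local Notation mu := (@lebesgue_measure R).
Hypothesis mU : measurable U.
Implicit Types (a b : T -> R) (f g : T -> R[i]) (x y : T).
Hypothesis projK : projection_kernel mu U K.
Definition ball_ind (r : R) (x : T) : R := (`|(x : R)| <= r)%R%:R.
Definition k2 (x y : T) : R := normc (K x y) ^+ 2.
(** The double integral of [w] against |K(x,y)|^2 dx dy, the natural measure on
    pairs: its value on (f(x) - f(y))^2 controls the variance of a linear
    statistic. *)
Definition wint (w : T -> T -> R) : \bar R := iint mu U (fun (x y : T) => w x y * k2 x y).
Hypothesis finK : forall r, 0 < r -> (wint (fun (x _ : T) => ball_ind r x) < +oo)%E.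
Variable e : nat -> T -> R[i].
Hypothesis he : orthonormal_basis mu U e.
Local Notation L2 := (square_integrable mu U).
Local Notation inner := (inner mu U).
Local Notation sqnorm := (sqnorm mu U).
Local Notation A := (kernel_operator mu U K).

(** The multipliers that cut the projection down to a Hilbert-Schmidt operator. *)
Definition bsupp a := [/\ measurable_fun setT a, exists M, forall x, `|a x| <= M &
  exists r, 0 < r /\ forall x, r < `|x : R| -> a x = 0].

Lemma proj_L2 f : L2 f -> L2 (A f).
Proof. by case: projK => _ _ [[H _ _] _ _]; exact: H. Qed.

Lemma proj_lin (c : R[i]) f g : L2 f -> L2 g ->
  ae_on_eq mu U (A (fun x => c * f x + g x)) (fun x => c * A f x + A g x).
Proof. by case: projK => _ _ [[_ H _] _ _]; exact: H. Qed.

Lemma proj_idem f : L2 f -> ae_on_eq mu U (A (A f)) (A f).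
Proof. by case: projK => _ _ [_ H _]; exact: H. Qed.

Lemma proj_sym f g : L2 f -> L2 g -> inner (A f) g = inner f (A g).
Proof. by case: projK => _ _ [_ _ H]; exact: H. Qed.

Lemma cmeasK : cmeasurable (U `*` U) (fun p => K p.1 p.2).
Proof. by case: projK. Qed.

Lemma meas2_k2 : meas2 U k2.
Proof. exact: (meas_sqr_normc cmeasK). Qed.

Lemma k2_ge0 x y : 0 <= k2 x y. Proof. exact: sqr_ge0. Qed.

Lemma measurable_ball_ind r : measurable_fun setT (ball_ind r).
Proof.
rewrite (_ : ball_ind r = \1_[set x : T | `|x : R| <= r]).
  apply: measurable_indic; rewrite -[X in measurable X]setTI.
  apply: (@measurable_fun_ler _ _ _ setT (fun x : T => `|x : R|) (fun=> r)) => //.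
  exact: measurableT_comp.
by apply/funext => x; rewrite /ball_ind indicE; congr ((nat_of_bool _)%:R); apply/idP/idP; rewrite inE.
Qed.

Lemma ball_ind_bdd r x : `|ball_ind r x| <= 1.
Proof. by rewrite /ball_ind ger0_norm// lern1 leq_b1. Qed.

Lemma bsupp_ball_ind r : 0 < r -> bsupp (ball_ind r).
Proof.
move=> r0; split; [exact: measurable_ball_ind|by exists 1; exact: ball_ind_bdd|].
by exists r; split => // x rx; rewrite /ball_ind leNgt rx.
Qed.

Lemma bsupp_bound a b : bsupp a -> bsupp b -> exists M r, [/\ 0 <= M, 0 < r,
  forall x, `|a x| <= M * ball_ind r x & forall x, `|b x| <= M * ball_ind r x].
Proof.
move=> [ma [M aM] [r [r0 ar]]] [mb [N bN] [s [s0 bs]]].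
have M0 : 0 <= M by apply: le_trans (aM 0).
have N0 : 0 <= N by apply: le_trans (bN 0).
exists (M + N), (r + s); split; rewrite ?addr_ge0 ?addr_gt0// => x; rewrite /ball_ind.
- have [|xr] := lerP `|x : R| (r + s); first by rewrite mulr1 (le_trans (aM x))// lerDl.
  by rewrite ar ?normr0 ?mulr0// (le_lt_trans _ xr)// lerDl ltW.
- have [|xr] := lerP `|x : R| (r + s); first by rewrite mulr1 (le_trans (bN x))// lerDr.
  by rewrite bs ?normr0 ?mulr0// (le_lt_trans _ xr)// lerDr ltW.
Qed.

Lemma bsupp_L2 a f : bsupp a -> L2 f -> L2 (fun x : T => (a x)%:C * f x).
Proof.
move=> [ma [M aM] _]; apply: (L2_mulR mU) aM; exact: measurable_funS ma.
Qed.

Lemma bsupp_innerR a f g : bsupp a -> L2 f -> L2 g ->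
  inner (fun x : T => (a x)%:C * f x) g = inner f (fun x : T => (a x)%:C * g x).
Proof.
move=> [ma [M aM] _]; apply: inner_mulR aM; exact: measurable_funS ma.
Qed.

Lemma wint_le (w1 w2 : T -> T -> R) : meas2 U w1 -> meas2 U w2 ->
  (forall x y, 0 <= w1 x y) -> (forall x y, w1 x y <= w2 x y) -> (wint w1 <= wint w2)%E.
Proof.
move=> m1 m2 w10 w12; apply: (iint_le mU).
- by apply: meas2M => //; exact: meas2_k2.
- by apply: meas2M => //; exact: meas2_k2.
- by move=> x y _ _; rewrite mulr_ge0 ?k2_ge0.
- by move=> x y _ _ _; rewrite ler_wpM2r ?k2_ge0.
- by move=> x y _ _; rewrite mulr_ge0 ?k2_ge0// (le_trans (w10 x y)).
- by move=> x; exact: lebesgue_measure_set1.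
- by move=> x; exact: measurable_set1.
Qed.

Lemma wint_eq (w1 w2 : T -> T -> R) : (forall x y, w1 x y = w2 x y) -> wint w1 = wint w2.
Proof. by move=> ww; apply: iint_eq => x y _ _; rewrite ww. Qed.

Lemma wintD (w1 w2 : T -> T -> R) : meas2 U w1 -> meas2 U w2 ->
  (forall x y, 0 <= w1 x y) -> (forall x y, 0 <= w2 x y) ->
  wint (fun (x y : T) => w1 x y + w2 x y) = (wint w1 + wint w2)%E.
Proof.
move=> m1 m2 w10 w20.
have E : wint (fun x y => w1 x y + w2 x y) = iint mu U (fun x y => w1 x y * k2 x y + w2 x y * k2 x y).
  by apply: iint_eq => x y _ _; rewrite mulrDl.
rewrite E; apply: (@iintD _ _ _ mu U mU (fun x y => w1 x y * k2 x y) (fun x y => w2 x y * k2 x y)).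
- by apply: meas2M => //; exact: meas2_k2.
- by apply: meas2M => //; exact: meas2_k2.
- by move=> x y _ _; rewrite mulr_ge0 ?k2_ge0.
- by move=> x y _ _; rewrite mulr_ge0 ?k2_ge0.
Qed.

Lemma wintZ (c : R) (w : T -> T -> R) : 0 <= c -> meas2 U w -> (forall x y, 0 <= w x y) ->
  wint (fun (x y : T) => c * w x y) = (c%:E * wint w)%E.
Proof.
move=> c0 mw w0.
have E : wint (fun x y => c * w x y) = iint mu U (fun x y => c * (w x y * k2 x y)).
  by apply: iint_eq => x y _ _; rewrite mulrA.
rewrite E; apply: (@iintZ _ _ _ mu U mU c (fun x y => w x y * k2 x y) c0).
- by apply: meas2M => //; exact: meas2_k2.
- by move=> x y _ _; rewrite mulr_ge0 ?k2_ge0.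
Qed.

Lemma wint_ge0 (w : T -> T -> R) : (forall x y, 0 <= w x y) -> (0 <= wint w)%E.
Proof. by move=> w0; apply: iint_ge0 => x y _ _; rewrite mulr_ge0 ?k2_ge0. Qed.

(** For c = 1 and c = -1, the kernels [crossed a b c] * K are the sums and
    differences of the compressions a K b and b K a, to be used in polarization. *)
Definition crossed a b (c : R) x y : R := a x * b y + c * (b x * a y).

Lemma meas2_crossed a b c : bsupp a -> bsupp b -> meas2 U (crossed a b c).
Proof.
move=> [ma _ _] [mb _ _]; apply: meas2D; last apply: meas2M; first apply: meas2M.
- exact: meas2_fst. - exact: meas2_snd. - exact: meas2_cst.
by apply: meas2M; [exact: meas2_fst|exact: meas2_snd].
Qed.

Lemma wint_crossed_fin a b c : bsupp a -> bsupp b ->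
  (wint (fun (x y : T) => (crossed a b c x y ^+ 2)%R) < +oo)%E.
Proof.
move=> na nb; have [M [r [M0 r0 aM bM]]] := bsupp_bound na nb.
pose C := ((1 + `|c|) * M ^+ 2) ^+ 2.
have bi0 x : 0 <= ball_ind r x by rewrite /ball_ind.
have bi1 x : ball_ind r x <= 1 by rewrite /ball_ind lern1 leq_b1.
apply: (@le_lt_trans _ _ (wint (fun (x y : T) => (C * ball_ind r x)%R))); last first.
  rewrite (@wintZ C (fun (x _ : T) => ball_ind r x)) ?sqr_ge0//; last first.
    by apply: meas2_fst => //; exact: measurable_ball_ind.
  by rewrite lte_mul_pinfty ?lee_fin ?sqr_ge0// finK.
apply: wint_le.
- by apply: meas2X; exact: meas2_crossed.
- by apply: meas2M; [exact: meas2_cst|apply: meas2_fst; exact: measurable_ball_ind].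
- by move=> x y; exact: sqr_ge0.
move=> x y; have -> : C * ball_ind r x = ((1 + `|c|) * M ^+ 2 * ball_ind r x) ^+ 2.
  rewrite exprMn /C; congr (_ * _); rewrite /ball_ind -natrX; congr (_%:R); by case: (_ <= _).
rewrite -(real_normK (num_real (crossed _ _ _ _ _))) lerXn2r// ?nnegrE//.
  by rewrite !mulr_ge0 ?addr_ge0.
apply: (le_trans (ler_normD _ _)); rewrite !normrM -mulrA mulrDl mul1r.
have H (p q : T -> R) : (forall x, `|p x| <= M * ball_ind r x) -> (forall x, `|q x| <= M * ball_ind r x) ->
    `|p x| * `|q y| <= M ^+ 2 * ball_ind r x.
  move=> pM qM; rewrite expr2 mulrAC; apply: ler_pM => //.
  by apply: le_trans (qM y) _; rewrite ler_piMr.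
by apply: lerD; [exact: H|apply: ler_wpM2l => //; exact: H].
Qed.

Definition crossed_kernel a b c x y : R[i] := (crossed a b c x y)%:C * K x y.

Lemma hs_crossed a b c : bsupp a -> bsupp b -> hs_kernel mu U (crossed_kernel a b c).
Proof.
move=> na nb; split.
  apply: cmeasM; last exact: cmeasK.
  by apply: cmeasR; exact: (meas2_crossed c na nb).
apply: le_lt_trans (wint_crossed_fin c na nb); rewrite le_eqVlt; apply/orP; left; apply/eqP.
by apply: iint_eq => x y _ _; rewrite sqr_normcM sqr_normcR.
Qed.

Lemma crossed_operator a b c f : bsupp a -> bsupp b -> L2 f ->
  ae_on_eq mu U (kernel_operator mu U (crossed_kernel a b c) f)
    (fun x : T => (a x)%:C * A (fun y : T => (b y)%:C * f y) x +
              c%:C * ((b x)%:C * A (fun y : T => (a y)%:C * f y) x)).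
Proof.
move=> na nb Lf; case: projK => _ int _.
apply: filterS2 (int _ (bsupp_L2 nb Lf)) (int _ (bsupp_L2 na Lf)) => x Ib Ia Ux.
have {}Ib := Ib Ux; have {}Ia := Ia Ux.
have I2 : cintegrable mu U (fun y : T => (c * b x)%:C * (K x y * ((a y)%:C * f y))).
  have := cintegrable_lin mU ((c * b x)%:C - 1) Ia Ia; apply: cintegrable_eq => // y _.
  by rewrite mulrBl mul1r subrK.
rewrite /kernel_operator.
transitivity (cintegral mu U (fun y : T => (a x)%:C * (K x y * ((b y)%:C * f y)) +
    (c * b x)%:C * (K x y * ((a y)%:C * f y)))).
  apply: cintegral_eq => y _; rewrite /crossed_kernel /crossed.
  by apply: complex_ext; rewrite !reimE /=; ring.
rewrite cintegral_lin//; congr (_ + _).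
have -> : cintegral mu U (fun y : T => (c * b x)%:C * (K x y * ((a y)%:C * f y))) =
   cintegral mu U (fun y : T => ((c * b x)%:C - 1) * (K x y * ((a y)%:C * f y)) + (K x y * ((a y)%:C * f y))).
  by apply: cintegral_eq => y _; rewrite mulrBl mul1r subrK.
rewrite cintegral_lin// mulrBl mul1r subrK.
by apply: complex_ext; rewrite !reimE /=; ring.
Qed.

(** The matrix of the compression a K b in the basis [e]. *)
Definition amat a b j i : R[i] :=
  inner (A (fun y : T => (b y)%:C * e j y)) (fun y : T => (a y)%:C * e i y).

Lemma amatE a b j i : amat a b j i =
  inner (A (fun y : T => (b y)%:C * e j y)) (fun y : T => (a y)%:C * e i y).
Proof. by []. Qed.

(** Self-adjointness of the projection. *)
Lemma amat_swap a b j i : bsupp a -> bsupp b -> amat b a j i = conjc (amat a b i j).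
Proof.
move=> na nb; have Le k := onb_L2 he k.
have La k := bsupp_L2 na (Le k); have Lb k := bsupp_L2 nb (Le k).
by rewrite /amat proj_sym// innerC//; exact: proj_L2.
Qed.

Lemma crossed_coef a b c j i : bsupp a -> bsupp b ->
  inner (kernel_operator mu U (crossed_kernel a b c) (e j)) (e i) =
  amat a b j i + c%:C * conjc (amat a b i j).
Proof.
move=> na nb; have Le k := onb_L2 he k.
have La k := bsupp_L2 na (Le k); have Lb k := bsupp_L2 nb (Le k).
have L1 := bsupp_L2 na (proj_L2 (Lb j)); have L2' := bsupp_L2 nb (proj_L2 (La j)).
have L3 := L2Z mU c%:C L2'.
have Lk := kernel_operator_onb_L2 mU he j (hs_crossed c na nb).
have E := ae_eq_inner mU Lk (L2D mU L1 L3) (Le i) (Le i) (crossed_operator c na nb (Le j))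
  (aeW _ (fun x _ => erefl)).
rewrite E (innerD mU L1 L3 (Le i)) (innerZ mU c%:C L2' (Le i)) -amat_swap// /amat.
by rewrite (bsupp_innerR na (proj_L2 (Lb j)) (Le i)) (bsupp_innerR nb (proj_L2 (La j)) (Le i)).
Qed.

Lemma amat_cvg a b c : bsupp a -> bsupp b ->
  \sum_(j < n) \sum_(i < n) normc (amat a b j i + c%:C * conjc (amat a b i j)) ^+ 2
    @[n --> \oo] --> fine (wint (fun (x y : T) => crossed a b c x y ^+ 2)).
Proof.
move=> na nb; have := hs_cvg2 mU he (hs_crossed c na nb).
rewrite (_ : iint _ _ _ = wint (fun (x y : T) => crossed a b c x y ^+ 2)); last first.
  by apply: iint_eq => x y _ _; rewrite sqr_normcM sqr_normcR.
apply: eq_cvgn => n; apply: eq_bigr => j _; apply: eq_bigr => i _.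
by rewrite crossed_coef.
Qed.

(** Both sides are Hilbert-Schmidt norms, of a K b and of its adjoint b K a; a
    pointwise symmetry of |K| is replaced by the symmetry of the operator. *)
Lemma wint_swap_bdd a b : bsupp a -> bsupp b ->
  wint (fun (x y : T) => a x ^+ 2 * b y ^+ 2) = wint (fun (x y : T) => b x ^+ 2 * a y ^+ 2).
Proof.
move=> na nb.
have E (p q : T -> R) : wint (fun (x y : T) => p x ^+ 2 * q y ^+ 2) = wint (fun (x y : T) => crossed p q 0 x y ^+ 2).
  by apply: wint_eq => x y; rewrite /crossed; ring.
have F (p q : T -> R) : bsupp p -> bsupp q -> wint (fun (x y : T) => p x ^+ 2 * q y ^+ 2) \is a fin_num.
  move=> np nq; rewrite E ge0_fin_numE; first exact: wint_crossed_fin.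
  by apply: wint_ge0 => x y; exact: sqr_ge0.
have S (p q : T -> R) : bsupp p -> bsupp q ->
  \sum_(j < n) \sum_(i < n) normc (amat p q j i) ^+ 2 @[n --> \oo] --> fine (wint (fun (x y : T) => p x ^+ 2 * q y ^+ 2)).
  move=> np nq; rewrite E; have := amat_cvg (c := 0) np nq.
  apply: eq_cvgn => n; apply: eq_bigr => j _; apply: eq_bigr => i _.
  by rewrite mul0r addr0.
(* The matrix of b K a is the conjugate transpose of that of a K b. *)
have S' : \sum_(j < n) \sum_(i < n) normc (amat a b j i) ^+ 2 @[n --> \oo] -->
    fine (wint (fun (x y : T) => b x ^+ 2 * a y ^+ 2)).
  apply: (eq_cvgn _ (S b a nb na)) => n; rewrite [LHS]exchange_big.
  apply: eq_bigr => j _; apply: eq_bigr => i _.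
  by rewrite (amat_swap i j na nb) sqr_normcJ.
have E2 := cvg_unique (@Rhausdorff R) (S a b na nb) S'.
by rewrite -(fineK (F a b na nb)) -(fineK (F b a nb na)) E2.
Qed.

(** The second weight may have unbounded support: cut it by balls and use
    monotone convergence. *)
Lemma wint_swap a b : bsupp a -> measurable_fun setT b -> (exists M, forall x, `|b x| <= M) ->
  wint (fun (x y : T) => a x ^+ 2 * b y ^+ 2) = wint (fun (x y : T) => b x ^+ 2 * a y ^+ 2).
Proof.
move=> na mb [M bM].
(* The radius k + 1 is positive, as required of the support bound. *)
pose bk (k : nat) (x : T) := b x * ball_ind k.+1%:R x.
have nbk k : bsupp (bk k).
  split.
  - by apply: measurable_funM => //; exact: measurable_ball_ind.
  - exists M => x; rewrite /bk normrM -[X in _ <= X]mulr1; apply: ler_pM => //; exact: ball_ind_bdd.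
  - by exists k.+1%:R; split => // x kx; rewrite /bk /ball_ind leNgt kx mulr0.
have bkE k x : bk k x ^+ 2 = b x ^+ 2 * ball_ind k.+1%:R x.
  by rewrite /bk exprMn /ball_ind -natrX; congr (_ * _%:R); case: (_ <= _).
have nd x : {homo (fun k => bk k x ^+ 2) : n m / (n <= m)%N >-> n <= m}.
  move=> n m nm; rewrite !bkE; apply: ler_wpM2l; first exact: sqr_ge0.
  rewrite /ball_ind ler_nat; case: (lerP `|x : R| n.+1%:R) => // xn.
  by rewrite (le_trans xn)// ler_nat.
have cv x : bk k x ^+ 2 @[k --> \oo] --> b x ^+ 2.
  apply: cvg_near_cst; have [N xN] : exists N, `|x : R| <= N%:R.
    by exists (Num.bound `|x : R|); apply/ltW/archi_boundP.
  exists N => // k /= Nk; rewrite bkE /ball_ind (le_trans xN) ?mulr1// ler_nat.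
  exact: leq_trans Nk _.
have ma : measurable_fun setT a by case: na.
have mbk k : measurable_fun setT (bk k) by case: (nbk k).
have c1 : wint (fun (x y : T) => a x ^+ 2 * bk k y ^+ 2) @[k --> \oo] --> wint (fun (x y : T) => a x ^+ 2 * b y ^+ 2).
  apply: (iint_mct mU (w_ := fun k x y => a x ^+ 2 * bk k y ^+ 2 * k2 x y)).
  - move=> k; apply: meas2M; last exact: meas2_k2.
    by apply: meas2M; apply: meas2X; [exact: meas2_fst|exact: meas2_snd].
  - move=> k x y _ _; apply: mulr_ge0; [by apply: mulr_ge0; exact: sqr_ge0|exact: k2_ge0].
  - move=> x y _ _ n m nm; rewrite ler_wpM2r ?k2_ge0// ler_wpM2l ?sqr_ge0//.
    exact: nd.
  - by move=> x y _ _; apply: cvgM; [apply: cvgM; [exact: cvg_cst|exact: cv]|exact: cvg_cst].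
have c2 : wint (fun (x y : T) => bk k x ^+ 2 * a y ^+ 2) @[k --> \oo] --> wint (fun (x y : T) => b x ^+ 2 * a y ^+ 2).
  apply: (iint_mct mU (w_ := fun k x y => bk k x ^+ 2 * a y ^+ 2 * k2 x y)).
  - move=> k; apply: meas2M; last exact: meas2_k2.
    by apply: meas2M; apply: meas2X; [exact: meas2_fst|exact: meas2_snd].
  - move=> k x y _ _; apply: mulr_ge0; [by apply: mulr_ge0; exact: sqr_ge0|exact: k2_ge0].
  - move=> x y _ _ n m nm; rewrite ler_wpM2r ?k2_ge0// ler_wpM2r ?sqr_ge0//.
    exact: nd.
  - by move=> x y _ _; apply: cvgM; [apply: cvgM; [exact: cv|exact: cvg_cst]|exact: cvg_cst].
have c2' := eq_ecvgn (fun k => wint_swap_bdd (nbk k) na) c2.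
exact: (cvg_unique (@ereal_hausdorff R) c1 c2').
Qed.

Lemma wint_bsupp_fin a : bsupp a -> (wint (fun (x _ : T) => (a x ^+ 2)%R) < +oo)%E.
Proof.
move=> na; have [M [r [M0 r0 aM _]]] := bsupp_bound na na.
apply: (@le_lt_trans _ _ (wint (fun (x _ : T) => (M ^+ 2 * ball_ind r x)%R))); last first.
  rewrite (@wintZ (M ^+ 2) (fun (x _ : T) => ball_ind r x)) ?sqr_ge0//; last first.
    by apply: meas2_fst => //; exact: measurable_ball_ind.
  by rewrite lte_mul_pinfty ?lee_fin ?sqr_ge0// finK.
apply: wint_le.
- by apply: meas2X; apply: meas2_fst; case: na.
- by apply: meas2M; [exact: meas2_cst|apply: meas2_fst; exact: measurable_ball_ind].
- by move=> x y; exact: sqr_ge0.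
move=> x y; rewrite -(real_normK (num_real (a x))).
have -> : M ^+ 2 * ball_ind r x = (M * ball_ind r x) ^+ 2.
  by rewrite exprMn /ball_ind -natrX; congr (_ * _%:R); case: (_ <= _).
by rewrite lerXn2r// ?nnegrE// (le_trans _ (aM x)).
Qed.

Lemma wint_bsupp_swap a : bsupp a -> wint (fun (_ y : T) => a y ^+ 2) = wint (fun (x _ : T) => a x ^+ 2).
Proof.
move=> na; have := @wint_swap a (fun=> 1) na (measurable_cst _).
rewrite (_ : wint (fun (x y : T) => a x ^+ 2 * 1 ^+ 2) = wint (fun (x _ : T) => a x ^+ 2)); last first.
  by apply: wint_eq => x y; rewrite expr1n mulr1.
rewrite (_ : wint (fun (x y : T) => 1 ^+ 2 * a y ^+ 2) = wint (fun (_ y : T) => a y ^+ 2)); last first.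
  by apply: wint_eq => x y; rewrite expr1n mul1r.
by move=> ->//; exists 1 => x; rewrite normr1.
Qed.

(** The Hilbert-Schmidt norms of a K b + b K a and of a K b - b K a differ by
    four times the trace of (a K b)^2, entry by entry on the left and pointwise
    in the integrand on the right. *)
Lemma amat_trace2_cvg a b : bsupp a -> bsupp b -> (forall x : T, 0 <= a x) -> (forall x : T, 0 <= b x) ->
  \sum_(j < n) \sum_(i < n) Re (amat a b j i * amat a b i j)
    @[n --> \oo] --> fine (wint (fun (x y : T) => (a x * b x) * (a y * b y))).
Proof.
move=> na nb a0 b0; have C1 := amat_cvg (c := 1) na nb; have C2 := amat_cvg (c := (-1)) na nb.
have ma : measurable_fun setT a by case: na.
have mb : measurable_fun setT b by case: nb.
have m1 : meas2 U (fun (x y : T) => a x * b x * (a y * b y)).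
  by apply: meas2M; apply: meas2M; solve [exact: meas2_fst|exact: meas2_snd].
have m2 : meas2 U (fun (x y : T) => crossed a b (-1) x y ^+ 2) by apply: meas2X; exact: meas2_crossed.
have F c : wint (fun (x y : T) => crossed a b c x y ^+ 2) \is a fin_num.
  rewrite ge0_fin_numE; first exact: wint_crossed_fin.
  by apply: wint_ge0 => x y; exact: sqr_ge0.
have E : wint (fun (x y : T) => crossed a b 1 x y ^+ 2) =
   (wint (fun (x y : T) => (crossed a b (-1) x y ^+ 2)%R) + 4%:E * wint (fun (x y : T) => ((a x * b x) * (a y * b y))%R))%E.
  have p0 x y : 0 <= a x * b x * (a y * b y) by rewrite !mulr_ge0.
  have p4 x y : 0 <= 4 * (a x * b x * (a y * b y)) by rewrite mulr_ge0.
  have s0 x y : 0 <= crossed a b (-1) x y ^+ 2 by exact: sqr_ge0.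
  have D := wintD m2 (meas2M (@meas2_cst _ _ _ U 4) m1) s0 p4.
  rewrite (wintZ (ler0n R 4) m1 p0) in D; rewrite -D.
  by apply: wint_eq => x y; rewrite /crossed; ring.
have F1 : wint (fun (x y : T) => (a x * b x) * (a y * b y)) \is a fin_num.
  rewrite ge0_fin_numE; last by apply: wint_ge0 => x y; rewrite !mulr_ge0.
  have := F 1; rewrite E fin_numD => /andP[_].
  case: (wint _) (wint_ge0 (w := fun (x y : T) => (a x * b x) * (a y * b y))) => [r _ _|_|h _].
  - exact: ltry.
  - by rewrite mulry gtr0_sg// mul1e.
  - by [].
have {E} E : fine (wint (fun (x y : T) => (a x * b x) * (a y * b y))) =
   4^-1 * (fine (wint (fun (x y : T) => crossed a b 1 x y ^+ 2)) - fine (wint (fun (x y : T) => crossed a b (-1) x y ^+ 2))).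
  exact: fine_polar (F _) F1 E.
rewrite E; have := cvg_polar C1 C2.
apply: eq_cvgn => n.
rewrite -sumrB mulr_sumr; apply: eq_bigr => j _; rewrite -sumrB mulr_sumr; apply: eq_bigr => i _.
move: (amat a b j i) (amat a b i j) => z w.
by rewrite !sqr_normcE !reimE /=; field.
Qed.

(** |K a|_HS^2, computed in the basis and from the kernel. *)
Lemma trace_sqnorm_cvg a : bsupp a ->
  \sum_(j < n) sqnorm (A (fun y : T => (a y)%:C * e j y)) @[n --> \oo] -->
  fine (wint (fun (_ y : T) => a y ^+ 2)).
Proof.
move=> na; pose L (x y : T) : R[i] := (a y)%:C * K x y.
have E : iint mu U (fun (x y : T) => normc (L x y) ^+ 2) = wint (fun (_ y : T) => a y ^+ 2).
  by apply: iint_eq => x y _ _; rewrite sqr_normcM sqr_normcR.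
have hL : hs_kernel mu U L.
  split; last by rewrite E wint_bsupp_swap// wint_bsupp_fin.
  apply: cmeasM; last exact: cmeasK.
  by apply: cmeasR; apply: meas2_snd; case: na.
have LE f : kernel_operator mu U L f = A (fun y : T => (a y)%:C * f y).
  apply/funext => x; apply: cintegral_eq => y _; rewrite /L.
  by rewrite [(a y)%:C * _]mulrC mulrA.
have H := hs_cvg mU he hL; rewrite E in H; apply: (eq_cvgn _ H) => n.
by apply: eq_bigr => j _; rewrite LE.
Qed.

Lemma bsuppD a b c : bsupp a -> bsupp b -> bsupp (fun x => a x + c * b x).
Proof.
move=> na nb; have [M [r [M0 r0 aM bM]]] := bsupp_bound na nb.
have bi1 x : 0 <= ball_ind r x <= 1 by rewrite /ball_ind ler0n lern1 leq_b1.
split.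
- by case: na nb => [ma _ _] [mb _ _]; apply: measurable_funD => //; exact: measurable_funM.
- exists (M + `|c| * M) => x; apply: le_trans (ler_normD _ _) _; rewrite normrM.
  have /andP[h0 h1] := bi1 x.
  apply: lerD; last apply: ler_wpM2l => //.
    by apply: le_trans (aM x) _; rewrite ler_piMr.
  by apply: le_trans (bM x) _; rewrite ler_piMr.
- exists r; split => // x rx.
  have h : ball_ind r x = 0 by rewrite /ball_ind leNgt rx.
  by have := aM x; have := bM x; rewrite h mulr0 !normr_le0 => /eqP-> /eqP->; rewrite mulr0 addr0.
Qed.

(** As K is an orthogonal projection, <K b e_j, a e_j> = <K b e_j, K a e_j>;
    polarization reduces this to [trace_sqnorm_cvg] for the multipliers b + a
    and b - a. *)
Lemma amat_trace_cvg a b : bsupp a -> bsupp b -> (forall x : T, 0 <= a x) -> (forall x : T, 0 <= b x) ->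
  \sum_(j < n) Re (amat a b j j) @[n --> \oo] --> fine (wint (fun (_ y : T) => a y * b y)).
Proof.
move=> na nb a0 b0.
have np := bsuppD 1 nb na; have nm := bsuppD (-1) nb na.
have C1 := trace_sqnorm_cvg np; have C2 := trace_sqnorm_cvg nm.
have ma : measurable_fun setT a by case: na.
have mb : measurable_fun setT b by case: nb.
have F (p : T -> R) : bsupp p -> wint (fun (_ y : T) => p y ^+ 2) \is a fin_num.
  move=> npp; rewrite ge0_fin_numE; first by rewrite wint_bsupp_swap// wint_bsupp_fin.
  by apply: wint_ge0 => x y; exact: sqr_ge0.
have E : wint (fun (_ y : T) => (b y + 1 * a y) ^+ 2) =
   (wint (fun (_ y : T) => ((b y + (-1) * a y) ^+ 2)%R) + 4%:E * wint (fun (_ y : T) => (a y * b y)%R))%E.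
  have p0 (x y : T) : 0 <= a y * b y by rewrite mulr_ge0.
  have p4 (x y : T) : 0 <= 4 * (a y * b y) by exact: mulr_ge0 (ler0n _ _) (p0 x y).
  have s0 (x y : T) : 0 <= (b y + (-1) * a y) ^+ 2 by exact: sqr_ge0.
  have m1 : meas2 U (fun (_ y : T) => a y * b y) by apply: meas2M; apply: meas2_snd.
  have M q : bsupp q -> meas2 U (fun (_ y : T) => q y ^+ 2).
    by move=> [mq _ _]; apply: meas2X; exact: meas2_snd.
  have m2 := M _ nm.
  have D := wintD m2 (meas2M (@meas2_cst _ _ _ U 4) m1) s0 p4.
  rewrite (wintZ (ler0n R 4) m1 p0) in D; rewrite -D.
  by apply: wint_eq => x y; ring.
have F1 : wint (fun (_ y : T) => a y * b y) \is a fin_num.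
  have := F _ np; rewrite E fin_numD => /andP[_].
  have : (0 <= wint (fun (_ y : T) => (a y * b y)%R))%E by apply: wint_ge0 => x y; rewrite mulr_ge0.
  by case: (wint _) => [r|_|]//; rewrite mulry gtr0_sg// mul1e.
have {E} E : fine (wint (fun (_ y : T) => a y * b y)) =
   4^-1 * (fine (wint (fun (_ y : T) => (b y + 1 * a y) ^+ 2)) - fine (wint (fun (_ y : T) => (b y + (-1) * a y) ^+ 2))).
  exact: fine_polar (F _ nm) F1 E.
rewrite E; have := cvg_polar C1 C2.
apply: eq_cvgn => n.
rewrite -sumrB mulr_sumr; apply: eq_bigr => j _.
have Lj := onb_L2 he j; have La := bsupp_L2 na Lj; have Lb := bsupp_L2 nb Lj.
have PA := proj_L2 La; have PB := proj_L2 Lb.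
have -> : amat a b j j = inner (A (fun y : T => (b y)%:C * e j y)) (A (fun y : T => (a y)%:C * e j y)).
  rewrite -(proj_sym PB La).
  exact: (esym (ae_eq_inner mU (proj_L2 PB) PB La La (proj_idem Lb) (aeW _ (fun x _ => erefl)))).
rewrite (polarization mU PB PA).
have sq c : sqnorm (A (fun y : T => (b y + c * a y)%:C * e j y)) =
   sqnorm (fun x => A (fun y : T => (b y)%:C * e j y) x + c%:C * A (fun y : T => (a y)%:C * e j y) x).
  apply: (ae_sqnorm mU (proj_L2 (bsupp_L2 (bsuppD c nb na) Lj)) (L2D mU PB (L2Z mU c%:C PA))).
  apply: filterS (proj_lin c%:C La Lb) => x H Ux.
  rewrite [RHS]addrC -H//; congr (kernel_operator _ _ _ _ x); apply/funext => y.
  by apply: complex_ext; rewrite !reimE /=; ring.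
congr (_ * (_ - _)); rewrite sq; congr (complex.Re (Defs.inner _ _ _ _)); apply/funext => x;
by apply: complex_ext; rewrite !reimE /=; ring.
Qed.

End projection.

(** * Second-order expansion of finite products *)

Section list_products.
Context {R : realType}.
Implicit Types (v : seq R) (z : R).

(** The second elementary symmetric function, by the Newton identity. *)
Definition esum2 v : R := ((\sum_(a <- v) a) ^+ 2 - \sum_(a <- v) a ^+ 2) / 2.

Lemma esum2_cons a v : esum2 (a :: v) = esum2 v + a * \sum_(b <- v) b.
Proof. by rewrite /esum2 !big_cons; field. Qed.

Lemma esum2_ge0 v : (forall a, a \in v -> 0 <= a) -> 0 <= esum2 v.
Proof.
elim: v => [|a v ih] v0; first by rewrite /esum2 !big_nil expr0n/= subrr mul0r.
rewrite esum2_cons addr_ge0//; first by apply: ih => b bv; apply: v0; rewrite inE bv orbT.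
rewrite mulr_ge0//; first by apply: v0; rewrite inE eqxx.
by rewrite big_seq sumr_ge0// => b bv; apply: v0; rewrite inE bv orbT.
Qed.

(** The sum of the elementary symmetric functions of degree at least 3, i.e.
    what the product leaves at z = 1. *)
Definition third_rest v : R := \prod_(a <- v) (1 + a) - 1 - \sum_(a <- v) a - esum2 v.

Lemma third_rest_cons a v : third_rest (a :: v) = third_rest v + a * esum2 v + a * third_rest v.
Proof. by rewrite /third_rest esum2_cons !big_cons; ring. Qed.

(** The coefficients are nonnegative, so the terms of degree at least 3 are at
    most z^3 times their value at z = 1. By induction on the list. *)
Lemma prod_taylor v : (forall a, a \in v -> 0 <= a) ->
  0 <= third_rest v /\ forall z, 0 <= z <= 1 ->
  1 + z * \sum_(a <- v) a + z ^+ 2 * esum2 v <= \prod_(a <- v) (1 + z * a) <=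
  1 + z * \sum_(a <- v) a + z ^+ 2 * esum2 v + z ^+ 3 * third_rest v.
Proof.
elim: v => [|a v ih] v0.
  have E : esum2 [::] = 0 by rewrite /esum2 !big_nil expr0n/= subrr mul0r.
  have Q : third_rest [::] = 0 by rewrite /third_rest E !big_nil; ring.
  by split=> [|z _]; rewrite Q// E !big_nil !mulr0 !addr0 lexx.
have [|Q0 H] := ih; first by move=> b bv; apply: v0; rewrite inE bv orbT.
have a0 : 0 <= a by apply: v0; rewrite inE eqxx.
have e0 : 0 <= esum2 v by apply: esum2_ge0 => b bv; apply: v0; rewrite inE bv orbT.
split; first by rewrite third_rest_cons; apply: addr_ge0; [apply: addr_ge0 => //|]; exact: mulr_ge0.
move=> z z01; have /andP[h1 h2] := H z z01; move: z01 => /andP[z0 z1].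
rewrite third_rest_cons esum2_cons !big_cons.
move: (\sum_(_ <- _) _) (\prod_(_ <- _) _) (esum2 v) (third_rest v) e0 Q0 h1 h2 => S p e q e0 q0 h1 h2.
have za0 : 0 <= 1 + z * a by rewrite addr_ge0 ?mulr_ge0.
have k1 := ler_wpM2l za0 h1; have k2 := ler_wpM2l za0 h2.
have z3 : 0 <= z ^+ 3 by exact: exprn_ge0.
have w1 : 0 <= z ^+ 3 * (a * e) by rewrite !mulr_ge0.
have w2 : 0 <= z ^+ 3 * (a * q) * (1 - z) by rewrite !mulr_ge0// subr_ge0.
apply/andP; split.
  apply: le_trans k1; rewrite -subr_ge0.
  have -> : (1 + z * a) * (1 + z * S + z ^+ 2 * e) - (1 + z * (a + S) + z ^+ 2 * (e + a * S)) = z ^+ 3 * (a * e) by ring.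
  exact: w1.
apply: le_trans k2 _; rewrite -subr_ge0.
have -> : 1 + z * (a + S) + z ^+ 2 * (e + a * S) + z ^+ 3 * (q + a * e + a * q) -
  (1 + z * a) * (1 + z * S + z ^+ 2 * e + z ^+ 3 * q) = z ^+ 3 * (a * q) * (1 - z) by ring.
exact: w2.
Qed.

Lemma eq0_of_small (a C : R) : (forall z, 0 < z <= 2^-1 -> `|a| <= C * z) -> a = 0.
Proof.
move=> H; apply/eqP; rewrite -normr_le0; apply/ler_addgt0Pr => eps eps0; rewrite add0r.
have C1 : 0 < `|C| + 1 by rewrite ltr_wpDl.
pose z := Num.min 2^-1 (eps / (`|C| + 1)).
have z0 : 0 < z by rewrite lt_min invr_gt0 ltr0n divr_gt0.
have zle : z <= eps / (`|C| + 1) by rewrite ge_min lexx orbT.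
apply: (le_trans (H z _)); first by rewrite z0 ge_min lexx.
apply: (@le_trans _ _ ((`|C| + 1) * z)); first by apply: ler_wpM2r; [exact: ltW|rewrite (le_trans (ler_norm C))// lerDl ler01].
by rewrite mulrC -ler_pdivlMr.
Qed.

(** Both expansions agree with F up to O(z^3) as z tends to 0, hence have the
    same coefficients of degree 1 and 2. *)
Lemma coef_match (F : R -> R) (rho : nat -> R) (E1 E2 Q : R) : rho 0%N = 1 ->
  (forall z, 0 <= z -> \sum_(k < n) z ^+ k * rho k @[n --> \oo] --> F z) ->
  (forall z, 0 <= z <= 1 -> 1 + z * E1 + z ^+ 2 * E2 <= F z <= 1 + z * E1 + z ^+ 2 * E2 + z ^+ 3 * Q) ->
  E1 = rho 1%N /\ E2 = rho 2%N.
Proof.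
move=> r0 cF bF.
(* Convergence at z = 1 bounds the coefficients. *)
have [M [M0 HM]] : exists M, 0 <= M /\ forall k, `|rho k| <= M.
  have c1 : cvgn (fun n => \sum_(k < n) rho k).
    apply/cvg_ex; exists (F 1); have := cF 1 ler01; apply: eq_cvgn => n.
    by apply: eq_bigr => k _; rewrite expr1n mul1r.
  have [M [_ HM]] := cvg_seq_bounded c1.
  exists (2 * (`|M| + 1)); split; first by rewrite mulr_ge0// addr_ge0.
  move=> k; have {}HM n : `|\sum_(k < n) rho k| <= `|M| + 1.
    by apply: HM => //; rewrite ltr_pwDr// ler_norm.
  have -> : rho k = \sum_(j < k.+1) rho j - \sum_(j < k) rho j.
    by rewrite big_ord_recr /=; ring.
  by apply: le_trans (ler_normB _ _) _; rewrite mulr2n mulrDl mul1r lerD.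
(* For z <= 1/2 the tail is at most a geometric series of ratio 1/2. *)
have sm z : 0 < z <= 2^-1 -> `|F z - (1 + z * rho 1%N + z ^+ 2 * rho 2%N)| <= 2 * M * z ^+ 3.
  move=> /andP[z0 zh].
  have c3 : `|\sum_(k < n) z ^+ k * rho k - (1 + z * rho 1%N + z ^+ 2 * rho 2%N)| @[n --> \oo] -->
     `|F z - (1 + z * rho 1%N + z ^+ 2 * rho 2%N)|.
    apply: cvg_norm; apply: cvgB; last exact: cvg_cst.
    exact: cF (ltW z0).
  apply: (cvgr_to_le c3); exists 3%N => // n /= n3.
  have -> : n = (3 + (n - 3))%N by rewrite subnKC.
  rewrite big_split_ord /= !big_ord_recr big_ord0 /= r0 expr0 expr1 add0r mulr1.
  rewrite [X in `|X|](_ : _ = \sum_(i < n - 3) z ^+ (3 + i) * rho (3 + i)%N); last by ring.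
  apply: le_trans (ler_norm_sum _ _ _) _.
  apply: (@le_trans _ _ (\sum_(i < n - 3) M * z ^+ 3 * 2^-1 ^+ i)).
    apply: ler_sum => i _; rewrite normrM exprD normrM !(@ger0_norm _ (z ^+ _)) ?exprn_ge0//; try exact: ltW.
    rewrite mulrC -[X in _ <= X]mulrA; apply: ler_pM => //.
      by rewrite mulr_ge0// exprn_ge0// ltW.
    apply: ler_wpM2l; first by rewrite exprn_ge0// ltW.
    by rewrite lerXn2r// nnegrE ?invr_ge0// ltW.
  rewrite -mulr_sumr mulrC -mulrA; apply: ler_wpM2r; last exact: geom_half_le.
  by rewrite mulr_ge0// exprn_ge0// ltW.
have key z : 0 < z <= 2^-1 -> `|(E1 - rho 1%N) * z + (E2 - rho 2%N) * z ^+ 2| <= (2 * M + `|Q|) * z ^+ 3.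
  move=> zz; have := sm z zz; have /andP[z0 zh] := zz.
  have z1 : 0 <= z <= 1 by rewrite ltW//= (le_trans zh)// invf_le1// ler1n.
  have /andP[b1 b2] := bF z z1.
  have z3 : 0 <= z ^+ 3 by rewrite exprn_ge0// ltW.
  have Qz := ler_wpM2l z3 (ler_norm Q).
  have Qz' : 0 <= z ^+ 3 * `|Q| by rewrite mulr_ge0.
  rewrite !ler_norml mulrDl => /andP[b3 b4].
  by apply/andP; split; lra.
have e1 : E1 = rho 1%N.
  apply/eqP; rewrite -subr_eq0; apply/eqP; apply: (@eq0_of_small _ (`|E2 - rho 2%N| + (2 * M + `|Q|))) => z zz.
  have /andP[z0 zh] := zz; have zn0 : 0 <= z by exact: ltW.
  rewrite -(ler_pM2r z0) -[X in _ * X <= _](ger0_norm zn0) -normrM.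
  have -> : (E1 - rho 1%N) * z = ((E1 - rho 1%N) * z + (E2 - rho 2%N) * z ^+ 2) - (E2 - rho 2%N) * z ^+ 2 by ring.
  apply: le_trans (ler_normB _ _) _; rewrite normrM (ger0_norm (sqr_ge0 z)).
  rewrite [X in _ <= X](_ : _ = (2 * M + `|Q|) * z ^+ 2 + `|E2 - rho 2%N| * z ^+ 2); last by ring.
  rewrite lerD2r.
  apply: le_trans (key z zz) _; apply: ler_wpM2l; first by rewrite addr_ge0// mulr_ge0.
  by rewrite exprS ler_piMl ?sqr_ge0// (le_trans zh)// invf_le1// ler1n.
split=> //; apply/eqP; rewrite -subr_eq0; apply/eqP; apply: (@eq0_of_small _ (2 * M + `|Q|)) => z zz.
have := key z zz; rewrite e1 subrr mul0r add0r normrM.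
have /andP[z0 _] := zz; rewrite (ger0_norm (sqr_ge0 z)) => h.
have z2 : 0 < z ^+ 2 by rewrite exprn_gt0.
by rewrite -(ler_pM2r z2) -mulrA -exprS.
Qed.

End list_products.

(** * Configurations restricted to a ball *)

Section configuration_list.
Context {R : realType}.

(** Particles repeated according to their multiplicities: every functional that
    does not see the outside of the ball becomes a finite sum or product over
    one list. *)
Lemma conf_list (r : R) (X : conf R) : exists u : seq R,
  [/\ forall x, x \in u -> `|x| <= r,
      forall F : R -> R, (forall x, r < `|x| -> F x = 0) ->
        \sum_(x \in [set: R]) (F x *+ X x) = \sum_(x <- u) F x,
      forall g : R -> R[i], (forall x, r < `|x| -> g x = 1) ->
        mult_functional g X = \prod_(x <- u) g x
    & forall A : set R, A `<=` [set x | `|x| <= r] ->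
        num_particles A X = (\sum_(x <- u) (x \in A))%N].
Proof.
pose B := [set x : R | `|x| <= r].
have bB : bounded_set B.
  exists r; split; first exact: num_real.
  by move=> M rM x /= xr; exact: le_trans xr (ltW rM).
have fB := mult_locally_finite X bB.
pose s := finmap.enum_fset (fset_set (B `&` [set x | X x != 0%N])).
have sE x : x \in s = (`|x| <= r) && (X x != 0%N).
  have H : (x \in s) = (x \in B `&` [set x | X x != 0%N]) by exact: (in_fset_set fB x).
  rewrite H; apply/idP/andP => [/set_mem[]|[h1 h2]]; first by split.
  exact: mem_set.
have us : uniq s by exact: finmap.fset_uniq.
exists (flatten [seq nseq (X x) x | x <- s]).
split.
- move=> x /flatten_mapP[y]; rewrite sE => /andP[yr _]; rewrite mem_nseq => /andP[_ /eqP ->].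
  exact: yr.
- move=> F F0; rewrite (@fsbigE _ _ _ _ _ s) //.
  + rewrite big_flatten big_map; under eq_bigl do rewrite in_setT.
    by apply: eq_bigr => x _; rewrite big_nseq iter_addr_0.
  + move=> x _; rewrite sE negb_and -ltNge negbK => /orP[/F0 ->|/eqP ->]; last by rewrite mulr0n.
    by rewrite mul0rn.
- move=> g g1; rewrite /mult_functional (@fsbigE _ _ _ _ _ s) //.
  + rewrite big_flatten big_map; under eq_bigl do rewrite in_setT.
    by apply: eq_bigr => x _; rewrite big_nseq iter_mulr_1.
  + move=> x _; rewrite sE negb_and -ltNge negbK => /orP[/g1 ->|/eqP ->]; last by rewrite expr0.
    by rewrite expr1n.
- move=> A AB; rewrite /num_particles.
  rewrite (@fsbigE _ _ _ _ _ [seq x <- s | x \in A]) ?filter_uniq//.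
  + transitivity (\sum_(x <- s) ((x \in A) * X x))%N.
      rewrite big_filter_cond big_mkcond /=; apply: eq_bigr => x _.
      by rewrite andbb; case: (x \in A); rewrite ?mul1n.
    rewrite big_flatten big_map /=; apply: eq_bigr => x _.
    by rewrite big_nseq iter_addn_0.
  + by move=> x /=; rewrite mem_filter => /andP[/set_mem].
  + move=> x Ax; rewrite mem_filter mem_set//= sE negb_and negbK => /orP[|/eqP//].
    by rewrite (AB _ Ax).
Qed.

End configuration_list.

(** * Traces of the first two exterior powers *)

Section double_sums.
Context {R : realType}.

Lemma sum_lt_half (N : nat) (h : 'I_N -> 'I_N -> R[i]) :
  (forall i j, h i j = h j i) -> (forall i, h i i = 0) ->
  2 * \sum_(p : 'I_N * 'I_N | (p.1 < p.2)%N) h p.1 p.2 = \sum_i \sum_j h i j.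
Proof.
move=> hC h0; rewrite pair_bigA /= [RHS](bigID (fun p : 'I_N * 'I_N => (p.1 < p.2)%N)) /=.
rewrite mulr2n mulrDl mul1r; congr (_ + _).
rewrite [RHS](bigID (fun p : 'I_N * 'I_N => (p.2 < p.1)%N)) /= [X in _ = _ + X]big1 ?addr0; last first.
  move=> [i j] /= /andP[]; rewrite -!leqNgt => ji ij.
  have -> : i = j by apply/val_inj/eqP; rewrite /= eqn_leq ij ji.
  exact: h0.
rewrite (reindex_inj (h := fun p : 'I_N * 'I_N => (p.2, p.1))) /=; last by move=> [a b] [c d] /= [-> ->].
apply: eq_big => [[i j]|[i j] _] /=; last exact: hC.
by case: ltngtP.
Qed.

Lemma det2 (M : 'M[R[i]]_2) : \det M = M 0 0 * M 1 1 - M 0 1 * M 1 0.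
Proof.
rewrite (expand_det_row _ 0) !big_ord_recl big_ord0 addr0 /cofactor !det_mx11 !mxE /=.
rewrite expr0 mul1r expr1 mulN1r mulrN.
congr (_ * M _ _ - M _ _ * M _ _); exact/val_inj.
Qed.

(** [ext_trace] for an arbitrary infinite matrix; it is the sum of the principal
    minors of order n of the N x N truncation. *)
Definition wedge_sum (a : nat -> nat -> R[i]) (n N : nat) : R[i] :=
  \sum_(s : {ffun 'I_n -> 'I_N} | [forall i : 'I_n, forall j : 'I_n, (i < j)%N ==> (s i < s j)%N])
    \det (\matrix_(i < n, j < n) a (s j) (s i)).

Lemma wedge_sum0 a N : wedge_sum a 0 N = 1.
Proof.
rewrite /wedge_sum (eq_bigl xpredT); last first.
  by move=> s; apply/forallP => -[].
under eq_bigr do rewrite det_mx00.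
by rewrite sumr_const card_ffun !card_ord expn0.
Qed.

Lemma wedge_sum1 a N : wedge_sum a 1 N = \sum_(i < N) a i i.
Proof.
rewrite /wedge_sum (eq_bigl xpredT); last first.
  by move=> s; apply/forallP => i; apply/forallP => j; rewrite !ord1 ltnn.
rewrite (reindex (fun i : 'I_N => [ffun => i] : {ffun 'I_1 -> 'I_N})) /=; last first.
  exists (fun s : {ffun 'I_1 -> 'I_N} => s ord0) => [i _|s _]; first by rewrite ffunE.
  by apply/ffunP => i; rewrite ffunE (ord1 i).
by apply: eq_bigr => i _; rewrite det_mx11 mxE !ffunE.
Qed.

(** tr(Lambda^2 A) = (tr(A)^2 - tr(A^2)) / 2. *)
Lemma wedge_sum2 a N :
  2 * wedge_sum a 2 N = (\sum_(i < N) a i i) ^+ 2 - \sum_(j < N) \sum_(i < N) a j i * a i j.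
Proof.
pose h (i j : 'I_N) := a i i * a j j - a j i * a i j.
have -> : wedge_sum a 2 N = \sum_(p : 'I_N * 'I_N | (p.1 < p.2)%N) h p.1 p.2.
  pose f (p : 'I_N * 'I_N) : {ffun 'I_2 -> 'I_N} := [ffun i : 'I_2 => if i == 0 then p.1 else p.2].
  rewrite /wedge_sum (reindex f) /=; last first.
    exists (fun s : {ffun 'I_2 -> 'I_N} => (s 0, s 1)) => [[i j] _|s _]; first by rewrite !ffunE.
    apply/ffunP => i; rewrite ffunE; case: eqP => [->//|/eqP i0] /=.
    by congr (s _); apply/val_inj; case: i i0 => [[|[|]]].
  apply: eq_big => [p|p _].
    apply/forallP/idP => [/(_ 0)/forallP/(_ 1)|pl i]; first by rewrite !ffunE.
    apply/forallP => j; apply/implyP; rewrite !ffunE.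
    by case: i j => [[|[|]]// ?] [[|[|]]// ?].
  rewrite det2 !mxE !ffunE /= /h; ring.
rewrite sum_lt_half; [|by move=> i j; rewrite /h; ring|by move=> i; rewrite /h; ring].
rewrite expr2 big_distrl /= -sumrB; apply: eq_bigr => i _.
rewrite big_distrr /= -sumrB; apply: eq_bigr => j _; rewrite /h; ring.
Qed.

(** The real part of tr(A)^2 is at most (Re tr A)^2. *)
Lemma Re_wedge_sum2 a N :
  2 * Re (wedge_sum a 2 N) <=
  Re (wedge_sum a 1 N) ^+ 2 - \sum_(j < N) \sum_(i < N) Re (a j i * a i j).
Proof.
have H := congr1 (@complex.Re R) (wedge_sum2 a N).
have E (w : R[i]) : Re (2 * w) = 2 * Re w by rewrite mulr2n mulrDl mul1r reimE; ring.
rewrite -E H wedge_sum1 ReD ReN Re_sum.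
rewrite (eq_bigr (fun j : 'I_N => \sum_(i < N) Re (a j i * a i j))); last by move=> j _; rewrite Re_sum.
by rewrite lerD2r expr2 reimE -expr2 -expr2 lerBlDr lerDl sqr_ge0.
Qed.

Lemma wedge_sumZ (z : R[i]) (a b : nat -> nat -> R[i]) n N : (forall j i, b j i = z * a j i) ->
  wedge_sum b n N = z ^+ n * wedge_sum a n N.
Proof.
move=> ba; rewrite mulr_sumr; apply: eq_bigr => s _; rewrite -detZ; congr (\det _).
by apply/matrixP => i j; rewrite !mxE ba.
Qed.

Lemma cvgC_Re (u : nat -> R[i]) (l : R[i]) : u n @[n --> \oo] --> (l : R[i]^o) ->
  Re (u n) @[n --> \oo] --> Re l.
Proof.
move=> /(@cvgrPdist_lt R[i] (R[i]^o) nat \oo _ u l) ul; apply/cvgrPdist_lt => eps eps0.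
have e0 : 0 < eps%:C by rewrite ltcR.
have := ul _ e0; apply: filterS => n /= h.
rewrite -ReN -ReD; apply: le_lt_trans (Re_le_normc _) _.
by rewrite -ltcR; move: h; rewrite /Num.norm /=.
Qed.

End double_sums.

(** * Mean and variance of linear statistics *)

Lemma ereal_half_diff {R : realType} (q p s : \bar R) : (s < +oo)%E ->
  (0 <= s)%E -> (0 <= p)%E -> (0 <= q)%E -> (q + 2%:E * p = s + s)%E ->
  q = (2 * (fine s - fine p))%:E.
Proof.
case: s => [s||]// _ _; case: p => [p||]// _; last first.
  by rewrite mulry gtr0_sg// mul1e; case: q.
case: q => [q||]// _; rewrite -EFinM -!EFinD => -[E].
by congr (_%:E); rewrite /=; lra.
Qed.

Lemma Rintegral_one {d} {T : measurableType d} {R : realType} (P : probability T R) :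
  (\int[P]_X (1 : R))%R = 1.
Proof. by rewrite /Rintegral integral_cst//= mul1e probability_setT. Qed.

Lemma variance_arith {R : realType} (m p q s : R) : 2 * s <= m ^+ 2 - q ->
  1 * (2 * s + 1 * p) + 1 * (- 2 * m * m + m ^+ 2 * 1) <= 2^-1 * (2 * (p - q)).
Proof. by move=> h; lra. Qed.

Section moments.
Context {R : realType}.
Local Notation T := (measurableTypeR R).
Variables (U : set T) (K : T -> T -> R[i]).
Hypothesis mU : measurable U.
Local Notation mu := (@lebesgue_measure R).
Hypothesis projK : projection_kernel mu U K.
Hypothesis finK : forall r, 0 < r -> (wint U K (fun x _ => ball_ind r x) < +oo)%E.
Variable e : nat -> T -> R[i].
Hypothesis he : orthonormal_basis mu U e.
Variable P : probability (confB R) R.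
Hypothesis hdet : forall (g : R -> R[i]) (B : set R),
    cmeasurable setT g ->
    (exists M : R, forall x, normc (g x) <= M) ->
    measurable B -> bounded_set B -> (forall x, ~ B x -> g x = 1) ->
    cintegrable P setT (mult_functional g) /\
    is_fredholm_det mu U e
      (mul_operator (fun x => g x - 1) \o kernel_operator mu U K
         \o mul_operator (cindic B))
      (cintegral P setT (mult_functional g)).
Local Notation inner := (inner mu U).
Local Notation A := (kernel_operator mu U K).
Local Notation amat := (amat U K e).
Implicit Types (f : T -> R) (X : conf R).

Definition linstat f X : R := \sum_(x \in [set: R]) (f x *+ X x).

(** The generating function of the linear statistic; its expectation is the
    Fredholm determinant of 1 + z f K. *)
Definition psi f (z : R) X : R := Re (mult_functional (fun x : R => (1 + z * f x)%:C) X).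

(** The sum of f(x) f(y) over unordered pairs of particles. *)
Definition pair_stat f X : R := (linstat f X ^+ 2 - linstat (fun x => f x ^+ 2) X) / 2.

Definition triple_rest f X : R := psi f 1 X - 1 - linstat f X - pair_stat f X.

Lemma prodrC (I : Type) (s : seq I) (F : I -> R) :
  \prod_(i <- s) (F i)%:C%C = (\prod_(i <- s) F i)%:C.
Proof.
elim: s => [|a s ih]; first by rewrite !big_nil.
by rewrite !big_cons ih; apply: complex_ext; rewrite !reimE /=; ring.
Qed.

Lemma normcR (a : R) : normc a%:C = `|a|.
Proof. by rewrite /= expr0n/= addr0 sqrtr_sqr. Qed.

Section fixed_f.
Variables (f : T -> R) (r : R).
Hypothesis nf : bsupp f.
Hypothesis r0 : 0 < r.
Hypothesis fr : forall x : T, r < `|x : R| -> f x = 0.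
Hypothesis f0 : forall x, 0 <= f x.

(** Pointwise in X, the expansion of [prod_taylor]. All the terms are at most
    [psi f 1], which is integrable, and this is what makes the moments finite. *)
Lemma psi_taylor X : [/\ 0 <= linstat f X, 0 <= pair_stat f X, 0 <= triple_rest f X &
  forall z, 0 <= z <= 1 ->
  1 + z * linstat f X + z ^+ 2 * pair_stat f X <= psi f z X <=
  1 + z * linstat f X + z ^+ 2 * pair_stat f X + z ^+ 3 * triple_rest f X].
Proof.
have [u [_ uF ug _]] := conf_list r X.
pose v := [seq f x | x <- u].
have v0 a : a \in v -> 0 <= a by move=> /mapP[x _ ->].
have E1 : linstat f X = \sum_(a <- v) a by rewrite /linstat uF// big_map.
have E2 : linstat (fun x => f x ^+ 2) X = \sum_(a <- v) a ^+ 2.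
  by rewrite /linstat uF ?big_map// => x rx; rewrite fr// expr0n.
have Ep z : psi f z X = \prod_(a <- v) (1 + z * a).
  rewrite /psi ug; last by move=> x rx; rewrite fr// mulr0 addr0.
  by rewrite prodrC /= big_map.
have E3 : pair_stat f X = esum2 v by rewrite /pair_stat E1 E2.
have E4 : triple_rest f X = third_rest v.
  rewrite /triple_rest /third_rest E3 E1 Ep; congr (_ - _ - _ - _).
  by apply: eq_bigr => a _; rewrite mul1r.
have [q0 H] := prod_taylor v0.
split.
- by rewrite E1 big_seq sumr_ge0.
- by rewrite E3 esum2_ge0.
- by rewrite E4.
- by move=> z z01; rewrite E1 E3 E4 Ep; exact: H.
Qed.

Let B := [set x : R | `|x| <= r].

Lemma measurable_cball : measurable B.
Proof.
have -> : B = `[- r, r]%classic.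
  by apply/seteqP; split => x /=; rewrite in_itv /= -ler_norml.
exact: measurable_itv.
Qed.

Lemma bounded_cball : bounded_set B.
Proof.
exists r; split; first exact: num_real.
by move=> M rM x /= xr; exact: le_trans xr (ltW rM).
Qed.

Lemma cindic_ball x : cindic B x = (ball_ind r x)%:C.
Proof.
rewrite /cindic /ball_ind indicE; congr ((nat_of_bool _)%:R)%:C.
by apply/idP/idP; rewrite inE.
Qed.

Local Notation b := (@ball_ind R r).

Let nb : bsupp b. Proof. exact: bsupp_ball_ind. Qed.

Lemma mult_functional_det z : 0 <= z ->
  cintegrable P setT (mult_functional (fun x : R => (1 + z * f x)%:C)) /\
  is_fredholm_det mu U e
      (mul_operator (fun x : T => (1 + z * f x)%:C - 1) \o A \o mul_operator (cindic B))
      (cintegral P setT (mult_functional (fun x : R => (1 + z * f x)%:C))).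
Proof.
move=> z0; have [mf [M fM] _] := nf; apply: hdet.
- have mf' : measurable_fun (setT : set R) (f : R -> R) by exact: mf.
  apply: cmeasR; apply: measurable_funD; first exact: measurable_cst.
  by apply: measurable_funM => //; exact: measurable_cst.
- exists (1 + z * M) => x; rewrite normcR.
  apply: le_trans (ler_normD _ _) _; rewrite normr1 lerD2l normrM (ger0_norm z0).
  exact: ler_wpM2l.
- exact: measurable_cball.
- exact: bounded_cball.
- by move=> x /negP; rewrite -ltNge => rx; rewrite fr// mulr0 addr0.
Qed.

Lemma mult_operator_coef z j i :
  inner ((mul_operator (fun x : T => (1 + z * f x)%:C - 1) \o A \o mul_operator (cindic B)) (e j)) (e i)
  = z%:C * amat f b j i.
Proof.
have Le k := onb_L2 he k; have Lb := bsupp_L2 mU nb (Le j); have PB := proj_L2 projK Lb.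
have Lf := bsupp_L2 mU nf PB.
have E1 : mul_operator (cindic B) (e j) = (fun y : T => (b y)%:C * e j y).
  by apply/funext => y; rewrite /mul_operator cindic_ball.
rewrite /comp E1.
have E2 : mul_operator (fun x : T => (1 + z * f x)%:C - 1) (A (fun y : T => (b y)%:C * e j y)) =
   (fun x : T => z%:C * ((f x)%:C * A (fun y : T => (b y)%:C * e j y) x)).
  by apply/funext => x; rewrite /mul_operator; apply: complex_ext; rewrite !reimE /=; ring.
by rewrite E2 (innerZ mU z%:C Lf (Le i)) amatE (bsupp_innerR nf PB (Le i)).
Qed.

(** By homogeneity the n-th exterior trace of z f K chi is z^n times that of f K
    chi, so the coefficients obtained at z = 1 serve for all z. *)
Lemma fredholm_coef : exists rho : nat -> R,
  (forall n, Re (wedge_sum (amat f b) n N) @[N --> \oo] --> rho n) /\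
  (forall z, 0 <= z -> \sum_(k < n) z ^+ k * rho k @[n --> \oo] -->
     (\int[P]_X psi f z X)%R).
Proof.
(* The determinant at z comes with its own sequence of coefficients. *)
have H z : 0 <= z -> exists c : nat -> R[i],
   (forall n, z ^+ n * Re (wedge_sum (amat f b) n N) @[N --> \oo] --> Re (c n)) /\
   (\sum_(k < n) Re (c k) @[n --> \oo] --> (\int[P]_X psi f z X)%R).
  move=> z0; have [_ [c [c1 c2]]] := mult_functional_det z0; exists c; split.
    move=> n; have := cvgC_Re (c1 n); apply: eq_cvgn => N.
    have -> : ext_trace mu U e (mul_operator (fun x : T => (1 + z * f x)%:C - 1) \o A \o mul_operator (cindic B)) n N =
       wedge_sum (fun j i => z%:C * amat f b j i) n N.
      apply: eq_bigr => s _; congr (\det _); apply/matrixP => i j; rewrite !mxE; exact: mult_operator_coef.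
    rewrite (@wedge_sumZ _ z%:C (amat f b))//.
    have -> : z%:C ^+ n = (z ^+ n)%:C :> R[i] by rewrite rmorphXn.
    by rewrite reimE /= mul0r subr0.
  have := cvgC_Re c2; apply: eq_cvgn => n.
  by rewrite Re_sum big_mkord.
have [c [c1 c2]] := H 1 ler01.
exists (fun n => Re (c n)).
have c1' n : Re (wedge_sum (amat f b) n N) @[N --> \oo] --> Re (c n).
  by have := c1 n; apply: eq_cvgn => N; rewrite expr1n mul1r.
split=> // z z0; have [cz [cz1 cz2]] := H z z0.
move: cz2; apply: eq_cvgn => n; apply: eq_bigr => k _.
exact: (cvg_unique (@Rhausdorff R) (cz1 k) (cvgM (cvg_cst _) (c1' k))).
Qed.

Lemma psi_integrable z : 0 <= z -> P.-integrable setT (EFin \o psi f z).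
Proof. by move=> z0; have [[]] := mult_functional_det z0. Qed.

(** For the vague Borel structure, S_f is the derivative at 0 of [psi f], whose
    measurability is part of the determinantal hypothesis: (psi_z - 1) / z
    converges to S_f as z = 1/(k+1) tends to 0. *)
Lemma linstat_meas : measurable_fun (setT : set (confB R)) (linstat f).
Proof.
apply: (@measurable_fun_cvg _ (confB R) R setT (fun k (X : confB R) => k.+1%:R * (psi f k.+1%:R^-1 X - 1))).
  move=> k; apply: measurable_funM; first exact: measurable_cst.
  apply: measurable_funB; last exact: measurable_cst.
  have k0 : 0 <= k.+1%:R^-1 :> R by rewrite invr_ge0.
  by have /measurable_int/measurable_EFinP := psi_integrable k0.
move=> X _; have [S0 p0 t0 H] := psi_taylor X.
have inv0 : (k.+1%:R^-1 : R) @[k --> \oo] --> 0 by exact: cvg_harmonic.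
apply: (@squeeze_cvgr _ _ _ _ (fun k => linstat f X) (fun k => linstat f X + k.+1%:R^-1 * (pair_stat f X + triple_rest f X))).
- apply: nearW => k.
  have kp : 0 < k.+1%:R^-1 :> R by rewrite invr_gt0.
  have kn : k.+1%:R != 0 :> R by [].
  have z01 : 0 <= (k.+1%:R^-1 : R) <= 1 by rewrite ltW//= invf_le1// ler1n.
  have /andP[h1 h2] := H _ z01; move: z01 => /andP[_ z1].
  set z : R := k.+1%:R^-1 in kp h1 h2 z1 *.
  have -> : k.+1%:R = z^-1 :> R by rewrite /z invrK.
  have zi : 0 < z^-1 by rewrite invr_gt0.
  rewrite -(ler_pM2l kp) mulrA mulfV ?gt_eqF// mul1r.
  rewrite -[X in _ && X](ler_pM2l kp) mulrA mulfV ?gt_eqF// mul1r.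
  have z2 : z ^+ 3 * triple_rest f X <= z ^+ 2 * triple_rest f X.
    by rewrite ler_wpM2r// exprS ler_piMl// ?sqr_ge0.
  have z3 : 0 <= z ^+ 2 * pair_stat f X by rewrite mulr_ge0 ?sqr_ge0.
  by apply/andP; split; [lra|nra].
- exact: cvg_cst.
- rewrite -[X in _ --> X]addr0; apply: cvgD; first exact: cvg_cst.
  by rewrite -[X in _ --> X](mul0r (pair_stat f X + triple_rest f X)); apply: cvgM => //; exact: cvg_cst.
Qed.

End fixed_f.

Lemma bsupp_sqr f : bsupp f -> bsupp (fun x => f x ^+ 2).
Proof.
move=> [mf [M fM] [r [r0 fr]]]; split; first exact: measurable_funX.
- exists (M ^+ 2) => x; rewrite normrX lerXn2r// ?nnegrE//.
  exact: le_trans (fM x).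
- by exists r; split => // x rx; rewrite fr// expr0n.
Qed.

(** The squeeze of [psi_taylor] survives integration, and [coef_match]
    identifies the integrals of its coefficients with the first two exterior
    traces. *)
Lemma linstat_moments f : bsupp f -> (forall x, 0 <= f x) ->
  [/\ P.-integrable setT (EFin \o linstat f),
      P.-integrable setT (EFin \o pair_stat f),
      (\int[P]_X linstat f X)%R = fine (wint U K (fun _ y => f y)) &
      2 * (\int[P]_X pair_stat f X)%R <=
        fine (wint U K (fun _ y => f y)) ^+ 2 - fine (wint U K (fun x y => f x * f y))].
Proof.
move=> nf f0; have [mf _ [r [r0 fr]]] := nf.
have nb := bsupp_ball_ind r0.
have b0 x : 0 <= ball_ind r x by rewrite /ball_ind.
have fb x : f x * ball_ind r x = f x.
  by rewrite /ball_ind; case: lerP => [_|/fr ->]; rewrite ?mulr1 ?mul0r.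
have tay X := psi_taylor fr f0 X.
have mS := linstat_meas nf fr f0.
have mS2 : measurable_fun (setT : set (confB R)) (linstat (fun x => f x ^+ 2)).
  apply: (@linstat_meas (fun x : T => f x ^+ 2) r (bsupp_sqr nf)) => x; last exact: sqr_ge0.
  by move=> rx; rewrite fr// expr0n.
have mp : measurable_fun (setT : set (confB R)) (pair_stat f).
  apply: measurable_funM; last exact: measurable_cst.
  by apply: measurable_funB => //; exact: measurable_funX.
have ip1 := psi_integrable nf fr (@ler01 R).
have bd X : linstat f X <= psi f 1 X /\ pair_stat f X <= psi f 1 X.
  have [S0 p0 t0 H] := tay X; have /andP[h _] := H 1 (introT andP (conj (@ler01 R) (lexx 1))).
  by move: h; rewrite expr1n !mul1r => h; split; lra.
have iS : P.-integrable setT (EFin \o linstat f).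
  apply: (rint_dom measurableT mS _ ip1) => X _; have [S0 _ _ _] := tay X.
  by rewrite ger0_norm//; case: (bd X).
have ip : P.-integrable setT (EFin \o pair_stat f).
  apply: (rint_dom measurableT mp _ ip1) => X _; have [_ p0 _ _] := tay X.
  by rewrite ger0_norm//; case: (bd X).
have i1 : P.-integrable setT (EFin \o (fun _ : confB R => (1 : R))).
  exact: finite_measure_integrable_cst.
have it : P.-integrable setT (EFin \o triple_rest f).
  have := rint_lin measurableT 1 1 (rint_lin measurableT 1 (-1) ip1 i1) (rint_lin measurableT (-1) (-1) iS ip).
  by apply: rint_eq => // X _; rewrite /triple_rest; ring.
have [rho [rho1 rho2]] := fredholm_coef nf r0 fr.
have [] := @coef_match _ (fun z => (\int[P]_X psi f z X)%R) rho
  (\int[P]_X linstat f X)%R (\int[P]_X pair_stat f X)%R (\int[P]_X triple_rest f X)%R.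
- apply: (cvg_unique (@Rhausdorff R) (rho1 0%N)).
  by apply: (@eq_cvgn _ (fun=> 1) _ 1); [move=> N; rewrite wedge_sum0|exact: cvg_cst].
- exact: rho2.
- move=> z z01; have z0 : 0 <= z by case/andP: z01.
  have ipz := psi_integrable nf fr z0.
  have E1 : (\int[P]_X 1 = 1 :> R)%R.
    exact: Rintegral_one.
  have H2 : (1 + z * \int[P]_X linstat f X + z ^+ 2 * \int[P]_X pair_stat f X =
     \int[P]_X (1 * (1 * 1 + z * linstat f X) + z ^+ 2 * pair_stat f X))%R.
    rewrite (Rintegral_lin measurableT); [|exact: rint_lin|by []].
    by rewrite (Rintegral_lin measurableT)// E1 !mul1r.
  have i2 := rint_lin measurableT 1 (z ^+ 2) (rint_lin measurableT 1 z i1 iS) ip.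
  rewrite H2 -[X in _ <= _ <= X + _]mul1r -(Rintegral_lin measurableT)//.
  apply/andP; split; apply: le_Rintegral => //.
  + by move=> X _; have [_ _ _ H] := tay X; have /andP[h _] := H z z01; rewrite !mul1r.
  + exact: rint_lin.
  + by move=> X _; have [_ _ _ H] := tay X; have /andP[_ h] := H z z01; rewrite !mul1r.
move=> e1 e2.
have r1 : rho 1%N = fine (wint U K (fun _ y => f y)).
  apply: (cvg_unique (@Rhausdorff R) (rho1 1%N)).
  have := amat_trace_cvg mU projK finK he nf nb f0 b0.
  have -> : wint U K (fun _ y => f y * ball_ind r y) = wint U K (fun _ y => f y).
    by apply: wint_eq => x y; rewrite fb.
  by apply: eq_cvgn => N; rewrite wedge_sum1 Re_sum.
split => //; first by rewrite e1 r1.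
rewrite e2 -r1.
have c2 : 2 * Re (wedge_sum (amat f (ball_ind r)) 2 N) @[N --> \oo] --> 2 * rho 2%N.
  by apply: cvgM; [exact: cvg_cst|exact: rho1].
have c3 : Re (wedge_sum (amat f (ball_ind r)) 1 N) ^+ 2 -
    \sum_(j < N) \sum_(i < N) Re (amat f (ball_ind r) j i * amat f (ball_ind r) i j)
    @[N --> \oo] --> rho 1%N ^+ 2 - fine (wint U K (fun x y => f x * f y)).
  apply: cvgB.
    by rewrite expr2; under eq_fun do rewrite expr2; apply: cvgM; exact: rho1.
  have := amat_trace2_cvg mU projK finK he nf nb f0 b0.
  have -> // : wint U K (fun x y => f x * ball_ind r x * (f y * ball_ind r y)) = wint U K (fun x y => f x * f y).
  by apply: wint_eq => x y; rewrite !fb.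
apply: (ler_cvg_to c2 c3); apply: nearW => N.
exact: Re_wedge_sum2.
Qed.

(** Expansion of the square, in which the two square terms agree by the symmetry
    of K. *)
Lemma wint_diff f : bsupp f -> (forall x, 0 <= f x) ->
  wint U K (fun x y => (f x - f y) ^+ 2) =
  (2 * (fine (wint U K (fun _ y => f y ^+ 2)) - fine (wint U K (fun x y => f x * f y))))%:E.
Proof.
move=> nf f0; have [mf _ _] := nf.
have F1 : (wint U K (fun x _ => (f x ^+ 2)%R) < +oo)%E by exact: wint_bsupp_fin.
have sq0 (a : R) : 0 <= a ^+ 2 by exact: sqr_ge0.
have m1 : meas2 U (fun x _ : T => f x ^+ 2) by apply: meas2X; exact: meas2_fst.
have m2 : meas2 U (fun _ y : T => f y ^+ 2) by apply: meas2X; exact: meas2_snd.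
have m3 : meas2 U (fun x y : T => f x * f y) by apply: meas2M; [exact: meas2_fst|exact: meas2_snd].
have m4 : meas2 U (fun x y : T => (f x - f y) ^+ 2).
  by apply: meas2X; apply: meas2B; [exact: meas2_fst|exact: meas2_snd].
have p3 (x y : T) : 0 <= f x * f y by rewrite mulr_ge0.
have p4 (x y : T) : 0 <= 2 * (f x * f y) by rewrite mulr_ge0.
have S := wint_bsupp_swap mU projK finK he nf.
have D1 := wintD mU projK m4 (meas2M (@meas2_cst _ _ _ U 2) m3) (fun x y => sq0 (f x - f y)) p4.
have D2 := wintD mU projK m1 m2 (fun x _ => sq0 (f x)) (fun _ y => sq0 (f y)).
rewrite (wintZ mU projK (ler0n R 2) m3 p3) in D1.
have E : wint U K (fun x y => (f x - f y) ^+ 2 + 2 * (f x * f y)) =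
         wint U K (fun x y => f x ^+ 2 + f y ^+ 2) by apply: wint_eq => x y; ring.
rewrite D1 D2 S in E.
have q0 := wint_ge0 U K (fun x y => sq0 (f x - f y)); have p0 := wint_ge0 U K p3.
have s0 := wint_ge0 U K (fun x _ => sq0 (f x)).
have H := ereal_half_diff F1 s0 p0 q0 E.
exact: (etrans H (congr1 (fun s => (2 * (fine s - _))%:E) (esym S))).
Qed.

(** E S^2 = E S_(f^2) + 2 E(pair sum), and the square of the mean cancels
    against that of [linstat_moments]. The inequality is that of
    [Re_wedge_sum2]. *)
Lemma linstat_variance f : bsupp f -> (forall x, 0 <= f x) ->
  P.-integrable setT (EFin \o (fun X => (linstat f X - (\int[P]_X linstat f X)%R) ^+ 2)) /\
  ((\int[P]_X ((linstat f X - (\int[P]_X linstat f X)%R) ^+ 2)%:E) <=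
   2^-1%:E * wint U K (fun x y => ((f x - f y) ^+ 2)%R))%E.
Proof.
move=> nf f0; have [i1 i2 E1 E2] := linstat_moments nf f0.
have [i3 _ E3 _] := linstat_moments (bsupp_sqr nf) (fun x => sqr_ge0 (f x)).
set m := (\int[P]_X linstat f X)%R in E1 *.
have ic : P.-integrable setT (EFin \o (fun _ : confB R => (1 : R))).
  exact: finite_measure_integrable_cst.
have eqX X : (linstat f X - m) ^+ 2 = 1 * (2 * pair_stat f X + 1 * linstat (fun x => f x ^+ 2) X) +
   1 * ((- 2 * m) * linstat f X + m ^+ 2 * 1).
  by rewrite /pair_stat; field.
have j1 := rint_lin measurableT 2 1 i2 i3.
have j2 := rint_lin measurableT (- 2 * m) (m ^+ 2) i1 ic.
have iV : P.-integrable setT (EFin \o (fun X => (linstat f X - m) ^+ 2)).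
  have := rint_lin measurableT 1 1 j1 j2; apply: rint_eq => // X _; by rewrite eqX.
split => //.
rewrite wint_diff// -EFinM.
have -> : (\int[P]_X ((linstat f X - m) ^+ 2)%:E)%E = ((\int[P]_X (linstat f X - m) ^+ 2)%R)%:E.
  by rewrite /Rintegral fineK//; exact: integrable_fin_num iV.
rewrite lee_fin.
have -> : (\int[P]_X (linstat f X - m) ^+ 2 = \int[P]_X (1 * (2 * pair_stat f X + 1 * linstat (fun x => f x ^+ 2) X) +
   1 * ((- 2 * m) * linstat f X + m ^+ 2 * 1)))%R.
  by apply: eq_Rintegral => X _; rewrite eqX.
rewrite (Rintegral_lin measurableT)// !(Rintegral_lin measurableT)//.
rewrite Rintegral_one.
by rewrite E3 -/m; apply: variance_arith; rewrite E1.
Qed.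

End moments.

(** * Power integrals and the far kernel bound *)

Section power_integrals.
Context {R : realType}.
Local Notation T := (measurableTypeR R).
Local Notation mu := (@lebesgue_measure R).
Implicit Types a delta x y : R.

Lemma powRE x p : 0 < x -> x `^ p = expR (p * ln x).
Proof. by move=> x0; rewrite /powR gt_eqF. Qed.

Lemma powR_primitive delta x : 0 < delta -> 0 < x ->
  is_derive x 1 (fun y : R => - delta^-1 * y `^ (- delta)) (x `^ (- (1 + delta))).
Proof.
move=> d0 x0; have H := is_derive1_powR (- delta) x0.
have := is_deriveZ (- delta^-1) H.
have -> : x `^ (- (1 + delta)) = - delta^-1 *: (- delta * x `^ (- delta - 1)).
  rewrite opprD addrC /GRing.scale /= mulrA mulrNN mulVf ?gt_eqF// mul1r.
  by [].
by [].
Qed.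

Lemma powR_primitive_cvg delta : 0 < delta ->
  - delta^-1 * y `^ (- delta) @[y --> +oo%R] --> (0 : R).
Proof.
move=> d0; apply/cvgrPdist_le => eps eps0.
pose M := (delta * eps)^-1 `^ delta^-1.
have de0 : 0 < delta * eps by rewrite mulr_gt0.
have M0 : 0 < M by rewrite powR_gt0// invr_gt0.
near=> y.
have My : M <= y by near: y; apply: nbhs_pinfty_ge; exact: num_real.
have y0 : 0 < y by exact: lt_le_trans My.
rewrite sub0r -mulNr opprK ger0_norm; last by rewrite mulr_ge0 ?powR_ge0// invr_ge0 ltW.
rewrite powRN -invfM -[X in _ <= X]invrK lef_pV2 ?posrE ?invr_gt0//; last first.
  by rewrite mulr_gt0// powR_gt0.
have H : M `^ delta <= y `^ delta by apply: ge0_ler_powR => //; rewrite ?nnegrE ltW.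
have ME : M `^ delta = (delta * eps)^-1.
  by rewrite /M -powRrM mulVf ?gt_eqF// powRr1// invr_ge0 ltW.
rewrite ME in H; have -> : eps^-1 = delta * (delta * eps)^-1 by field; rewrite !gt_eqF.
by apply: ler_wpM2l => //; exact: ltW.
Unshelve. all: by end_near. Qed.

Lemma powR_tail_integral a delta : 0 < a -> 0 < delta ->
  (\int[mu]_(x in `[a, +oo[) (x `^ (- (1 + delta)))%:E = (delta^-1 * a `^ (- delta))%:E)%E.
Proof.
move=> a0 d0; have der x : a <= x -> is_derive x 1 (fun y : R => - delta^-1 * y `^ (- delta)) (x `^ (- (1 + delta))).
  by move=> ax; apply: powR_primitive => //; exact: lt_le_trans ax.
rewrite (@ge0_continuous_FTC2y _ _ (fun y : R => - delta^-1 * y `^ (- delta)) a 0).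
- by rewrite -EFinB sub0r mulNr opprK.
- by move=> x _; exact: powR_ge0.
- apply: derivable_within_continuous => x; rewrite in_itv /= andbT => ax.
  apply: derivable_powR; rewrite in_itv /= andbT; exact: lt_le_trans ax.
- exact: powR_primitive_cvg.
- by move=> x ax; have [] := der x (ltW ax).
- apply: cvg_at_right_filter.
  have [dF _] := der a (lexx a).
  by move/derivable1_diffP/differentiable_continuous : dF.
- move=> x; rewrite in_itv /= andbT => ax.
  by rewrite derive1E; have [_ ->] := der x (ltW ax).
Qed.

(** |x|^(-1-delta), frozen at the value in [a] for |x| < a so that it is
    integrable on the whole line. *)
Definition tailf a delta x : R := (Num.max a `|x|) `^ (- (1 + delta)).

Lemma tailf_ge0 a delta x : 0 <= tailf a delta x.
Proof. exact: powR_ge0. Qed.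

Lemma measurable_tailf a delta : measurable_fun (setT : set R) (tailf a delta).
Proof.
apply: (measurableT_comp (measurable_powR (- (1 + delta)))).
by apply: measurable_maxr; [exact: measurable_cst|exact: normr_measurable].
Qed.

Lemma tailf_integral a delta : 0 < a -> 0 < delta ->
  (\int[mu]_y (tailf a delta y)%:E <= (2 * (1 + delta^-1) * a `^ (- delta))%:E)%E.
Proof.
move=> a0 d0; pose q y := (tailf a delta y)%:E.
have q0 y : (0 <= q y)%E by rewrite lee_fin tailf_ge0.
have mq : measurable_fun (setT : set R) q by apply/measurable_EFinP; exact: measurable_tailf.
have mqT (A : set T) : measurable_fun A q by exact: measurable_funS mq.
(* On the half line: at most a * a^(-1-delta) from [0,a], and the primitive of
   the power beyond. *)
have half : (\int[mu]_(y in `[0%R, +oo[) q y <= ((1 + delta^-1) * a `^ (- delta))%:E)%E.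
  have -> : `[0%R, +oo[%classic = `[0%R, a[%classic `|` `[a, +oo[%classic :> set R.
    apply/seteqP; split => y /=; rewrite !in_itv /= ?andbT.
      by move=> y0; case: (ltP y a) => ya; [left; rewrite y0|right].
    by case=> [/andP[]//|ay]; apply: le_trans ay; exact: ltW.
  rewrite ge0_integral_setU//=; last first.
    by apply/disj_setPS => y /= []; rewrite !in_itv /= andbT => /andP[_ ya]; rewrite leNgt ya.
  rewrite mulrDl mul1r EFinD; apply: leeD.
    rewrite (eq_integral (cst (a `^ (- (1 + delta)))%:E)); last first.
      move=> y; rewrite inE /= in_itv /= => /andP[y0 ya]; by rewrite /q /tailf (ger0_norm y0) max_l// (ltW ya).
    rewrite integral_cst//= lebesgue_measure_itv /= lte_fin a0 sube0 -EFinM lee_fin.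
    have {2}-> : a = a `^ 1 by rewrite powRr1// ltW.
    rewrite -powRD; last by rewrite (gt_eqF a0) implybT.
    by rewrite opprD addrAC addNr add0r.
  rewrite -powR_tail_integral// le_eqVlt; apply/orP; left; apply/eqP.
  apply: eq_integral => y; rewrite inE /= in_itv /= andbT => ay; rewrite /q /tailf.
  by rewrite (ger0_norm (ltW (lt_le_trans a0 ay))) max_r.
have -> : (setT : set T) = `]-oo, 0%R[%classic `|` `[0%R, +oo[%classic :> set R.
  apply/seteqP; split => y //= _; rewrite !in_itv /= andbT; case: (ltP y 0); by [left|right].
rewrite ge0_integral_setU//=; last first.
  by apply/disj_setPS => y /= []; rewrite !in_itv /= andbT => ya; rewrite leNgt ya.
  by move=> y _; exact: q0.
rewrite -mulrA mulr2n mulrDl mul1r EFinD; apply: leeD => //.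
apply: le_trans half; rewrite ge0_integration_by_substitution0//.
apply: (@le_trans _ _ (\int[mu]_(y in `]-oo, 0%R]) q y)%E); last first.
  rewrite le_eqVlt; apply/orP; left; apply/eqP.
  by apply: eq_integral => y _; rewrite /q /tailf normrN.
apply: (@ge0_subset_integral _ T R mu _ _ _ _ q (mqT _)) => //.
by move=> y /=; rewrite !in_itv /=; exact: ltW.
Qed.

(** From ln u <= u - 1 at u = s^gamma. *)
Lemma ln_le_powR (gamma s : R) : 0 < gamma -> 0 < s -> ln s <= gamma^-1 * (s `^ gamma - 1).
Proof.
move=> g0 s0; have p0 : 0 < s `^ gamma by exact: powR_gt0.
have := @le_ln1Dx R (s `^ gamma - 1); rewrite [1 + _]addrC subrK ln_powR => H.
rewrite -(ler_pM2l g0) mulrA mulfV ?gt_eqF// mul1r; apply: H.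
by rewrite ltrBrDr addNr.
Qed.

(** Logarithm against s - 1: this is the cancellation of the diagonal
    singularity 1/|x - y|. *)
Lemma ln_ratio_bound (gamma s : R) : 0 < gamma -> gamma <= 1 -> 1 <= s ->
  ln s <= gamma^-1 * (s `^ (gamma - 1) * (s - 1)).
Proof.
move=> g0 g1 s1; have s0 : 0 < s by exact: lt_le_trans s1.
apply: (le_trans (ln_le_powR g0 s0)); apply: ler_wpM2l; first by rewrite invr_ge0 ltW.
rewrite mulrBr mulr1; apply: lerB.
  have {3}-> : s = s `^ 1 by rewrite powRr1// ltW.
  by rewrite -powRD ?subrK// (gt_eqF s0) implybT.
rewrite -[X in _ <= X](powRr0 s).
by apply: ler_powR => //; rewrite subr_le0.
Qed.

(** With s = |y|/|x| and |x - y| >= |x| (s - 1), the quotient ln(s) s^alpha / |x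
    - y| is at most a constant times s^(delta/2 - 1 + alpha) / |x|, by
    [ln_ratio_bound] with exponent delta/2. As alpha = 1/2 - delta, its square
    is the stated product of powers. *)
Lemma kernel_log_bound alpha delta x y : 0 < alpha < 1 / 2 -> delta = 2^-1 - alpha -> 0 < `|x| -> `|x| <= `|y| -> x <> y ->
  (ln `|y| - ln `|x|) ^+ 2 *
    (((`|x / y| `^ alpha + `|y / x| `^ alpha) / `|x - y|)) ^+ 2 <=
  16 * delta^-1 ^+ 2 * (`|x| `^ (delta - 1) * `|y| `^ (- (1 + delta))).
Proof.
move=> /andP[a0 a2] deltaE x0 xy nxy.
have d0 : 0 < delta by rewrite deltaE; lra.
have y0 : 0 < `|y| by exact: lt_le_trans xy.
have nx : `|x| != 0 by rewrite gt_eqF.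
have ny : `|y| != 0 by rewrite gt_eqF.
pose s := `|y| / `|x|.
have s1 : 1 <= s by rewrite /s ler_pdivlMr// mul1r.
have s0 : 0 < s by exact: lt_le_trans s1.
have -> : ln `|y| - ln `|x| = ln s by rewrite /s ln_div ?posrE.
have -> : `|y / x| = s by rewrite normrM normfV.
have -> : `|x / y| = s^-1 by rewrite normrM normfV /s invf_div.
have dxy : `|x| * (s - 1) <= `|x - y|.
  by rewrite mulrBr mulr1 /s mulrCA mulfV// mulr1 distrC; exact: lerB_dist.
have pxy : 0 < `|x - y| by rewrite normr_gt0 subr_eq0; apply/eqP.
have E : `|x| `^ (delta - 1) * `|y| `^ (- (1 + delta)) = (`|x|^-1 * s `^ (delta / 2 - 1 + alpha)) ^+ 2.
  rewrite !powRE// /s ln_div ?posrE//.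
  have -> : `|x|^-1 = expR (- ln `|x|) by rewrite expRN lnK.
  rewrite -!expRD -expRM_natl; congr expR; rewrite deltaE; by field.
rewrite E -exprMn.
have -> : 16 * delta^-1 ^+ 2 * (`|x|^-1 * s `^ (delta / 2 - 1 + alpha)) ^+ 2 =
  ((delta / 2)^-1 * 2 * (`|x|^-1 * s `^ (delta / 2 - 1 + alpha))) ^+ 2.
  by field; rewrite nx gt_eqF.
have g0 : 0 < delta / 2 by rewrite divr_gt0.
have lns0 : 0 <= ln s by exact: ln_ge0.
rewrite lerXn2r// ?nnegrE.
- by rewrite mulr_ge0// divr_ge0 ?addr_ge0 ?powR_ge0// ltW.
- by rewrite !mulr_ge0 ?powR_ge0 ?invr_ge0// ltW.
have sa : s^-1 `^ alpha + s `^ alpha <= 2 * s `^ alpha.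
  rewrite mulr2n mulrDl mul1r lerD2r; apply: ge0_ler_powR; rewrite ?nnegrE ?invr_ge0 ?(ltW s0) ?(ltW a0)//.
  by apply: (@le_trans _ _ 1) => //; rewrite invf_le1.
have b1 := ln_ratio_bound g0 _ s1.
have {}b1 : ln s <= (delta / 2)^-1 * (s `^ (delta / 2 - 1) * (s - 1)) by apply: b1; rewrite deltaE; lra.
rewrite mulrA ler_pdivrMr//.
apply: (@le_trans _ _ ((delta / 2)^-1 * (s `^ (delta / 2 - 1) * (s - 1)) * (2 * s `^ alpha))).
  by apply: ler_pM => //; rewrite addr_ge0 ?powR_ge0.
have -> : s `^ (delta / 2 - 1 + alpha) = s `^ (delta / 2 - 1) * s `^ alpha.
  by rewrite powRD// (gt_eqF s0) implybT.
have -> : (delta / 2)^-1 * (s `^ (delta / 2 - 1) * (s - 1)) * (2 * s `^ alpha) =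
  (delta / 2)^-1 * 2 * (`|x|^-1 * (s `^ (delta / 2 - 1) * s `^ alpha)) * (`|x| * (s - 1)).
  by field; rewrite nx gt_eqF.
apply: ler_wpM2l => //.
by rewrite !mulr_ge0 ?powR_ge0 ?invr_ge0// ltW.
Qed.

End power_integrals.

(** * Logarithmic cutoffs *)

Lemma meas2_swap {d : measure_display} {T : measurableType d} {R : realType} (D : set T)
  (w : T -> T -> R) : measurable D -> meas2 D w -> meas2 D (fun x y => w y x).
Proof.
move=> mD mw; have mDD : measurable (D `*` D) by exact: measurableX.
rewrite /meas2; have -> : (fun p : T * T => w p.2 p.1) = (fun p => w p.1 p.2) \o unstable.swap by [].
apply: (measurable_comp mDD _ mw); first by move=> _ [[a b] [/= Da Db] <-].
by apply: (@measurable_funS _ _ _ _ setT) => //; exact: measurable_swap.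
Qed.

Section log_cutoff.
Context {R : realType}.
Local Notation T := (measurableTypeR R).
Implicit Types r L x y : R.

(** As ln vanishes at nonpositive arguments, the formula also gives 1 at x = 0. *)
Definition logcut r L x : R := Num.max 0 (Num.min 1 (1 - ln (`|x| / r) / L)).

Lemma logcut_ge0 r L x : 0 <= logcut r L x.
Proof. by rewrite /logcut le_max lexx. Qed.

Lemma logcut_le1 r L x : logcut r L x <= 1.
Proof. by rewrite /logcut ge_max ler01 ge_min lexx. Qed.

Lemma logcut_in r L x : 0 < r -> 0 < L -> `|x| <= r -> logcut r L x = 1.
Proof.
move=> r0 L0 xr; rewrite /logcut min_l ?max_r//.
rewrite lerBrDr gerDl pmulr_lle0 ?invr_gt0//.
by apply: ln_le0; rewrite ler_pdivrMr// mul1r.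
Qed.

Lemma logcut_out r L x : 0 < r -> 0 < L -> r * expR L <= `|x| -> logcut r L x = 0.
Proof.
move=> r0 L0 xr; rewrite /logcut max_l// ge_min; apply/orP; right.
rewrite subr_le0 ler_pdivlMr// mul1r.
have e0 : 0 < expR L by exact: expR_gt0.
have H : expR L <= `|x| / r by rewrite ler_pdivlMr// mulrC.
by rewrite -ler_expR lnK// posrE; apply: lt_le_trans H.
Qed.

Lemma measurable_logcut r L : measurable_fun (setT : set T) (logcut r L).
Proof.
apply: measurable_maxr; first exact: measurable_cst.
apply: measurable_minr; first exact: measurable_cst.
apply: measurable_funB; first exact: measurable_cst.
apply: measurable_funM; last exact: measurable_cst.
apply: (measurableT_comp (@measurable_ln R)).
apply: measurable_funM; last exact: measurable_cst.
exact: normr_measurable.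
Qed.

Lemma bsupp_logcut r L : 0 < r -> 0 < L -> bsupp (logcut r L).
Proof.
move=> r0 L0; split; first exact: measurable_logcut.
- by exists 1 => x; rewrite ger0_norm ?logcut_ge0// logcut_le1.
- exists (r * expR L); split; first by rewrite mulr_gt0// expR_gt0.
  by move=> x /ltW; exact: logcut_out.
Qed.

(** Clipping to the interval [0,1] is 1-Lipschitz. *)
Lemma clip_dist (a b : R) : (Num.max 0 (Num.min 1 a) - Num.max 0 (Num.min 1 b)) ^+ 2 <= (a - b) ^+ 2.
Proof.
wlog ba : a b / b <= a.
  move=> H; case: (leP b a) => [/H//|/ltW/H].
  by rewrite -(sqrrN (_ - _)) opprB -[X in _ <= X -> _](sqrrN (b - a)) opprB.
have [h0 h1] : 0 <= Num.max 0 (Num.min 1 a) - Num.max 0 (Num.min 1 b) /\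
    Num.max 0 (Num.min 1 a) - Num.max 0 (Num.min 1 b) <= a - b.
  by case: (lerP 1 a) => ?; case: (lerP 1 b) => ?; case: (lerP 0 a) => ?; case: (lerP 0 b) => ?;
    rewrite ?(max_r (@ler01 R)); split; lra.
by rewrite lerXn2r// nnegrE// subr_ge0.
Qed.

Lemma logcut_dist r L x y : 0 < r -> 0 < L -> 0 < `|x| -> 0 < `|y| ->
  (logcut r L x - logcut r L y) ^+ 2 <= L^-1 ^+ 2 * (ln `|y| - ln `|x|) ^+ 2.
Proof.
move=> r0 L0 x0 y0; apply: (le_trans (clip_dist _ _)).
rewrite !ln_div ?posrE// le_eqVlt; apply/orP; left; apply/eqP.
by field; rewrite gt_eqF.
Qed.

Lemma logcut_compl r L x : 0 < r -> 0 < L -> r < `|x| ->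
  (1 - logcut r L x) ^+ 2 <= L^-1 ^+ 2 * ln (`|x| / r) ^+ 2.
Proof.
move=> r0 L0 rx.
have rr : `|r| <= r by rewrite ger0_norm// ltW.
have rp : 0 < `|r| by rewrite normr_gt0 gt_eqF.
have x0 : 0 < `|x| by exact: lt_trans rx.
have := @logcut_dist r L r x r0 L0 rp x0.
by rewrite (logcut_in r0 L0 rr) ln_div ?posrE// (ger0_norm (ltW r0)).
Qed.

End log_cutoff.

(** * The variation of the logarithmic cutoff *)

Lemma combine_bounds {R : realType} (a b p q : R) : a * p <= a * q -> b * p <= b * q ->
  a * p + a * p + b * (p + q) <= (2 * a + 2 * b) * q.
Proof. by move=> ha hb; lra. Qed.

Section variation.
Context {R : realType}.
Local Notation T := (measurableTypeR R).
Variables (U : set T) (K : T -> T -> R[i]) (alpha eps : R) (C : R -> R).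
Local Notation mu := (@lebesgue_measure R).
Hypothesis mU : measurable U.
Hypothesis projK : projection_kernel mu U K.
Variable e : nat -> T -> R[i].
Hypothesis he : orthonormal_basis mu U e.
Hypothesis alpha_bounds : 0 < alpha < 1 / 2.
Hypothesis eps0 : 0 < eps.
Hypothesis C0 : forall r : R, 0 < r -> 0 < C r.
Hypothesis K_bound : forall r : R, 0 < r -> forall x y : R, U x -> U y -> x <> y ->
     r <= `|x| -> r <= `|y| ->
     normc (K x y) <= C r * ((`|x / y| `^ alpha + `|y / x| `^ alpha) / `|x - y|).
Hypothesis K_tail : forall r : R, 0 < r -> forall y : R, U y ->
     (\int[mu]_(x in U `&` [set x : R | (`|x| <= r)%R])
         ((normc (K x y)) ^+ 2)%:E
       <= (C r / (1 + `|y| `^ (1 + eps)))%:E)%E.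

(** Integrate first in x over the ball, where the tail hypothesis applies, and
    then in y. *)
Lemma wint_tail r (g M : R) (w : T -> R) : 0 < r -> 0 < g -> 0 <= M ->
  measurable_fun setT w -> (forall y, 0 <= w y) ->
  (forall y : R, w y * (C r / (1 + `|y| `^ (1 + eps))) <= M * tailf r g y) ->
  (wint U K (fun (x y : T) => (ball_ind r x * w y)%R) <= (M * (2 * (1 + g^-1) * r `^ (- g)))%:E)%E.
Proof.
move=> r0 g0 M0 mw w0 wM.
have mk := meas2_k2 projK.
have b0 x : 0 <= ball_ind r x by rewrite /ball_ind.
have m1 : meas2 U (fun x y : T => (ball_ind r x * w y) * k2 K x y).
  apply: meas2M mk; apply: meas2M; [apply: meas2_fst => //; exact: measurable_ball_ind|exact: meas2_snd].
have p1 (x y : T) : 0 <= (ball_ind r x * w y) * k2 K x y by apply: mulr_ge0; [exact: mulr_ge0|exact: k2_ge0].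
rewrite /wint (iint_swap mu mU m1 (fun x y _ _ => p1 x y)).
have mt : measurable_fun (setT : set T) (fun y : T => (tailf r g y)%:E).
  by apply/measurable_EFinP; exact: measurable_tailf.
have t0 (y : T) : (0 <= (tailf r g y)%:E)%E by rewrite lee_fin; exact: tailf_ge0.
apply: (@le_trans _ _ (\int[mu]_(y in U) (M%:E * (tailf r g y)%:E))%E); last first.
  rewrite ge0_integralZl//; last exact: measurable_funS mt.
  rewrite EFinM; apply: lee_wpmul2l; first by rewrite lee_fin.
  apply: le_trans (tailf_integral r0 g0).
  by apply: (@ge0_subset_integral _ T R mu _ _ _ _ _ mt).
have H (y : T) : U y -> (\int[mu]_(x in U) (ball_ind r x * w y * k2 K x y)%:E <= M%:E * (tailf r g y)%:E)%E.
  move=> Uy.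
  apply: (@le_trans _ _ ((w y)%:E * (C r / (1 + `|y : R| `^ (1 + eps)))%:E)%E); last first.
    by rewrite -!EFinM lee_fin; exact: wM.
  have ms : measurable_fun U (fun x : T => k2 K x y).
    exact: (@meas2_sec _ _ _ _ mU (fun a b => k2 K b a) y (meas2_swap mU mk) Uy).
  have -> : (\int[mu]_(x in U) (ball_ind r x * w y * k2 K x y)%:E =
     \int[mu]_(x in U) ((w y)%:E * (ball_ind r x * k2 K x y)%:E))%E.
    by apply: eq_integral => x _; rewrite -EFinM mulrAC mulrC mulrA.
  rewrite ge0_integralZl//.
  - apply: lee_wpmul2l; first by rewrite lee_fin.
    apply: le_trans (K_tail r0 Uy).
    rewrite integral_mkcondr le_eqVlt; apply/orP; left; apply/eqP.
    apply: eq_integral => x _; rewrite patchE /ball_ind.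
    have -> : (x \in [set z : T | `|z : R| <= r]) = (`|x : R| <= r) by apply/idP/idP; rewrite inE.
    by case: (_ <= r); rewrite ?mul1r ?mul0r.
  - apply/measurable_EFinP; apply: measurable_funM => //.
    by apply: (measurable_funS measurableT) => //; exact: measurable_ball_ind.
  - by move=> x _; rewrite lee_fin; apply: mulr_ge0; [exact: b0|exact: k2_ge0].
  - by rewrite lee_fin.
apply: ge0_le_integral => //.
- by move=> y Uy; apply: integral_ge0 => x Ux; rewrite lee_fin.
- have m2 : meas2 U (fun y x : T => (ball_ind r x * w y) * k2 K x y) by exact: (meas2_swap mU m1).
  exact: (@meas_inner_integral _ _ _ mu _ mU _ m2 (fun x y _ _ => p1 y x)).
- apply/measurable_EFinP; apply: measurable_funM; first exact: measurable_cst.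
  by apply: (measurable_funS measurableT) => //; exact: measurable_tailf.
Qed.

(** Valid on both sides of |y| = r, where [tailf] changes its form. *)
Lemma tail_weight r (y : R) : 0 < r -> (1 + `|y| `^ (1 + eps))^-1 <= (1 + r `^ (1 + eps)) * tailf r eps y.
Proof.
move=> r0; have p0 (x : R) : 0 <= x `^ (1 + eps) by exact: powR_ge0.
have q0 (x : R) : 0 < x -> 0 < x `^ (1 + eps) by exact: powR_gt0.
rewrite /tailf powRN; have [yr|ry] := lerP `|y| r.
  rewrite mulrDl mul1r mulfV ?gt_eqF ?q0//.
  apply: (@le_trans _ _ 1); first by rewrite invf_le1 ?lerDl ?ltr_pwDl.
  by rewrite lerDr invr_ge0.
have y0 : 0 < `|y| by exact: lt_trans ry.
apply: (@le_trans _ _ (`|y| `^ (1 + eps))^-1).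
  by rewrite lef_pV2 ?posrE ?lerDr ?ltr_pwDl ?q0.
by rewrite ler_peMl ?invr_ge0// lerDl.
Qed.

Lemma wint_ball_fin r : 0 < r -> (wint U K (fun (x _ : T) => ball_ind r x) < +oo)%E.
Proof.
move=> r0.
have -> : wint U K (fun x _ => ball_ind r x) = wint U K (fun x _ => ball_ind r x * 1).
  by apply: wint_eq => x y; rewrite mulr1.
apply: (@le_lt_trans _ _ _ _ _ (@wint_tail r eps (C r * (1 + r `^ (1 + eps))) (fun=> 1) r0 eps0 _ _ _ _)).
- by rewrite mulr_ge0 ?addr_ge0 ?powR_ge0// ltW// C0.
- exact: measurable_cst.
- by [].
- move=> y; rewrite mul1r -mulrA; apply: ler_wpM2l; last exact: tail_weight.
  by rewrite ltW// C0.
- exact: ltry.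
Qed.

(** 1 - logcut, outside of the ball: the variation of the cutoff between a point
    of the ball and y. *)
Definition outcut r L (x : T) : R := (1 - ball_ind r x) * (1 - logcut r L x).

(** ln(|y|/r)^2 is absorbed by |y|^(eps/2), half of the spare decay. *)
Lemma outcut_tail r L (y : R) : 0 < r -> 0 < L ->
  outcut r L y ^+ 2 * (C r / (1 + `|y| `^ (1 + eps))) <=
  (C r * L^-1 ^+ 2 * (eps / 4)^-1 ^+ 2 * r `^ (- (eps / 2))) * tailf r (eps / 2) y.
Proof.
move=> r0 L0; have c0 := C0 r0.
rewrite /outcut /ball_ind; have [yr|ry] := lerP `|y| r.
  rewrite subrr mul0r expr0n mul0r.
  apply: mulr_ge0; last exact: tailf_ge0.
  apply: mulr_ge0; last exact: powR_ge0.
  by apply: mulr_ge0; [apply: mulr_ge0; [exact: ltW|exact: sqr_ge0]|exact: sqr_ge0].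
have y0 : 0 < `|y| by exact: lt_trans ry.
have yp : 0 < `|y| `^ (1 + eps) by exact: powR_gt0.
rewrite subr0 mul1r /tailf max_r ?(ltW ry)//.
pose s := `|y| / r; have s1 : 1 <= s by rewrite /s ler_pdivlMr// mul1r ltW.
have s0 : 0 < s by exact: lt_le_trans s1.
have h1 : (1 - logcut r L y) ^+ 2 <= L^-1 ^+ 2 * ln s ^+ 2 by exact: logcut_compl.
have g0 : 0 < eps / 4 by rewrite divr_gt0.
have h2 : ln s ^+ 2 <= ((eps / 4)^-1 * s `^ (eps / 4)) ^+ 2.
  rewrite lerXn2r ?nnegrE ?ln_ge0//; first by rewrite mulr_ge0 ?powR_ge0 ?invr_ge0// ltW.
  apply: le_trans (ln_le_powR g0 s0) _; apply: ler_wpM2l; first by rewrite invr_ge0 ltW.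
  by rewrite gerBl.
have h3 : C r / (1 + `|y| `^ (1 + eps)) <= C r * (`|y| `^ (1 + eps))^-1.
  apply: ler_wpM2l; first exact: ltW.
  by rewrite lef_pV2 ?posrE ?lerDr ?ltr_pwDl.
have h4 : C r * L^-1 ^+ 2 * (eps / 4)^-1 ^+ 2 * r `^ (- (eps / 2)) * `|y| `^ (- (1 + eps / 2)) =
   L^-1 ^+ 2 * ((eps / 4)^-1 * s `^ (eps / 4)) ^+ 2 * (C r * (`|y| `^ (1 + eps))^-1).
  have E : r `^ (- (eps / 2)) * `|y| `^ (- (1 + eps / 2)) =
     s `^ (eps / 4) ^+ 2 * (`|y| `^ (1 + eps))^-1.
    rewrite !powRE// /s ln_div ?posrE// -expRN -expRM_natl -!expRD; congr expR; by field.
  by rewrite -[LHS]mulrA E; move: (s `^ _) (_^-1) => p q; move: L^-1 => l; ring.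
rewrite h4; apply: ler_pM => //; first exact: sqr_ge0.
- by rewrite divr_ge0 ?addr_ge0 ?powR_ge0// ltW.
- apply: le_trans h1 _; apply: ler_wpM2l => //; exact: sqr_ge0.
Qed.


Let delta := 2^-1 - alpha.

Let delta0 : 0 < delta. Proof. by rewrite /delta; case/andP: alpha_bounds => ? ?; lra. Qed.

(** The last factor e r^(1/L) is the price of replacing |x|^-1 by |x|^(-1-1/L),
    which is integrable at infinity, on the range |x| <= r e^L where the cutoff
    varies. *)
Definition far_const r L : R := C r ^+ 2 * L^-1 ^+ 2 * (16 * delta^-1 ^+ 2) * (expR 1 * r `^ L^-1).

(** The majorant for r < |x| <= |y|; the maxima make it a genuine function on
    the plane, measurable and integrable. *)
Definition far_major r L (x y : T) : R :=
  far_const r L * (Num.max r `|x : R| `^ (delta - 1 - L^-1) * tailf (Num.max r `|x : R|) delta y).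

Lemma far_const_ge0 r L : 0 <= far_const r L.
Proof.
apply: mulr_ge0; last by rewrite mulr_ge0 ?expR_ge0 ?powR_ge0.
by apply: mulr_ge0; apply: mulr_ge0; rewrite ?sqr_ge0 ?ler0n.
Qed.

Lemma far_major_ge0 r L x y : 0 <= far_major r L x y.
Proof. by rewrite mulr_ge0 ?far_const_ge0// mulr_ge0 ?powR_ge0. Qed.

Lemma meas2_far_major r L : meas2 U (far_major r L).
Proof.
have mm : measurable_fun (setT : set T) (fun x : T => Num.max r `|x : R|).
  by apply: measurable_maxr; [exact: measurable_cst|exact: normr_measurable].
apply: meas2M; first exact: meas2_cst.
apply: meas2M.
  by apply: meas2_fst => //; exact: (measurableT_comp (measurable_powR _) mm).
apply: (measurableT_comp (measurable_powR _)).
have m1 : meas2 U (fun x _ : T => Num.max r `|x : R|) by exact: meas2_fst.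
have m2 : meas2 U (fun _ y : T => `|y : R|) by apply: meas2_snd => //; exact: normr_measurable.
exact: (measurable_maxr m1 m2).
Qed.

(** If |x| >= r e^L the cutoff vanishes at both points. Otherwise |x|^(1/L) <= e
    r^(1/L), which provides the extra exponent -1/L of the majorant. *)
Lemma far_bound r L (x y : T) (k : R) : 0 < r -> 0 < L -> r <= `|x : R| -> `|x : R| <= `|y : R| -> x <> y ->
  0 <= k -> k <= C r * ((`|(x : R) / y| `^ alpha + `|(y : R) / x| `^ alpha) / `|(x : R) - y|) ->
  (logcut r L x - logcut r L y) ^+ 2 * k ^+ 2 <= far_major r L x y.
Proof.
move=> r0 L0 rx xy nxy k0 kC.
have [xL|Lx] := leP (r * expR L) `|x : R|.
  rewrite !logcut_out//; last exact: le_trans xy.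
  by rewrite subrr expr0n mul0r far_major_ge0.
have x0 : 0 < `|x : R| by exact: lt_le_trans rx.
have y0 : 0 < `|y : R| by exact: lt_le_trans xy.
have H1 := logcut_dist r0 L0 x0 y0.
have H2 := kernel_log_bound alpha_bounds (erefl delta) x0 xy nxy.
set q := (_ / `|(x : R) - y|) in kC H2.
have H3 : k ^+ 2 <= C r ^+ 2 * q ^+ 2.
  by rewrite -exprMn lerXn2r// nnegrE//; exact: le_trans kC.
(* Equivalent to ln|x| <= ln r + L, divided by L. *)
have H4 : `|x : R| `^ (delta - 1) <= expR 1 * r `^ L^-1 * `|x : R| `^ (delta - 1 - L^-1).
  rewrite !powRE// -!expRD ler_expR.
  have Ln : L != 0 by rewrite gt_eqF.
  have h : ln `|x : R| <= ln r + L.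
    have -> : ln r + L = ln (r * expR L) by rewrite lnM ?posrE ?expR_gt0// expRK.
    by rewrite ler_ln ?posrE ?mulr_gt0 ?expR_gt0// ltW.
  have {}h : L^-1 * ln `|x : R| <= L^-1 * ln r + 1.
    rewrite -[X in _ + X](mulVf Ln).
    by rewrite -mulrDr; apply: ler_wpM2l h; rewrite invr_ge0 ltW.
  by move: h; move: (ln _) (ln _) L^-1 => a b l h; nra.
have E : far_major r L x y = L^-1 ^+ 2 * (C r ^+ 2 * (16 * delta^-1 ^+ 2 *
   (expR 1 * r `^ L^-1 * `|x : R| `^ (delta - 1 - L^-1) * `|y : R| `^ (- (1 + delta))))).
  rewrite /far_major /far_const /tailf (max_r rx) (max_r xy); ring.
rewrite E.
apply: (@le_trans _ _ (L^-1 ^+ 2 * (ln `|y : R| - ln `|x : R|) ^+ 2 * (C r ^+ 2 * q ^+ 2))).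
  by apply: ler_pM; rewrite ?sqr_ge0.
rewrite -mulrA; apply: ler_wpM2l; first exact: sqr_ge0.
rewrite mulrCA; apply: ler_wpM2l; first exact: sqr_ge0.
apply: (le_trans H2); apply: ler_wpM2l; first by rewrite mulr_ge0// sqr_ge0.
by apply: ler_wpM2r => //; exact: powR_ge0.
Qed.

Definition far_sqdiff r L (x y : T) : R :=
  (1 - ball_ind r x) * (1 - ball_ind r y) * (logcut r L x - logcut r L y) ^+ 2.

(** The two terms of the majorant serve |x| <= |y| and |y| <= |x|. *)
Lemma far_pointwise r L (x y : T) : 0 < r -> 0 < L -> U x -> U y -> x <> y ->
  far_sqdiff r L x y * k2 K x y <= far_major r L x y + far_major r L y x.
Proof.
move=> r0 L0 Ux Uy nxy.
have g0 : 0 <= far_major r L x y + far_major r L y x by rewrite addr_ge0 ?far_major_ge0.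
rewrite /far_sqdiff /ball_ind; have [xr|rx] := lerP `|x : R| r; first by rewrite subrr !mul0r.
have [yr|ry] := lerP `|y : R| r; first by rewrite subrr mulr0 !mul0r.
rewrite !subr0 !mul1r.
have k0 : 0 <= normc (K x y) by exact: normc_ge0.
have kC := K_bound r0 Ux Uy nxy (ltW rx) (ltW ry).
have [xy|/ltW yx] := leP `|x : R| `|y : R|.
  by apply: (le_trans (far_bound r0 L0 (ltW rx) xy nxy k0 kC)); rewrite lerDl far_major_ge0.
apply: (@le_trans _ _ (far_major r L y x)); last by rewrite lerDr far_major_ge0.
rewrite -(sqrrN (_ - _)) opprB.
apply: (far_bound r0 L0 (ltW ry) yx _ k0); first by move=> yxE; exact: nxy.
by rewrite [X in X / _]addrC distrC.
Qed.

(** The integral in y gives |x|^-delta, so that |x|^(-1-1/L) is left, whose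
    integral is of order L r^(-1/L); the power of r cancels that of [far_const]. *)
Lemma iint_far_major r L : 0 < r -> 0 < L ->
  (iint mu U (far_major r L) <= (C r ^+ 2 * 16 * delta^-1 ^+ 2 * expR 1 * 4 * (1 + delta^-1) * ((1 + L) / L ^+ 2))%:E)%E.
Proof.
move=> r0 L0; have Li0 : 0 < L^-1 by rewrite invr_gt0.
pose c2 := far_const r L * (2 * (1 + delta^-1)).
have c20 : 0 <= c2 by rewrite mulr_ge0 ?far_const_ge0// mulr_ge0// addr_ge0// invr_ge0 ltW.
have mt a g : measurable_fun (setT : set T) (fun y : T => (tailf a g y)%:E).
  by apply/measurable_EFinP; exact: measurable_tailf.
have tU a g : 0 < a -> 0 < g -> (\int[mu]_(y in U) (tailf a g y)%:E <= (2 * (1 + g^-1) * a `^ (- g))%:E)%E.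
  move=> a0 g0; apply: le_trans (tailf_integral a0 g0).
  by apply: (@ge0_subset_integral _ T R mu _ _ _ _ _ (mt _ _)) => // y _; rewrite lee_fin; exact: powR_ge0.
have inner (x : T) : U x -> (\int[mu]_(y in U) (far_major r L x y)%:E <= c2%:E * (tailf r L^-1 x)%:E)%E.
  move=> Ux; set m := Num.max r `|x : R|; have m0 : 0 < m by rewrite lt_max r0.
  have -> : (\int[mu]_(y in U) (far_major r L x y)%:E =
     \int[mu]_(y in U) ((far_const r L * m `^ (delta - 1 - L^-1))%:E * (tailf m delta y)%:E))%E.
    by apply: eq_integral => y _; rewrite -EFinM /far_major mulrA.
  have q0 : 0 <= far_const r L * m `^ (delta - 1 - L^-1) by rewrite mulr_ge0 ?far_const_ge0 ?powR_ge0.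
  rewrite ge0_integralZl//.
  - apply: (@le_trans _ _ ((far_const r L * m `^ (delta - 1 - L^-1))%:E * (2 * (1 + delta^-1) * m `^ (- delta))%:E)%E).
      by apply: lee_wpmul2l; [rewrite lee_fin|exact: tU].
    rewrite -!EFinM lee_fin /c2 /tailf -/m.
    have -> : m `^ (- (1 + L^-1)) = m `^ (delta - 1 - L^-1) * m `^ (- delta).
      by rewrite !powRE// -expRD; congr expR; ring.
    by rewrite le_eqVlt; apply/orP; left; apply/eqP; ring.
  - exact: measurable_funS (mt _ _).
  - by move=> y _; rewrite lee_fin; exact: powR_ge0.
apply: (@le_trans _ _ (\int[mu]_(x in U) (c2%:E * (tailf r L^-1 x)%:E))%E).
  apply: ge0_le_integral => //.
  - by move=> x Ux; apply: integral_ge0 => y Uy; rewrite lee_fin far_major_ge0.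
  - exact: (@meas_inner_integral _ _ _ mu _ mU _ (meas2_far_major r L) (fun x y _ _ => far_major_ge0 r L x y)).
  - apply/measurable_EFinP; apply: measurable_funM; first exact: measurable_cst.
    by apply: (measurable_funS measurableT) => //; exact: measurable_tailf.
rewrite ge0_integralZl//; last 2 first.
- exact: measurable_funS (mt _ _).
- by move=> y _; rewrite lee_fin; exact: powR_ge0.
apply: (@le_trans _ _ (c2%:E * (2 * (1 + L) * r `^ (- L^-1))%:E)%E).
  by apply: lee_wpmul2l; [rewrite lee_fin|have := tU _ _ r0 Li0; rewrite invrK].
rewrite -EFinM lee_fin /c2 /far_const powRN.
have rn : r `^ L^-1 != 0 by rewrite gt_eqF// powR_gt0.
have dn : delta != 0 by rewrite gt_eqF.
have Ln : L != 0 by rewrite gt_eqF.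
rewrite le_eqVlt; apply/orP; left; apply/eqP.
by move: rn dn; move: (r `^ _) delta (expR 1) => p d q rn dn; field; rewrite rn dn Ln.
Qed.

Lemma meas2_far_sqdiff r L : meas2 U (far_sqdiff r L).
Proof.
have mb : measurable_fun (setT : set T) (fun x => 1 - ball_ind r x).
  by apply: measurable_funB; [exact: measurable_cst|exact: measurable_ball_ind].
apply: meas2M.
  by apply: meas2M; [exact: meas2_fst|exact: meas2_snd].
apply: meas2X; apply: meas2B; [apply: meas2_fst => //|apply: meas2_snd => //]; exact: measurable_logcut.
Qed.

Lemma ball_ind_compl_ge0 r (x : T) : 0 <= 1 - ball_ind r x.
Proof. by rewrite subr_ge0 /ball_ind lern1 leq_b1. Qed.

Lemma far_sqdiff_ge0 r L x y : 0 <= far_sqdiff r L x y.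
Proof. by rewrite mulr_ge0 ?sqr_ge0// mulr_ge0 ?ball_ind_compl_ge0. Qed.

Lemma wint_far r L : 0 < r -> 0 < L ->
  (wint U K (far_sqdiff r L) <= (C r ^+ 2 * 16 * delta^-1 ^+ 2 * expR 1 * 8 * (1 + delta^-1) * ((1 + L) / L ^+ 2))%:E)%E.
Proof.
move=> r0 L0.
have mk := meas2_k2 projK; have mg := meas2_far_major r L.
have mg' : meas2 U (fun x y => far_major r L y x) by exact: meas2_swap.
have D := iintD mu mU mg mg' (fun x y _ _ => far_major_ge0 r L x y) (fun x y _ _ => far_major_ge0 r L y x).
have S := iint_swap mu mU mg (fun x y _ _ => far_major_ge0 r L x y).
have G := iint_far_major r0 L0.
apply: (@le_trans _ _ (iint mu U (fun x y => far_major r L x y + far_major r L y x))).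
  apply: (iint_le mU).
  - exact: (meas2M (meas2_far_sqdiff r L) mk).
  - exact: (meas2D mg mg').
  - by move=> x y _ _; apply: mulr_ge0; [exact: far_sqdiff_ge0|exact: k2_ge0].
  - by move=> x y Ux Uy nxy; exact: far_pointwise.
  - by move=> x y _ _; rewrite addr_ge0 ?far_major_ge0.
  - by move=> x; exact: lebesgue_measure_set1.
  - by move=> x; exact: measurable_set1.
rewrite D -S.
set c := (X in X%:E); set c' := (X in (_ <= X%:E)%E) in G.
have -> : c = c' + c' by rewrite /c /c'; ring.
by rewrite EFinD; apply: leeD.
Qed.

Lemma measurable_outcut r L : measurable_fun (setT : set T) (outcut r L).
Proof.
apply: measurable_funM; apply: measurable_funB; try exact: measurable_cst.
  exact: measurable_ball_ind.
exact: measurable_logcut.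
Qed.

(** The plane splits into four parts according to whether |x| and |y| exceed r.
    The cutoff is constant on the first one; the two mixed ones have equal
    integrals by [wint_swap]. *)
Lemma wint_logcut r : 0 < r -> exists2 c : R, 0 <= c & forall L, 1 <= L ->
  (wint U K (fun (x y : T) => ((logcut r L x - logcut r L y) ^+ 2)%R) <= (c / L)%:E)%E.
Proof.
move=> r0; have c0 := C0 r0.
pose a := C r * (eps / 4)^-1 ^+ 2 * r `^ (- (eps / 2)) * (2 * (1 + (eps / 2)^-1) * r `^ (- (eps / 2))).
pose b := C r ^+ 2 * 16 * delta^-1 ^+ 2 * expR 1 * 8 * (1 + delta^-1).
have e20 : 0 < eps / 2 by rewrite divr_gt0.
have a0 : 0 <= a.
  apply: mulr_ge0.
    by apply: mulr_ge0; [apply: mulr_ge0; [exact: ltW|exact: sqr_ge0]|exact: powR_ge0].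
  apply: mulr_ge0; last exact: powR_ge0.
  by rewrite mulr_ge0// addr_ge0// invr_ge0 ltW.
have b0 : 0 <= b.
  apply: mulr_ge0; last by rewrite addr_ge0// invr_ge0 ltW.
  do 2! [apply: mulr_ge0; last by rewrite ?expR_ge0].
  by apply: mulr_ge0; [apply: mulr_ge0|]; rewrite ?sqr_ge0 ?ler0n.
exists (2 * a + 2 * b); first by rewrite addr_ge0// mulr_ge0.
move=> L L1; have L0 : 0 < L by exact: lt_le_trans L1.
have i0 (x : T) : 0 <= ball_ind r x by rewrite /ball_ind.
have i2 (x : T) : ball_ind r x ^+ 2 = ball_ind r x.
  by rewrite /ball_ind -natrX; congr (_%:R); case: (_ <= _).
have mb := @measurable_ball_ind R r.
have mo := measurable_outcut r L.
have o1 (x : T) : `|outcut r L x| <= 1.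
  rewrite /outcut normrM -[X in _ <= X]mulr1; apply: ler_pM => //.
    by rewrite ger0_norm ?ball_ind_compl_ge0// gerBl.
  by rewrite ger0_norm ?subr_ge0 ?logcut_le1// gerBl logcut_ge0.
have A1 : (wint U K (fun x y => (ball_ind r x * outcut r L y ^+ 2)%R) <= (a * L^-1 ^+ 2)%:E)%E.
  apply: (le_trans (@wint_tail r (eps / 2) (C r * L^-1 ^+ 2 * (eps / 4)^-1 ^+ 2 * r `^ (- (eps / 2)))
    (fun y => outcut r L y ^+ 2) r0 e20 _ _ _ _)).
  - apply: mulr_ge0; last exact: powR_ge0.
    by apply: mulr_ge0; [apply: mulr_ge0; [exact: ltW|exact: sqr_ge0]|exact: sqr_ge0].
  - exact: measurable_funX.
  - by move=> y; exact: sqr_ge0.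
  - by move=> y; exact: outcut_tail.
  - by rewrite lee_fin /a le_eqVlt; apply/orP; left; apply/eqP; ring.
have nb := @bsupp_ball_ind R r r0.
have SW := @wint_swap _ U K mU projK wint_ball_fin e he (ball_ind r) (outcut r L) nb mo (ex_intro _ 1 o1).
have E1 : wint U K (fun x y => ball_ind r x ^+ 2 * outcut r L y ^+ 2) = wint U K (fun x y => ball_ind r x * outcut r L y ^+ 2).
  by apply: wint_eq => x y; rewrite i2.
rewrite E1 in SW.
have M1 : meas2 U (fun x y => ball_ind r x * outcut r L y ^+ 2).
  by apply: meas2M; [exact: meas2_fst|apply: meas2X; exact: meas2_snd].
have M2 : meas2 U (fun x y => outcut r L x ^+ 2 * ball_ind r y ^+ 2).
  by apply: meas2M; apply: meas2X; [exact: meas2_fst|exact: meas2_snd].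
have P1 (x y : T) : 0 <= ball_ind r x * outcut r L y ^+ 2 by rewrite mulr_ge0 ?sqr_ge0.
have P2 (x y : T) : 0 <= outcut r L x ^+ 2 * ball_ind r y ^+ 2 by rewrite mulr_ge0 ?sqr_ge0.
have D1 := wintD mU projK M1 M2 P1 P2.
have D2 := wintD mU projK (meas2D M1 M2) (meas2_far_sqdiff r L) (fun x y => addr_ge0 (P1 x y) (P2 x y)) (far_sqdiff_ge0 r L).
have -> : wint U K (fun x y => (logcut r L x - logcut r L y) ^+ 2) =
   wint U K (fun x y => ball_ind r x * outcut r L y ^+ 2 + outcut r L x ^+ 2 * ball_ind r y ^+ 2 + far_sqdiff r L x y).
  apply: wint_eq => x y; rewrite /outcut /far_sqdiff /ball_ind.
  have [xr|_] := lerP `|x : R| r; have [yr|_] := lerP `|y : R| r; rewrite /= ?mulr1n ?mulr0n.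
  - by rewrite (logcut_in r0 L0 xr) (logcut_in r0 L0 yr); ring.
  - by rewrite (logcut_in r0 L0 xr); ring.
  - by rewrite (logcut_in r0 L0 yr); ring.
  - by ring.
rewrite D2 D1 -SW.
apply: (@le_trans _ _ ((a * L^-1 ^+ 2)%:E + (a * L^-1 ^+ 2)%:E + (b * ((1 + L) / L ^+ 2))%:E)%E).
  by apply: leeD; [apply: leeD|exact: wint_far].
rewrite -!EFinD lee_fin.
have Ln : L != 0 by rewrite gt_eqF.
have l0 : 0 < L^-1 by rewrite invr_gt0.
have l1 : L^-1 <= 1 by rewrite invf_le1.
have -> : (1 + L) / L ^+ 2 = L^-1 ^+ 2 + L^-1 by field.
have h : L^-1 ^+ 2 <= L^-1.
  by rewrite expr2; apply: ler_piMl l1; exact: ltW l0.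
have ha : a * L^-1 ^+ 2 <= a * L^-1 by apply: ler_wpM2l.
have hb : b * L^-1 ^+ 2 <= b * L^-1 by apply: ler_wpM2l.
exact: combine_bounds.
Qed.

End variation.

(** * Counting the particles of a bounded set from outside *)

(** The sum of the f_n has a finite integral, hence is finite almost everywhere,
    and then its terms tend to 0. *)
Lemma ae_cvg0_of_summable {d : measure_display} {T : measurableType d} {R : realType}
  (mu : {measure set T -> \bar R}) (f : nat -> T -> R) (c : R) : 0 <= c ->
  (forall n, measurable_fun setT (f n)) -> (forall n x, 0 <= f n x) ->
  (forall n, (\int[mu]_x (f n x)%:E <= (c * 2^-1 ^+ n)%:E)%E) ->
  {ae mu, forall x, f n x @[n --> \oo] --> (0 : R)}.
Proof.
move=> c0 mf f0 fc.
pose F x := (\sum_(0 <= n <oo) (f n x)%:E)%E.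
have mfE n : measurable_fun setT (fun x => (f n x)%:E) by apply/measurable_EFinP.
have f0E n x : setT x -> (0 <= (f n x)%:E)%E by rewrite lee_fin.
have intF : mu.-integrable setT F.
  apply/integrableP; split.
    by apply: ge0_emeasurable_sum => // n x _ _; exact: f0E.
  rewrite (eq_integral F); last first.
    by move=> x _; rewrite gee0_abs// /F; apply: nneseries_ge0 => n _ _; rewrite lee_fin.
  rewrite /F integral_nneseries//; apply: (@le_lt_trans _ _ (2 * c)%:E); last exact: ltry.
  apply: lime_le; first by apply: is_cvg_nneseries => n _ _; apply: integral_ge0 => x _; exact: f0E.
  apply: nearW => n.
  apply: (@le_trans _ _ (\sum_(0 <= k < n) (c * 2^-1 ^+ k)%:E)%E).
    by apply: lee_sum => k _; exact: fc.
  rewrite sumEFin lee_fin -mulr_sumr mulrC; apply: ler_wpM2r => //.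
  by rewrite big_mkord; exact: geom_half_le.
apply: filterS (integrable_ae measurableT intF) => x /(_ I) Fx.
have bd n : series (fun n => f n x) n <= fine (F x).
  rewrite -lee_fin fineK// /series /= -sumEFin.
  exact: (@nneseries_lim_ge _ (fun k => (f k x)%:E) xpredT 0%N n (fun k _ _ => f0E k x I)).
apply: (@cvg_series_cvg_0 R R^o (fun n => f n x)).
apply: nondecreasing_is_cvgn.
  by apply/nondecreasing_seqP => n; rewrite /series /= big_nat_recr//= lerDl.
by exists (fine (F x)) => _ [n _ <-].
Qed.

(** The sum is the integer part of [s]. *)
Lemma count_floor {R : realType} (n : nat) (s : R) : 0 <= s <= n%:R ->
  s - 1 <= (\sum_(j < n) ((j.+1%:R <= s)%R : nat))%:R <= s.
Proof.
elim: n s => [|n IH] s /andP[s0 sn].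
  have -> : s = 0 by apply/eqP; rewrite eq_le s0 sn.
  by rewrite big_ord0 lexx andbT sub0r oppr_le0.
rewrite big_ord_recr/=; have [ns|sn'] := leP s n%:R.
  have -> : (n.+1%:R <= s) = false by apply/negbTE; rewrite -ltNge (le_lt_trans ns)// ltr_nat.
  by rewrite addn0; apply: IH; rewrite s0.
have -> : (\sum_(i < n) ((i.+1%:R <= s)%R : nat) = n)%N.
  rewrite -[RHS]card_ord -sum1_card; apply: eq_bigr => i _.
  by have -> : (i.+1%:R <= s) = true by apply: le_trans (ltW sn'); rewrite ler_nat.
rewrite -natr1 in sn; have [h|h] := lerP n.+1%:R s; rewrite /= ?addn0 ?addn1 -?natr1.
  by rewrite -natr1 in h; apply/andP; split; lra.
by apply/andP; split; lra.
Qed.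

Section counting_statistics.
Context {R : realType}.
Local Notation T := (measurableTypeR R).
Variables (G : set_system (conf R)) (D : set R).
Hypothesis GD : forall (A : set R) (S : set nat), measurable A -> bounded_set A -> A `<=` D ->
  G (num_particles A @^-1` S).

Lemma measurable_num_particles (A : set R) : measurable A -> bounded_set A -> A `<=` D ->
  measurable_fun (setT : set (g_sigma_algebraType G)) (fun X : conf R => (num_particles A X)%:R : R).
Proof.
move=> mA bA AD _ Y mY; rewrite setTI; apply: sub_sigma_algebra.
exact: (GD (fun n => Y n%:R) mA bA AD).
Qed.

(** A linear statistic is a limit of combinations of particle counts:
    approximate f from below by the step function with values j/(n+1). The error
    is at most 1/(n+1) for each of the finitely many particles in the ball. *)
Lemma measurable_linstat (f : T -> R) (r : R) : measurable_fun setT f ->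
  (forall x, 0 <= f x <= 1) -> (forall x : R, f x != 0 -> D x) -> (forall x : R, r < `|x| -> f x = 0) ->
  measurable_fun (setT : set (g_sigma_algebraType G)) (linstat f).
Proof.
move=> mf f01 fD fr.
pose A n j := [set x : R | j.+1%:R <= n.+1%:R * f x].
have Apos n j x : A n j x -> f x != 0.
  by rewrite /A /=; apply: contraL => /eqP ->; rewrite mulr0 -ltNge.
have Ar n j x : A n j x -> `|x| <= r.
  by move=> /Apos; rewrite leNgt; apply: contra => /fr ->.
pose S n (X : conf R) : R := n.+1%:R^-1 * \sum_(j < n.+1) (num_particles (A n j) X)%:R.
apply: (@measurable_fun_cvg _ (g_sigma_algebraType G) R setT S).
  move=> n; apply: measurable_funM; first exact: measurable_cst.
  apply: measurable_sum => j; apply: measurable_num_particles.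
  - have -> : A n j = (fun x : T => n.+1%:R * f x) @^-1` `[j.+1%:R, +oo[.
      by apply/seteqP; split => x /=; rewrite /A /= in_itv /= andbT.
    rewrite -[X in measurable X]setTI.
    have mg : measurable_fun (setT : set T) (fun x : T => n.+1%:R * f x).
      by apply: measurable_funM => //; exact: measurable_cst.
    by apply: mg => //; exact: measurable_itv.
  - exists r; split; first exact: num_real.
    by move=> M rM x /Ar xr; exact: le_trans xr (ltW rM).
  - by move=> x /Apos; exact: fD.
move=> X _; have [u [_ uF _ uN]] := conf_list r X.
have E : linstat f X = \sum_(x <- u) f x by exact: uF.
have bd n : linstat f X - n.+1%:R^-1 * (size u)%:R <= S n X <= linstat f X.
  have n0 : 0 < n.+1%:R :> R by [].
  have SE : S n X = \sum_(x <- u) n.+1%:R^-1 * (\sum_(j < n.+1) ((j.+1%:R <= n.+1%:R * f x)%R : nat))%:R.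
    rewrite /S -mulr_sumr; congr (_ * _).
    under eq_bigr => j _ do rewrite (uN (A n j) (@Ar n j)) natr_sum.
    rewrite exchange_big /=; apply: eq_bigr => x _; rewrite natr_sum; apply: eq_bigr => j _.
    by congr ((nat_of_bool _)%:R); apply/idP/idP; rewrite inE.
  have cf x : n.+1%:R * f x - 1 <= (\sum_(j < n.+1) ((j.+1%:R <= n.+1%:R * f x)%R : nat))%:R <= n.+1%:R * f x.
    apply: count_floor; have /andP[h0 h1] := f01 x.
    by rewrite mulr_ge0//= ler_piMr.
  rewrite SE E; apply/andP; split.
    rewrite -sum1_size natr_sum mulr_sumr -sumrB; apply: ler_sum => x _.
    have /andP[h _] := cf x.
    have -> : f x - n.+1%:R^-1 * 1%N%:R = n.+1%:R^-1 * (n.+1%:R * f x - 1).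
      by field.
    by apply: ler_wpM2l => //; rewrite invr_ge0.
  apply: ler_sum => x _; have /andP[_ h] := cf x.
  by rewrite ler_pdivrMl.
apply: (@squeeze_cvgr _ _ _ _ (fun n => linstat f X - n.+1%:R^-1 * (size u)%:R) (fun=> linstat f X)).
- by apply: nearW => n; exact: bd.
- rewrite -[X in _ --> X]subr0; apply: cvgB; first exact: cvg_cst.
  rewrite -[X in _ --> X](mul0r (size u)%:R); apply: cvgM; last exact: cvg_cst.
  exact: cvg_harmonic.
- exact: cvg_cst.
Qed.

End counting_statistics.

Lemma linstat_split {R : realType} (f : R -> R) (B : set R) (r : R) (X : conf R) :
  (forall x, r < `|x| -> f x = 0) -> (forall x, B x -> f x = 1) ->
  linstat f X = (num_particles B X)%:R + linstat (fun x => f x * \1_(~` B) x) X.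
Proof.
move=> fr fB; have [u [_ uF _ uN]] := conf_list r X.
have Br : B `<=` [set x | `|x| <= r].
  move=> x Bx /=; rewrite leNgt; apply/negP => /fr h.
  by have := fB x Bx; rewrite h => /eqP; rewrite eq_sym oner_eq0.
rewrite /linstat uF// (uF (fun x => f x * \1_(~` B) x)); last by move=> x /fr ->; rewrite mul0r.
rewrite (uN B Br) natr_sum -big_split; apply: eq_bigr => x _ /=.
rewrite indicE in_setC; have [xB|xB] := boolP (x \in B); rewrite /= ?mulr1 ?mulr0 ?addr0 ?add0r//.
by rewrite (fB x)//; apply/set_mem.
Qed.

(** Off a null set N, the number #_B is the limit of m_n minus the statistic of
    f_n restricted to the complement of B, by [linstat_split]. Multiplied by the
    indicator of the complement of N, these measurable functions converge
    everywhere; the completion contains N and all its subsets. *)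
Lemma rigid_of_cutoffs {R : realType} (P : probability (confB R) R)
  (B : set R) (f : nat -> R -> R) (rr m : nat -> R) :
  measurable B ->
  (forall n, measurable_fun (setT : set (measurableTypeR R)) (f n : measurableTypeR R -> R)) ->
  (forall n x, 0 <= f n x <= 1) ->
  (forall n x, rr n < `|x| -> f n x = 0) -> (forall n x, B x -> f n x = 1) ->
  {ae P, forall X, (linstat (f n) X - m n) ^+ 2 @[n --> \oo] --> (0 : R)} ->
  forall S : set nat, sigma_count_completed P (~` B) (num_particles B @^-1` S).
Proof.
move=> mB mf f01 fr fB aeP S.
pose G : set_system (conf R) := sigma_count (~` B) `|` P.-negligible.
pose T' := g_sigma_algebraType G.
pose N : set (conf R) := ~` [set X | (linstat (f n) X - m n) ^+ 2 @[n --> \oo] --> (0 : R)].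
have GN : G N by right; exact: aeP.
have mN : measurable (N : set T') by exact: sub_sigma_algebra.
have GD (A : set R) (Z : set nat) : measurable A -> bounded_set A -> A `<=` ~` B ->
    G (num_particles A @^-1` Z).
  by move=> mA bA AB; left; apply: sub_sigma_algebra; exists A, Z.
pose h n (X : conf R) : R := m n - linstat (fun x => f n x * \1_(~` B) x) X.
have mh n : measurable_fun (setT : set T') (h n).
  apply: measurable_funB; first exact: measurable_cst.
  apply: (@measurable_linstat R G (~` B) GD _ (rr n)).
  - apply: measurable_funM => //; apply: measurable_indic; exact: measurableC.
  - move=> x; have /andP[h0 h1] := f01 n x; rewrite indicE.
    by case: (x \in _); rewrite ?mulr1 ?mulr0 ?lexx ?ler01 ?h0.
  - move=> x; rewrite indicE; have [|] := boolP (x \in ~` B); first by move=> /set_mem.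
    by rewrite mulr0 eqxx.
  - by move=> x /fr ->; rewrite mul0r.
have cvh X : ~ N X -> h n X @[n --> \oo] --> ((num_particles B X)%:R : R).
  move=> /contrapT NX; have H n : h n X = (num_particles B X)%:R - (linstat (f n) X - m n).
    by rewrite /h (linstat_split X (fr n) (fB n)); ring.
  rewrite (_ : (fun n => h n X) = (fun n => (num_particles B X)%:R - (linstat (f n) X - m n))); last exact/funext.
  rewrite -[X in _ --> X]subr0; apply: cvgB; first exact: cvg_cst.
  apply/norm_cvg0P.
  have : Num.sqrt ((linstat (f n) X - m n) ^+ 2) @[n --> \oo] --> Num.sqrt (0 : R).
    by apply: continuous_cvg => //; exact: sqrt_continuous.
  by rewrite sqrtr0; under eq_fun do rewrite sqrtr_sqr.
(* Everywhere the limit of h_n times the indicator of the complement of N. *)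
pose q (X : conf R) : R := (num_particles B X)%:R * \1_(~` N) X.
have mq : measurable_fun (setT : set T') q.
  apply: (@measurable_fun_cvg _ T' R setT (fun n X => h n X * \1_(~` N) X)).
    move=> n; apply: measurable_funM => //; apply: measurable_indic; exact: measurableC.
  move=> X _; have [/set_mem NX|NX] := boolP (X \in ~` N).
    by apply: cvgM; [exact: cvh|exact: cvg_cst].
  rewrite /q indicE (negbTE NX) mulr0; under eq_fun do rewrite mulr0; exact: cvg_cst.
have -> : num_particles B @^-1` S =
   (~` N `&` q @^-1` [set n%:R | n in S]) `|` (N `&` num_particles B @^-1` S).
  apply/seteqP; split => X /=.
    move=> SX; have [NX|NX] := pselect (N X); first by right.
    left; split => //; exists (num_particles B X) => //.
    by rewrite /q indicE mem_set// mulr1.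
  case=> [[NX [n Sn]]|[]//]; rewrite /q indicE mem_set// mulr1 => /eqP.
  by rewrite eqr_nat => /eqP <-.
change (measurable (((~` N `&` q @^-1` [set n%:R | n in S]) `|` (N `&` num_particles B @^-1` S)) : set T')).
apply: measurableU.
  apply: measurableI; first exact: measurableC.
  rewrite -[X in measurable X]setTI; apply: mq => //.
  apply: countable_measurable => //.
  by apply: card_le_trans (card_image_le _ _) _; exact: countableP.
apply: sub_sigma_algebra; right.
by case: aeP => A [mA A0 NA]; exists A; split => // X [NX _]; exact: NA.
Qed.

Theorem proposition1p1 (R : realType) (U : set R) (Pi : R -> R -> R[i])
  (alpha eps : R) (C : R -> R) (P : probability (confB R) R)
  (openU : open U)
  (projPi : projection_kernel lebesgue_measure U Pi)
  (trPi : locally_trace_class U (kernel_operator lebesgue_measure U Pi))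
  (alpha_bounds : 0 < alpha < 1 / 2)
  (eps_gt0 : 0 < eps)
  (C_gt0 : forall r : R, 0 < r -> 0 < C r)
  (Pi_bound : forall r : R, 0 < r -> forall x y : R, U x -> U y -> x <> y ->
     r <= `|x| -> r <= `|y| ->
     ComplexField.Normc.normc (Pi x y) <=
       C r * ((`|x / y| `^ alpha + `|y / x| `^ alpha) / `|x - y|))
  (Pi_tail : forall r : R, 0 < r -> forall y : R, U y ->
     (\int[lebesgue_measure]_(x in U `&` [set x : R | (`|x| <= r)%R])
         ((ComplexField.Normc.normc (Pi x y)) ^+ 2)%:E
       <= (C r / (1 + `|y| `^ (1 + eps)))%:E)%E)
  (detP : is_determinantal U Pi P) :
  rigid P.
Proof.
have mU : measurable (U : set (measurableTypeR R)) by exact: open_measurable.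
case: detP => e [he hdet] B mB [M [_ BM]].
pose r := `|M| + 1.
have r0 : 0 < r by rewrite ltr_wpDl.
have Br x : B x -> `|x| <= r.
  by move=> Bx; apply: (BM r) => //; rewrite /r (le_lt_trans (ler_norm M))// ltrDl.
(* With L = 2^n the variances c / (2 L) are summable. *)
pose L n : R := 2 ^+ n.
have L1 n : 1 <= L n by rewrite /L exprn_ege1// ler1n.
have L0 n : 0 < L n by exact: lt_le_trans (L1 n).
have [c c0 Hc] := wint_logcut mU projPi he alpha_bounds eps_gt0 C_gt0 Pi_bound Pi_tail r0.
have fin := wint_ball_fin mU projPi eps_gt0 C_gt0 Pi_tail.
pose f n : R -> R := logcut r (L n).
pose m n := (\int[P]_X linstat (f n) X)%R.
have nf n : bsupp (f n) by exact: bsupp_logcut.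
have f0 n x : 0 <= f n x by exact: logcut_ge0.
have fr n x : r * expR (L n) < `|x| -> f n x = 0 by move=> /ltW; exact: logcut_out.
apply: (@rigid_of_cutoffs R P B f (fun n => r * expR (L n)) m mB).
- by move=> n; exact: measurable_logcut.
- by move=> n x; rewrite logcut_ge0 logcut_le1.
- exact: fr.
- by move=> n x /Br; exact: logcut_in.
apply: (@ae_cvg0_of_summable _ (confB R) R P (fun n X => (linstat (f n) X - m n) ^+ 2) c c0).
- move=> n; apply: measurable_funX; apply: measurable_funB; last exact: measurable_cst.
  exact: (linstat_meas hdet (nf n) (fr n) (f0 n)).
- by move=> n X; exact: sqr_ge0.
move=> n; have [_ V] := linstat_variance mU projPi fin he hdet (nf n) (f0 n).
apply: (le_trans V).
apply: (@le_trans _ _ (1%:E * (c / L n)%:E)%E).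
  apply: lee_pmul => //; [|by rewrite lee_fin invf_le1// ler1n|exact: Hc].
  by apply: wint_ge0 => x y; exact: sqr_ge0.
by rewrite mul1e /L exprVn.
Qed.
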